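(* Let $M\ge1$ be an integer. The moment system $\vec B_M^0\,\partial_t\vec W_M+\vec B_M^1\,\partial_x\vec W_M=\vec S(\vec W_M)$ is strictly hyperbolic, that is, for every admissible state $\vec W_M\in\mathcal G_M$ the matrix $\vec B_M^0$ is invertible and $\vec B_M:=(\vec B_M^0)^{-1}\vec B_M^1$ has $2M+1$ real and pairwise distinct eigenvalues (in particular it is real diagonalizable); moreover the spectral radius of $\vec B_M$ is less than one.
   Context: Units: speed of light and particle rest mass equal to $1$. **Orthogonal polynomials.** For $\zeta>0$ let $K_n(\zeta)=\int_0^\infty\cosh(n\vartheta)e^{-\zeta\cosh\vartheta}d\vartheta$. For $\ell\in\{0,1\}$ let $\omega^{(\ell)}(x;\zeta)=K_1(\zeta)^{-1}(x^2-1)^{\ell-1/2}e^{-\zeta x}$ on $[1,\infty)$ and $(f,g)_{\omega^{(\ell)}}=\int_1^\infty fg\,\omega^{(\ell)}dx$. $\{P_n^{(\ell)}(x;\zeta)\}_{n\ge0}$ are the orthonormal polynomials for $(\cdot,\cdot)_{\omega^{(\ell)}}$ ($\deg P^{(\ell)}_n=n$, leading coefficient $c_n^{(\ell)}>0$); $P_n^{(\ell)}$ has $n$ simple zeros $1<x_{1,n}^{(\ell)}<\dots<x_{n,n}^{(\ell)}$. Put $a_n^{(\ell)}=c_n^{(\ell)}/c_{n+1}^{(\ell)}$, $b_n^{(\ell)}=(xP_n^{(\ell)},P_n^{(\ell)})_{\omega^{(\ell)}}$, $p_n=c_n^{(0)}/c_n^{(1)}$, $q_n=\frac{c_n^{(1)}}{c_{n+1}^{(0)}}\big(\sum_{i=1}^{n+2}x_{i,n+2}^{(0)}-\sum_{i=1}^nx_{i,n}^{(1)}\big)$,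 $r_n=c_{n-1}^{(1)}/c_{n+1}^{(0)}$ ($n\ge1$). **Matrices.** $\vec J_n^{(\ell)}$ is the $(n+1)\times(n+1)$ symmetric tridiagonal matrix with diagonal $b_0^{(\ell)},\dots,b_n^{(\ell)}$ and off-diagonal $a_0^{(\ell)},\dots,a_{n-1}^{(\ell)}$. $\vec J_{n}$ is the $(n+1)\times(n+2)$ matrix whose entries (rows $k=0,\dots,n$, columns $j=0,\dots,n+1$) are $p_k$ at $(k,k)$, $q_k$ at $(k,k+1)$, $r_{k+1}$ at $(k,k+2)$ when $k+2\le n+1$, and $0$ otherwise. Define the $(2M+1)\times(2M+1)$ matrices $$\vec A_M^0=\begin{pmatrix}\vec J_M^{(0)}&0\\0&\vec J_{M-1}^{(1)}\end{pmatrix},\qquad \vec A_M^1=\begin{pmatrix}0&\vec J_{M-1}^T\\ \vec J_{M-1}&0\end{pmatrix}.$$ **Weighted basis.** For $|u|<1$, $\theta>0$ set $\zeta=1/\theta$, $U^0=(1-u^2)^{-1/2}$, $U^1=uU^0$; for $p\in\mathbb R$ set $p^0=\sqrt{1+p^2}$, $E=U^0p^0-U^1p$, $p_{<1>}=-p+U^1E$, $g_{[u,\theta]}=\frac1{2K_1(\zeta)}e^{-\zeta E}$. Let $\tilde P_k^{(0)}[u,\theta]=g_{[u,\theta]}P_k^{(0)}(E;\zeta)$, $\tilde P_k^{(1)}[u,\theta]=g_{[u,\theta]}P_k^{(1)}(E;\zeta)\,p_{<1>}/U^0$. Let $\vec{\mathcal P}_M=(\tilde P_0^{(0)},\tilde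 P_1^{(0)},\tilde P_0^{(1)},\tilde P_2^{(0)},\tilde P_1^{(1)},\dots,\tilde P_M^{(0)},\tilde P_{M-1}^{(1)})^T$; its components are orthonormal for $\langle f,h\rangle=\int_{\mathbb R}\frac{fh}{g_{[u,\theta]}}\frac{dp}{p^0}$. $\vec P_M^p$ is the permutation matrix with $\vec P_M^p(\tilde P_0^{(0)},\dots,\tilde P_M^{(0)},\tilde P_0^{(1)},\dots,\tilde P_{M-1}^{(1)})^T=\vec{\mathcal P}_M$. **Moment system (order $M$).** Unknowns: $\vec W_M=(\rho,u,\theta,\Pi,\tilde n^1,f_3^0,f_2^1,\dots,f_M^0,f_{M-1}^1)^T\in\mathbb R^{2M+1}$ ($\vec W_1=(\rho,u,\theta)^T$, $\vec W_2=(\rho,u,\theta,\Pi,\tilde n^1)^T$). To $\vec W_M$ associate $\vec f_M=(f_0^0,f_1^0,f_0^1,f_2^0,f_1^1,\dots,f_M^0,f_{M-1}^1)^T$: for $M=1$, $\vec f_1=(\rho/c_0^{(0)},0,0)^T$; for $M\ge2$, $f_0^0=\rho/c_0^{(0)}-c_0^{(0)}\Pi$, $f_1^0=c_1^{(0)}x_{1,1}^{(0)}\Pi$, $f_0^1=-c_0^{(1)}\tilde n^1$, $f_2^0=-c_2^{(0)}x_{1,2}^{(0)}x_{2,2}^{(0)}\Pi$, $f_1^1=c_1^{(1)}x_{1,1}^{(1)}\tilde n^1$ (all coefficients at $\zeta=1/\theta$), the remaining components being those of $\vec W_M$. Let $F(\vec W_M;p)=\vec{\mathcal P}_M[u,\theta]^T\vec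 f_M$. $\vec D_M=\vec D_M(\vec W_M)$ is the $(2M+1)\times(2M+1)$ matrix with $(\vec D_M)_{kj}=\langle\partial F/\partial W_j,(\vec{\mathcal P}_M)_k\rangle$ (the coefficients of the orthogonal projection of $\partial F/\partial W_j$ on the span of $\vec{\mathcal P}_M$). Further $$\vec M_M^t=\vec P_M^p(U^0\vec A_M^0-U^1\vec A_M^1)(\vec P_M^p)^T,\quad \vec M_M^x=\vec P_M^p(U^1\vec A_M^0-U^0\vec A_M^1)(\vec P_M^p)^T,$$ $\vec B_M^0=\vec M_M^t\vec D_M$, $\vec B_M^1=\vec M_M^x\vec D_M$; the source $\vec S$ plays no role in hyperbolicity. **Admissible states.** $\mathcal G_M$ is the set of $\vec W_M$ with $\rho>0$, $|u|<1$, $\theta>0$ and, if $M\ge2$, $\Pi>-\rho\theta$. *)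

(* Defs.v *)
From HB Require Import structures.
From mathcomp Require Import all_boot all_order all_algebra.
From mathcomp Require Import all_classical all_reals all_analysis.
From mathcomp Require Import complex polyrcf.
From mathcomp Require Import zify.

Set Implicit Arguments.
Unset Strict Implicit.
Unset Printing Implicit Defensive.

Import Order.TTheory GRing.Theory Num.Theory.
Import numFieldNormedType.Exports.

Local Open Scope classical_set_scope.
Local Open Scope ring_scope.

Definition coshR (R : realType) (x : R) : R := (expR x + expR (- x)) / 2.

Definition bessel_K (R : realType) (n : nat) (zeta : R) : R :=
  \int[lebesgue_measure]_(t in `[0, +oo[)
    (coshR (n%:R * t) * expR (- zeta * coshR t)).

(* At x = 1 and l = 0 the library gives 0 `^ (- 2^-1) = 0; this is a null set. *)
Definition weight (R : realType) (l : nat) (zeta x : R) : R :=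
  (bessel_K 1 zeta)^-1 * (x ^+ 2 - 1) `^ (l%:R - 2^-1) * expR (- zeta * x).

Definition wdot (R : realType) (l : nat) (zeta : R) (f g : R -> R) : R :=
  \int[lebesgue_measure]_(x in `[1, +oo[) (f x * g x * weight l zeta x).

Definition orthonormal_polys (R : realType) (l : nat) (zeta : R)
    (P : nat -> {poly R}) : Prop :=
  (forall n, size (P n) = n.+1 /\ 0 < lead_coef (P n)) /\
  (forall m n, wdot l zeta (horner (P m)) (horner (P n)) = (m == n)%:R).

(* The family is unique; [xget] picks it. *)
Definition opoly (R : realType) (l : nat) (zeta : R) : nat -> {poly R} :=
  xget (fun=> 0) [set P | orthonormal_polys l zeta P].

Definition zeros (R : realType) (l : nat) (zeta : R) (n : nat) : seq R :=
  rootsR (opoly l zeta n).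

Section Coefficients.
Variables (R : realType) (zeta : R).

(* The zeros x_{i,n} are numbered from i = 1 in increasing order. *)
Definition xz (l n i : nat) : R := (zeros l zeta n)`_i.-1.

Definition lc (l n : nat) : R := lead_coef (opoly l zeta n).

Definition rec_a (l n : nat) : R := lc l n / lc l n.+1.

Definition rec_b (l n : nat) : R :=
  wdot l zeta (fun x => x * (opoly l zeta n).[x]) (horner (opoly l zeta n)).

Definition rec_p (n : nat) : R := lc 0 n / lc 1 n.

Definition rec_q (n : nat) : R :=
  lc 1 n / lc 0 n.+1 *
  (\sum_(1 <= i < n.+3) xz 0 n.+2 i - \sum_(1 <= i < n.+1) xz 1 n i).

(* Only used for n >= 1. *)
Definition rec_r (n : nat) : R := lc 1 n.-1 / lc 0 n.+1.

(* The matrices are indexed by their number of rows: [jacobi l n.+1] is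
   J_n^(l) and [jacobi_rect n.+1] is the rectangular J_n. *)
Definition jacobi (l m : nat) : 'M[R]_m :=
  \matrix_(i, j) if i == j then rec_b l i
                 else if j == i.+1 :> nat then rec_a l i
                 else if i == j.+1 :> nat then rec_a l j
                 else 0.

Definition jacobi_rect (m : nat) : 'M[R]_(m, m.+1) :=
  \matrix_(k < m, j < m.+1)
    if j == k :> nat then rec_p k
    else if j == k.+1 :> nat then rec_q k
    else if j == k.+2 :> nat then rec_r k.+1
    else 0.

Definition A0 (M : nat) : 'M[R]_(M.+1 + M) :=
  block_mx (jacobi 0 M.+1) 0 0 (jacobi 1 M).

Definition A1 (M : nat) : 'M[R]_(M.+1 + M) :=
  block_mx 0 (jacobi_rect M)^T (jacobi_rect M) 0.

End Coefficients.

(* A pair (l, k) stands for the basis function built from P_k^(l). The moment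
   order is (0,0), (0,1), (1,0), (0,2), (1,1), ..., (0,M), (1,M-1). *)
Definition moment_label (i : nat) : nat * nat :=
  if i == 0%N then (0, 0)%N
  else if odd i then (0%N, i.+1./2) else (1%N, i./2.-1).

Definition block_label (M : nat) (i : 'I_(M.+1 + M)) : nat * nat :=
  match fintype.split i with
  | inl k => (0%N, nat_of_ord k)
  | inr k => (1%N, nat_of_ord k)
  end.

(* Row i has its 1 in the column that carries the same basis function in the
   block order. *)
Definition perm_matrix (R : realType) (M : nat) : 'M[R]_(M.+1 + M) :=
  \matrix_(i, j) (moment_label i == block_label j)%:R.

Lemma perm_matrixP (R : realType) (M : nat) (v : nat * nat -> R) :
  (0 < M)%N ->
  perm_matrix R M *m (\col_j v (block_label j)) = \col_i v (moment_label i).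
Proof.
move=> M0; apply/matrixP => i j; rewrite !mxE big_split_ord /=.
under eq_bigr => k _ do rewrite !mxE /block_label
  (unsplitK (inl k : 'I_M.+1 + 'I_M)%type).
under [X in _ + X]eq_bigr => k _ do rewrite !mxE /block_label
  (unsplitK (inr k : 'I_M.+1 + 'I_M)%type).
have pE (l1 k1 l2 k2 : nat) :
  ((l1, k1) == (l2, k2)) = (l1 == l2) && (k1 == k2) by [].
have iM := ltn_ord i.
have delta n c l : (c < n)%N ->
    \sum_(k < n) (c == k :> nat)%:R * v (l, nat_of_ord k) = v (l, c).
  move=> cn; rewrite (bigD1 (Ordinal cn)) //= eqxx mul1r big1 ?addr0 // => k kc.
  case: eqP => [ck|_]; last by rewrite mul0r.
  by case/eqP: kc; apply: val_inj.
have E0 n (F : 'I_n -> R) : \sum_(k < n) (false%:R * F k) = 0.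
  by rewrite big1 // => k _; rewrite mul0r.
rewrite /moment_label; case: ifPn => [_|i0].
  under eq_bigr do rewrite pE eqxx /=.
  under [X in _ + X]eq_bigr do rewrite pE /=.
  by rewrite E0 addr0 delta.
have odd_half := odd_double_half i.
case: ifPn => iodd.
  under eq_bigr do rewrite pE eqxx andTb.
  under [X in _ + X]eq_bigr do rewrite pE /=.
  by rewrite E0 addr0 delta //; move: odd_half iM; rewrite iodd; lia.
under eq_bigr do rewrite pE /=.
under [X in _ + X]eq_bigr do rewrite pE eqxx andTb.
rewrite E0 add0r delta //.
by move: odd_half iM i0; rewrite (negbTE iodd); lia.
Qed.

Section WeightedBasis.
Variable R : realType.

Definition U0 (u : R) : R := (Num.sqrt (1 - u ^+ 2))^-1.
Definition U1 (u : R) : R := u * U0 u.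
Definition p0 (p : R) : R := Num.sqrt (1 + p ^+ 2).
Definition energy (u p : R) : R := U0 u * p0 p - U1 u * p.
Definition p_proj (u p : R) : R := - p + U1 u * energy u p.

Definition gJ (u theta p : R) : R :=
  (2 * bessel_K 1 theta^-1)^-1 * expR (- theta^-1 * energy u p).

Definition Ptilde (u theta : R) (lk : nat * nat) (p : R) : R :=
  gJ u theta p * (opoly lk.1 theta^-1 lk.2).[energy u p] *
  (p_proj u p / U0 u) ^+ lk.1.

Definition Pbasis (M : nat) (u theta : R) (i : 'I_(M.+1 + M)) : R -> R :=
  Ptilde u theta (moment_label i).

Definition pdot (u theta : R) (f h : R -> R) : R :=
  \int[lebesgue_measure]_(p in [set: R]) (f p * h p / gJ u theta p / p0 p).

End WeightedBasis.

Section MomentSystem.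
Variables (R : realType) (M : nat).
Implicit Type W : 'cV[R]_(M.+1 + M).

Definition coordW W (k : nat) : R := W (@inord (M + M) k) 0.
Definition rho_ W := coordW W 0.
Definition u_ W := coordW W 1.
Definition theta_ W := coordW W 2.
(* Pi and n1 are components of W only when M >= 2. *)
Definition Pi_ W := coordW W 3.
Definition n1_ W := coordW W 4.

Definition fvec W : 'cV[R]_(M.+1 + M) :=
  let z := (theta_ W)^-1 in
  \col_i
    if M == 1%N then (if i == 0%N :> nat then rho_ W / lc z 0 0 else 0)
    else match nat_of_ord i with
         | 0 => rho_ W / lc z 0 0 - lc z 0 0 * Pi_ W
         | 1 => lc z 0 1 * xz z 0 1 1 * Pi_ W
         | 2 => - lc z 1 0 * n1_ W
         | 3 => - lc z 0 2 * xz z 0 2 1 * xz z 0 2 2 * Pi_ W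
         | 4 => lc z 1 1 * xz z 1 1 1 * n1_ W
         | _ => W i 0
         end.

Definition F W (p : R) : R :=
  \sum_i Pbasis (u_ W) (theta_ W) i p * fvec W i 0.

Definition Dmx W : 'M[R]_(M.+1 + M) :=
  \matrix_(k, j) pdot (u_ W) (theta_ W)
    (fun p => 'D_(delta_mx j 0) (fun W' => F W' p) W)
    (Pbasis (u_ W) (theta_ W) k).

Definition Mt W : 'M[R]_(M.+1 + M) :=
  let z := (theta_ W)^-1 in let u := u_ W in
  perm_matrix R M *m (U0 u *: A0 z M - U1 u *: A1 z M) *m (perm_matrix R M)^T.

Definition Mx W : 'M[R]_(M.+1 + M) :=
  let z := (theta_ W)^-1 in let u := u_ W in
  perm_matrix R M *m (U1 u *: A0 z M - U0 u *: A1 z M) *m (perm_matrix R M)^T.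

Definition B0 W := Mt W *m Dmx W.
Definition B1 W := Mx W *m Dmx W.
Definition Bmx W := invmx (B0 W) *m B1 W.

Definition admissible W : Prop :=
  [/\ 0 < rho_ W, `|u_ W| < 1, 0 < theta_ W
    & (2 <= M)%N -> - (rho_ W * theta_ W) < Pi_ W].

End MomentSystem.

(* All complex eigenvalues are taken into account. *)
Definition spectral_radius (R : realType) (n : nat) (A : 'M[R]_n) : R :=
  sup [set r | exists2 z : R[i],
    eigenvalue (map_mx (real_complex R) A) z & r = ComplexField.Normc.normc z].

Definition real_distinct_spectrum (R : realType) (n : nat) (A : 'M[R]_n) : Prop :=
  exists s : seq R, [/\ size s = n, uniq s & all (eigenvalue A) s].

(* Main.v *)
Require Import Defs.
From HB Require Import structures.
From mathcomp Require Import all_boot all_order all_algebra.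
From mathcomp Require Import all_classical all_reals all_analysis.
From mathcomp Require Import complex polyrcf measurable_realfun.
From mathcomp Require Import zify ring lra.

Set Implicit Arguments.
Unset Strict Implicit.
Unset Printing Implicit Defensive.

Import Order.TTheory GRing.Theory Num.Theory.
Import numFieldNormedType.Exports.

Local Open Scope classical_set_scope.
Local Open Scope ring_scope.

(** In the frame that moves with velocity [u], write [x] for the energy and [s]
    for minus the momentum, so that [s^2 = x^2 - 1]. A function in the span of
    the basis is [g (p(x) + s q(x))] with [deg p <= M] and [deg q <= M - 1], and
    the inner product of two of them is [L (p p' + (x^2 - 1) q q')], where [L]
    integrates polynomials against the normalized weight of index [0]: the
    substitution that proves it is Lorentz invariance of [dp / p0], and the odd
    part in [s] integrates to zero ([pdot_horner]). Every matrix of the theorem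
    can then be read as a form or a map on the pairs [(p, q)].

    The block matrix [A0] is multiplication by [x] and [A1] is multiplication by
    [s], compressed to the span: the coefficients [p_n], [q_n], [r_n] are the
    pairings of [s (s P_k^(1))] with the [P_j^(0)], computed from leading and
    subleading coefficients ([jacobiE], [jacobi_rectE], [flux_form]). Hence
    [M^t] and [M^x] are symmetric, and for [|b| <= 1] the matrix [A0 + b A1] is
    positive definite because [x + b s > 0] on both branches [s = +- sqrt (x^2 -
    1)] ([hyp_form_gt0]). So [M^t] and [M^t +- M^x] are positive definite. When
    [D_M] is invertible, [B_M] is therefore self-adjoint for a scalar product,
    thus diagonalizable over the reals, with eigenvalues in [(-1, 1)]
    ([pencil_hyperbolic]).

    The eigenvalues are simple. An eigenvector for [a] yields a solution of
    [s f = m x f] modulo the orthogonal complement of the span, where [m] is the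
    relativistic difference of the velocities [u] and [a]. With [y = x + s] the
    function [s - m x] is a multiple of [y^-1 (y - c) (y + c)]. If two
    independent solutions existed, a combination would have no [y^M] term; then
    [(y - c) f] lies in the span, and pairing with it gives the integral of a
    square against the positive function [1 + c y^-1], which must vanish
    ([hyp_kernel], [flux_simple]).

    It remains to see that [D_M] is invertible ([Dmx_unit]). Since
    [c_n x_1 ... x_n] is up to sign the value of [P_n] at [0], the ansatz [F] is
    [g] times [rho] minus [Pi] times the kernel of the [P_k^(0)], [k <= 2], at
    the origin, minus [s n^1] times the kernel of the [P_k^(1)], [k <= 1], plus
    the free terms ([FE]). By the reproducing property, pairing with a low degree
    [p + s q] reads [rho L(p) - Pi p(0) - n^1 q(0)]. The derivative in [theta]
    pairs with it as the derivative of [rho L(p)] at frozen [p], and the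
    derivative in [u], which is up to a factor the derivation [x -> s], [s -> x],
    can be moved to the other side by integration by parts. A vector in the
    kernel of [D_M] is then tested against [s x], [x], [x^2], [1] and [s], in
    this order (against [s], [x] and [1] if [M = 1]), and each test kills one
    coordinate: [s x] because [rho L(x^2) + rho theta + Pi > 0], where
    admissibility enters; [x^2] because [L(x^2)] is strictly monotone in [theta]
    while [L(x) = 1]. The remaining coordinates vanish by orthonormality. *)

(** * Moments of the relativistic Maxwellian *)

Section Hyperboloid.
Variable R : realType.
Implicit Types t p u z : R.

Lemma p0_gt0 t : 0 < p0 t.
Proof. by rewrite sqrtr_gt0 ltr_pwDl ?sqr_ge0. Qed.

Lemma p0_ge1 t : 1 <= p0 t.
Proof. by rewrite -[leLHS]sqrtr1 ler_wsqrtr// lerDl sqr_ge0. Qed.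

Lemma sqr_p0 t : p0 t ^+ 2 = 1 + t ^+ 2.
Proof. by rewrite sqr_sqrtr// addr_ge0 ?sqr_ge0. Qed.

Lemma p0_gtn t : `|t| < p0 t.
Proof.
rewrite -(@ltr_pXn2r _ 2) ?nnegrE ?normr_ge0 ?(ltW (p0_gt0 t))//.
by rewrite sqr_p0 real_normK ?num_real// ltrDr.
Qed.

Lemma p0N t : p0 (- t) = p0 t.
Proof. by rewrite /p0 sqrrN. Qed.

Lemma is_derive_compE (f g : R -> R) (x a b c : R) : is_derive x 1 g b ->
  is_derive (g x) 1 f a -> a * b = c -> is_derive x 1 (fun y => f (g y)) c.
Proof.
by move=> dg df <-; exact: (@is_derive1_comp _ f g).
Qed.

Lemma is_derive_funD (f g : R -> R) (x a b : R) : is_derive x 1 f a ->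
  is_derive x 1 g b -> is_derive x 1 (fun y => f y + g y) (a + b).
Proof. by move=> df dg; exact: (@is_deriveD _ _ _ f g). Qed.

Lemma is_derive_funM (f g : R -> R) (x a b : R) : is_derive x 1 f a ->
  is_derive x 1 g b -> is_derive x 1 (fun y => f y * g y) (a * g x + f x * b).
Proof.
move=> df dg; rewrite addrC (mulrC a); exact: (@is_deriveM _ _ f g).
Qed.

Lemma is_derive_funX (f : R -> R) (x a : R) n : is_derive x 1 f a ->
  is_derive x 1 (fun y => f y ^+ n) (n%:R * f x ^+ n.-1 * a).
Proof.
move=> df; have -> : (fun y => f y ^+ n) = f ^+ n by rewrite exprfctE.
exact: (@is_deriveX _ _ f n).
Qed.

Lemma is_derive_continuous (f df : R -> R) :
  (forall x : R, is_derive x 1 f (df x)) -> continuous f.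
Proof.
by move=> h x; apply/differentiable_continuous/derivable1_diffP; case: (h x).
Qed.

Lemma continuous_funD (f g : R -> R) :
  continuous f -> continuous g -> continuous (fun x : R => f x + g x).
Proof. by move=> cf cg x; apply: cvgD; [exact: cf|exact: cg]. Qed.

Lemma continuous_funM (f g : R -> R) :
  continuous f -> continuous g -> continuous (fun x : R => f x * g x).
Proof. by move=> cf cg x; apply: cvgM; [exact: cf|exact: cg]. Qed.

Lemma continuous_funC (f g : R -> R) :
  continuous f -> continuous g -> continuous (fun x : R => f (g x)).
Proof.
by move=> cf cg x; apply: (@continuous_comp _ _ _ g f); [exact: cg|exact: cf].
Qed.

Lemma is_derive_p0 t : is_derive t 1 (@p0 R) (t / p0 t).
Proof.
have h : 0 < 1 + t ^+ 2 by rewrite ltr_pwDl ?sqr_ge0.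
have d1 := is_derive1_sqrt h.
have d2 : is_derive t 1 (fun x : R => 1 + x ^+ 2) (2 * t).
  by apply: is_derive_eq; rewrite /GRing.scale /=; ring.
apply: (is_derive_compE d2 d1); rewrite -/(p0 t); field.
by rewrite gt_eqF ?p0_gt0.
Qed.

Lemma continuous_p0 : continuous (@p0 R).
Proof. exact: is_derive_continuous is_derive_p0. Qed.

Section ExponentialDecay.
Variable c : R.
Hypothesis c0 : 0 < c.
Let mu := @lebesgue_measure R.

Let is_derive_decay t : is_derive t 1 (fun s : R => - expR (- c * s)) (c * expR (- c * t)).
Proof.
have d1 : is_derive t 1 (fun s : R => - c * s) (- c).
  by apply: is_derive_eq; rewrite /GRing.scale /=; ring.
have d2 := is_derive_compE d1 (is_derive_expR (- c * t)) erefl.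
by apply: is_derive_eq; ring.
Qed.

Let continuous_decay (C : R) : continuous (fun t : R => C * expR (- c * t)).
Proof.
apply: (@is_derive_continuous _ (fun t => - c * (C * expR (- c * t)))) => t.
have d1 : is_derive t 1 (fun s : R => - c * s) (- c).
  by apply: is_derive_eq; rewrite /GRing.scale /=; ring.
have d2 := is_derive_compE d1 (is_derive_expR (- c * t)) erefl.
by apply: is_derive_eq; rewrite /GRing.scale /=; ring.
Qed.

Lemma cvg_expR_decay : expR (- c * t) @[t --> +oo] --> (0 : R).
Proof.
under eq_fun do rewrite mulNr.
apply: (cvg_comp (fun t => c * t) (fun t => expR (- t))); last exact: cvgr_expR.
by apply: gt0_cvgMry.
Qed.

Lemma integral_expR_decay :
  (\int[mu]_(t in `[0%R, +oo[) (c * expR (- c * t))%:E = 1)%E.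
Proof.
rewrite (@ge0_continuous_FTC2y _ _ (fun t => - expR (- c * t)) 0 0).
- by rewrite mulr0 expR0 sub0e EFinN oppeK.
- by move=> t _; rewrite mulr_ge0 ?expR_ge0// ltW.
- exact: continuous_subspaceT.
- by rewrite -oppr0; apply: cvgN; exact: cvg_expR_decay.
- by move=> t _; case: (is_derive_decay t).
- by apply: cvg_at_right_filter; exact: (is_derive_continuous is_derive_decay).
- by move=> t _; rewrite derive1E; case: (is_derive_decay t).
Qed.

Lemma integrable_expR_decay (C : R) :
  mu.-integrable `[0, +oo[ (EFin \o (fun t : R => C * expR (- c * t))).
Proof.
have h : mu.-integrable `[0, +oo[ (EFin \o (fun t : R => c * expR (- c * t))).
  apply/integrableP; split.
    apply/measurable_EFinP; apply: measurable_funTS.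
    exact: continuous_measurable_fun.
  under eq_integral => t _.
    rewrite /= ger0_norm; last by rewrite mulr_ge0 ?expR_ge0// ltW.
    over.
  by rewrite integral_expR_decay ltry.
apply: eq_integrable (integrableZl _ (C / c) h) => // t _ /=.
rewrite -EFinM; congr EFin.
by rewrite mulrA divfK ?gt_eqF.
Qed.

(** Adding the dominating exponential makes the integrand nonnegative, where the
    fundamental theorem of calculus on a half-line applies. *)
Lemma FTC_expR_dominated (f F : R -> R) (C C' : R) :
  continuous f -> (forall t, 0 <= t -> `|f t| <= C * expR (- c * t)) ->
  (forall t, is_derive t 1 F (f t)) ->
  (forall t, 0 <= t -> `|F t| <= C' * expR (- c * t)) ->
  \int[mu]_(t in `[0, +oo[) f t = - F 0.
Proof.
move=> cf fC dF FC.
have intf : mu.-integrable `[0, +oo[ (EFin \o f).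
  apply: le_integrable (integrable_expR_decay C) => //.
    apply/measurable_EFinP; apply: measurable_funTS.
    exact: continuous_measurable_fun.
  move=> t /=; rewrite in_itv/= andbT => t0.
  by rewrite lee_fin (le_trans (fC _ t0))// ler_norm.
have F0 : F t @[t --> +oo] --> (0 : R).
  apply/norm_cvg0P.
  have h : C' * expR (- c * t) @[t --> +oo] --> (0 : R).
    by rewrite -[0](mulr0 C'); apply: cvgM; [exact: cvg_cst|exact: cvg_expR_decay].
  apply: squeeze_cvgr h; last exact: cvg_cst.
  near=> t; rewrite normr_ge0/=; apply: FC.
  by near: t; exact: nbhs_pinfty_ge.
have dG t : is_derive t 1 (fun s => F s + (C / c) * - expR (- c * s))
    (f t + C * expR (- c * t)).
  have d1 := dF t; have d2 := is_derive_decay t.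
  apply: is_derive_eq; rewrite /GRing.scale /=.
  by field; rewrite gt_eqF.
have := @Rintegral_ge0_continuous_FTC2y _ (fun t => f t + C * expR (- c * t))
  (fun s => F s + (C / c) * - expR (- c * s)) 0 0.
rewrite RintegralD//; last exact: integrable_expR_decay.
have -> : \int[mu]_(t in `[0, +oo[) (C * expR (- c * t)) = C / c.
  have CE t : C * expR (- c * t) = C / c * (c * expR (- c * t)).
    by rewrite mulrA divfK// gt_eqF.
  under eq_Rintegral do rewrite CE.
  rewrite RintegralZl//; last exact: integrable_expR_decay.
  by rewrite [X in _ * X]/Rintegral integral_expR_decay mulr1.
rewrite mulr0 expR0 => H.
suff : \int[mu]_(x in `[0, +oo[) f x + C / c = 0 - (F 0 + C / c * -1) by lra.
apply: H.
- move=> t t0; have := fC _ t0; rewrite ler_norml => /andP[+ _]; lra.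
- by apply: continuous_subspaceT; apply: continuous_funD.
- rewrite -[0](addr0 0); apply: cvgD => //.
  rewrite -[0](mulr0 (C / c)); apply: cvgM; first exact: cvg_cst.
  by rewrite -oppr0; apply: cvgN; exact: cvg_expR_decay.
- by move=> t _; case: (dG t).
- have := is_derive_continuous dG => /(_ 0)/cvg_at_right_filter.
  by rewrite mulr0 expR0.
- by move=> t _; rewrite derive1E; case: (dG t).
Unshelve. all: by end_near. Qed.

End ExponentialDecay.

(** The integrand [x^(k-1) e^(-z x)], [x = sqrt (1 + t^2)], of the [k]-th
    moment of the Maxwell-Juttner weight in the variable [t = sinh]. *)
Definition mker z k t := p0 t ^+ k / p0 t * expR (- z * p0 t).

Definition mom z k := \int[@lebesgue_measure R]_(t in `[0, +oo[) mker z k t.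

Lemma mker_ge0 z k t : 0 <= mker z k t.
Proof. by rewrite mulr_ge0 ?expR_ge0// divr_ge0 ?exprn_ge0// ltW ?p0_gt0. Qed.

Lemma mker_gt0 z k t : 0 < mker z k t.
Proof. by rewrite mulr_gt0 ?expR_gt0// divr_gt0 ?exprn_gt0// ?p0_gt0. Qed.

Lemma continuous_mker z k : continuous (mker z k).
Proof.
apply: continuous_funM.
  apply: continuous_funM.
    by apply: (@continuous_funC (fun x => x ^+ k)); [exact: exprn_continuous|exact: continuous_p0].
  by move=> t; apply: cvgV; [rewrite gt_eqF ?p0_gt0|exact: continuous_p0].
apply: (continuous_funC (@continuous_expR R)).
by apply: continuous_funM; [exact: cst_continuous|exact: continuous_p0].
Qed.

(** Powers are absorbed by half of the exponential decay. *)
Lemma mker_decay z k : 0 < z ->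
  exists C, forall t, mker z k t <= C * expR (- (z / 2) * `|t|).
Proof.
move=> z0; exists (k.+1`!%:R * (2 / z) ^+ k.+1) => t.
have x1 := p0_ge1 t; have x0 := p0_gt0 t.
have z20 : 0 < z / 2 by lra.
have step1 : p0 t ^+ k / p0 t <= p0 t ^+ k.+1.
  rewrite ler_pdivrMr// -exprSr.
  by apply: ler_weXn2l => //; rewrite -addn2 leq_addr.
have step2 : p0 t ^+ k.+1 <= k.+1`!%:R * (2 / z) ^+ k.+1 * expR (z / 2 * p0 t).
  have : 0 <= z / 2 * p0 t by rewrite mulr_ge0// ltW.
  move/(expR_ge1Dxn k) => h.
  have {}h : (z / 2 * p0 t) ^+ k.+1 / k.+1`!%:R <= expR (z / 2 * p0 t) by lra.
  move: h; rewrite ler_pdivrMr ?ltr0n ?fact_gt0// exprMn => h.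
  rewrite -[2 / z]invf_div exprVn mulrAC ler_pdivlMr ?exprn_gt0//.
  by rewrite mulrC (le_trans h)// mulrC.
rewrite /mker (le_trans (ler_wpM2r (expR_ge0 _) (le_trans step1 step2)))//.
rewrite -[leLHS]mulrA; apply: ler_wpM2l.
  by rewrite mulr_ge0// exprn_ge0// divr_ge0// ltW.
rewrite -expRD ler_expR.
have := ltW (p0_gtn t) => h.
have := ler_wpM2l (ltW z20) h; lra.
Qed.

Lemma mom_integrable z k : 0 < z ->
  lebesgue_measure.-integrable `[0, +oo[ (EFin \o mker z k).
Proof.
move=> z0; have [C hC] := mker_decay k z0.
have z20 : 0 < z / 2 by lra.
apply: le_integrable (integrable_expR_decay z20 C) => //.
  apply/measurable_EFinP; apply: measurable_funTS.
  exact: continuous_measurable_fun (@continuous_mker z k).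
move=> t /=; rewrite in_itv/= andbT => t0.
rewrite lee_fin ger0_norm ?mker_ge0// (le_trans (hC t))//.
by rewrite ger0_norm// ler_norm.
Qed.

(** Integrate the derivative of [t x^k e^(-z x)], [x = sqrt (1 + t^2)]. *)
Lemma mom_by_parts z k : 0 < z ->
  z * (mom z k.+2 - mom z k) = k.+1%:R * mom z k.+1 - k%:R * mom z k.-1.
Proof.
move=> z0; have z20 : 0 < z / 2 by lra.
pose F t := t * p0 t ^+ k * expR (- z * p0 t).
pose f t := k.+1%:R * mker z k.+1 t - k%:R * mker z k.-1 t
            - z * (mker z k.+2 t - mker z k t).
have int := mom_integrable _ z0.
have intZ C j : lebesgue_measure.-integrable `[0, +oo[ (EFin \o (fun t => C * mker z j t)).
  by apply: eq_integrable (integrableZl _ C (int j)) => // t _.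
have intB C j C' j' : lebesgue_measure.-integrable `[0, +oo[
    (EFin \o (fun t => C * mker z j t - C' * mker z j' t)).
  by apply: eq_integrable (integrableB _ (intZ C j) (intZ C' j')) => // t _.
have intB1 j j' : lebesgue_measure.-integrable `[0, +oo[
    (EFin \o (fun t => mker z j t - mker z j' t)).
  by apply: eq_integrable (integrableB _ (int j) (int j')) => // t _.
suff : \int[lebesgue_measure]_(t in `[0, +oo[) f t = 0.
  rewrite /f RintegralB//; last first.
    by apply: eq_integrable (integrableZl _ z (intB1 k.+2 k)) => // t _.
  rewrite RintegralB// !RintegralZl// RintegralB// -!/(mom _ _); lra.
have [C0 h0] := mker_decay k.+2 z0; have [C1 h1] := mker_decay k.+1 z0.
have [C2 h2] := mker_decay k.-1 z0; have [C3 h3] := mker_decay k z0.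
have F0 : - F 0 = 0 by rewrite /F !mul0r oppr0.
rewrite -[RHS]F0.
apply: (@FTC_expR_dominated (z / 2) z20 f F
  (k.+1%:R * C1 + k%:R * C2 + z * (C0 + C3)) C0).
- have cm j C : continuous (fun t => C * mker z j t).
    by apply: continuous_funM; [exact: cst_continuous|exact: continuous_mker].
  have -> : f = (fun t => (k.+1%:R * mker z k.+1 t + - k%:R * mker z k.-1 t)
            + (- z * mker z k.+2 t + z * mker z k t)).
    by apply/funext => t; rewrite /f; ring.
  by do 2?apply: continuous_funD.
- move=> t t0; rewrite /f.
  have := h0 t; have := h1 t; have := h2 t; have := h3 t.
  rewrite (ger0_norm t0).
  have := mker_ge0 z k.+2 t; have := mker_ge0 z k.+1 t.
  have := mker_ge0 z k.-1 t; have := mker_ge0 z k t.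
  set e := expR _; move: (mker _ _ _) (mker _ _ _) (mker _ _ _) (mker _ _ _).
  move=> a b c d a0 b0 c0 d0 ha hb hc hd.
  have k0 : 0 <= k%:R :> R by [].
  rewrite -natr1.
  have ka := mulr_ge0 k0 b0; have kb := mulr_ge0 k0 c0.
  have za := mulr_ge0 (ltW z0) a0; have zd := mulr_ge0 (ltW z0) d0.
  have := ler_wpM2l k0 hb; have := ler_wpM2l k0 hc.
  have := ler_wpM2l (ltW z0) ha; have := ler_wpM2l (ltW z0) hd.
  by rewrite ler_norml => *; apply/andP; split; lra.
- move=> t.
  have d1 := is_derive_p0 t.
  have d2 : is_derive t 1 (fun s : R => - z * p0 s) (- z * (t / p0 t)).
    by apply: is_derive_eq; rewrite /GRing.scale /=; ring.
  have d3 := is_derive_compE d2 (is_derive_expR (- z * p0 t)) erefl.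
  have d4 := is_derive_funX k d1.
  have := is_derive_funM (is_derive_funM (is_derive_id _ _) d4) d3.
  move=> d5; apply: (is_derive_eq d5); rewrite /f /mker /=.
  have p00 : p0 t != 0 by rewrite gt_eqF ?p0_gt0.
  have tE : t ^+ 2 = p0 t ^+ 2 - 1 by rewrite sqr_p0; ring.
  move: (expR _) => e; case: (k) => [|j].
    transitivity (e - z * e * t ^+ 2 / p0 t); first by field.
    by rewrite tE; field.
  rewrite /= !exprS -!natr1; move: (p0 t ^+ j) => X.
  transitivity (p0 t * X * e + t ^+ 2 * ((j%:R + 1) * X / p0 t * e - z * X * e)).
    by field.
  by rewrite tE; field.
- move=> t t0; rewrite /F !normrM normrX (gtr0_norm (p0_gt0 t)) (gtr0_norm (expR_gt0 _)).
  have := h0 t; rewrite (ger0_norm t0); apply: le_trans.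
  rewrite -{1}(ger0_norm t0) ler_wpM2r ?expR_ge0//.
  rewrite exprSr mulfK ?gt_eqF ?p0_gt0// exprSr mulrC ler_wpM2l//.
    by rewrite exprn_ge0// ltW// p0_gt0.
  exact/ltW/p0_gtn.
Qed.

Lemma is_derive_mker t k z : is_derive z 1 (mker^~ k ^~ t) (- mker z k.+1 t).
Proof.
have d1 : is_derive z 1 (fun x : R => - x * p0 t) (- p0 t).
  have d0 := is_deriveNid z 1.
  have := is_derive_funM d0 (is_derive_cst (p0 t) z 1).
  by rewrite mulN1r mulr0 addr0.
have d2 := is_derive_compE d1 (is_derive_expR (- z * p0 t)) erefl.
have := is_derive_funM (is_derive_cst (p0 t ^+ k / p0 t) z 1) d2.
move=> d3; apply: (is_derive_eq d3); rewrite /mker exprS /=.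
by field; rewrite gt_eqF ?p0_gt0.
Qed.

Lemma is_derive_mom k z : 0 < z ->
  is_derive z 1 (mom^~ k) (- mom z k.+1).
Proof.
move=> z0; have Iz : `]z / 2, z + 1[%classic z by rewrite /= in_itv/=; lra.
have pos x : `]z / 2, z + 1[%classic x -> 0 < x by rewrite /= in_itv/=; lra.
have mI : measurable (`[0%R, +oo[%classic : set (measurableTypeR R)).
  exact: measurable_itv.
have int x : `]z / 2, z + 1[%classic x -> lebesgue_measure.-integrable `[0, +oo[
    (EFin \o (fun x => mker x k) x).
  by move=> /pos x0; exact: mom_integrable.
have der x t : `]z / 2, z + 1[%classic x -> `[0%R, +oo[%classic t ->
    derivable (mker^~ k ^~ t) x 1.
  by move=> _ _; case: (is_derive_mker t k x).
have G0 t : 0 <= mker (z / 2) k.+1 t by exact: mker_ge0.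
have z20 : 0 < z / 2 by lra.
have dE x t : (mker^~ k ^~ t)^`()%classic x = - mker x k.+1 t.
  by rewrite derive1E; case: (is_derive_mker t k x).
have ub x t : `]z / 2, z + 1[%classic x -> `[0%R, +oo[%classic t ->
    `|partial1of2 (fun x => mker x k) x t| <= mker (z / 2) k.+1 t.
  move=> /= /[!in_itv]/= /andP[zx _] _.
  rewrite /partial1of2 dE normrN ger0_norm ?mker_ge0//.
  rewrite /mker ler_wpM2l//.
    by rewrite divr_ge0 ?exprn_ge0// ltW// p0_gt0.
  by rewrite ler_expR ler_wpM2r ?lerN2 1?ltW// p0_gt0.
have h1 := derivable_under_integral mI Iz int der G0 (mom_integrable _ z20) ub.
have h2 := differentiation_under_integral mI Iz int der G0 (mom_integrable _ z20) ub.
apply: DeriveDef => //.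
rewrite -derive1E h2.
under eq_Rintegral do rewrite /partial1of2 dE -mulN1r.
by rewrite RintegralZl ?mulN1r//; exact: mom_integrable.
Qed.

End Hyperboloid.

(** * Bessel and weighted integrals as moments *)

Section MomentSubstitution.
Variable R : realType.
Implicit Types t s u z x : R.
Let leb := @lebesgue_measure R.

Lemma p0_sub_mul t : (p0 t - t) * (p0 t + t) = 1.
Proof. by rewrite -subr_sqr sqr_p0; ring. Qed.

Lemma p0_addt_gt0 t : 0 < p0 t + t.
Proof. by have := p0_gtn t; rewrite ltr_norml => /andP[]; lra. Qed.

Lemma p0_subt_gt0 t : 0 < p0 t - t.
Proof. by have := p0_gtn t; rewrite ltr_norml => /andP[]; lra. Qed.

Lemma p0_sub_le t : 0 < t -> p0 t - t <= t^-1.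
Proof.
move=> t0; have := p0_sub_mul t; have := p0_subt_gt0 t; have := p0_gtn t.
rewrite gtr0_norm// => h1 h2 h3; rewrite -[leRHS]mul1r ler_pdivlMr//; nra.
Qed.

Lemma cvg_p0 : @p0 R t @[t --> +oo] --> +oo.
Proof.
apply/cvgryPge => A; near=> t.
apply: (@le_trans _ _ t); first by near: t; by apply: nbhs_pinfty_ge; rewrite num_real.
by have := p0_subt_gt0 t; lra.
Unshelve. all: by end_near. Qed.

Lemma cvg_inv_p0 : (@p0 R t)^-1 @[t --> +oo] --> (0 : R).
Proof.
apply/cvgrPdist_le => e e0; near=> t.
have t0 : 0 < t by near: t; by apply: nbhs_pinfty_gt; rewrite num_real.
have te : e^-1 <= t by near: t; by apply: nbhs_pinfty_ge; rewrite num_real.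
rewrite sub0r normrN ger0_norm ?invr_ge0 ?(ltW (p0_gt0 _))//.
rewrite -[leRHS]invrK lef_pV2 ?posrE ?invr_gt0 ?p0_gt0//.
by have := p0_subt_gt0 t; lra.
Unshelve. all: by end_near. Qed.

Lemma cvg_div_p0 : t / @p0 R t @[t --> +oo] --> (1 : R).
Proof.
apply/cvgrPdist_le => e e0; near=> t.
have t0 : 0 < t by near: t; by apply: nbhs_pinfty_gt; rewrite num_real.
have te : e^-1 <= t by near: t; by apply: nbhs_pinfty_ge; rewrite num_real.
have x0 := p0_gt0 t; have x1 := p0_ge1 t.
have -> : 1 - t / p0 t = (p0 t - t) / p0 t by field; rewrite gt_eqF.
rewrite ger0_norm; last by rewrite divr_ge0// ltW// p0_subt_gt0.
rewrite ler_pdivrMr//.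
have h1 := p0_sub_le t0.
have : t^-1 <= e by rewrite -[leRHS]invrK lef_pV2 ?posrE ?invr_gt0.
nra.
Unshelve. all: by end_near. Qed.

Lemma cvg_div_p0Ny : t / @p0 R t @[t --> -oo] --> (-1 : R).
Proof.
apply/cvgNy_compNP.
rewrite (_ : _ \o _ = (fun t : R => - (t / p0 t))); last first.
  by apply/funext => t /=; rewrite p0N mulNr.
by apply: cvgN; exact: cvg_div_p0.
Qed.

Lemma continuous_div_p0 : continuous (fun t : R => t / p0 t).
Proof.
apply: continuous_funM; first by move=> t; exact: cvg_id.
by move=> t; apply: cvgV; [rewrite gt_eqF ?p0_gt0|exact: continuous_p0].
Qed.

Lemma ltr_p0 t s : 0 <= t -> t < s -> p0 t < p0 s.
Proof.
move=> t0 ts; rewrite -(@ltr_pXn2r _ 2) ?nnegrE ?(ltW (p0_gt0 _))//.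
rewrite !sqr_p0 ltrD2l ltr_pXn2r// ?nnegrE//.
by rewrite (le_trans t0)// ltW.
Qed.

Lemma ler_p0 t s : 0 <= t -> t <= s -> p0 t <= p0 s.
Proof.
by move=> t0; rewrite le_eqVlt => /predU1P[->//|ts]; rewrite ltW// ltr_p0.
Qed.

(** The substitution [x = cosh s], [t = sinh s] in the Bessel integral. *)
Lemma bessel_K1E z : bessel_K 1 z = mom z 1.
Proof.
pose G s := coshR (1%:R * s) * expR (- z * coshR s).
pose F t := ln (t + p0 t).
have d t : is_derive t 1 F (p0 t)^-1.
  have d1 := is_derive_funD (is_derive_id t 1) (is_derive_p0 t).
  have tp : 0 < t + p0 t by rewrite addrC p0_addt_gt0.
  apply: (is_derive_compE d1 (is_derive1_ln tp)).
  have x0 := p0_gt0 t; field.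
  by rewrite !gt_eqF.
have F'E : F^`()%classic = (fun t => (p0 t)^-1).
  by apply/funext => t; rewrite derive1E; case: (d t).
have F0 : F 0 = 0 by rewrite /F /p0 expr0n /= addr0 sqrtr1 add0r ln1.
have cV : continuous (fun t => (p0 t)^-1).
  by move=> t; apply: cvgV; [rewrite gt_eqF ?p0_gt0|exact: continuous_p0].
have ccosh : continuous (@coshR R).
  move=> s; apply: cvgM; last exact: cvg_cst.
  apply: cvgD; first exact: continuous_expR.
  apply: (@continuous_funC _ (@expR R) (fun t => - t)).
    exact: continuous_expR.
  by move=> t; apply: cvgN; exact: cvg_id.
have cG : continuous G.
  apply: continuous_funM.
    apply: continuous_funC => //; apply: continuous_funM.
      exact: cst_continuous.
    by move=> t; exact: cvg_id.
  apply: continuous_funC; first exact: continuous_expR.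
  by apply: continuous_funM => //; exact: cst_continuous.
rewrite /bessel_K /mom /Rintegral -/leb; congr fine.
have := @increasing_ge0_integration_by_substitutiony R F G 0.
rewrite F0 => ->.
- apply: eq_integral => t _; rewrite F'E; congr EFin.
  transitivity (G (F t) * (p0 t)^-1) => //; rewrite /G /mker mul1r expr1.
  have -> : coshR (F t) = p0 t.
    have tp : 0 < t + p0 t by rewrite addrC p0_addt_gt0.
    rewrite /coshR expRN /F lnK ?posrE//.
    have -> : (t + p0 t)^-1 = p0 t - t.
      by rewrite -[LHS]mul1r -(p0_sub_mul t) [p0 t + t]addrC mulfK ?gt_eqF.
    by field.
  by rewrite mulrAC.
- move=> t s; rewrite !in_itv/= !andbT => t0 s0 ts.
  rewrite ltr_ln ?posrE; last 2 first.
    by rewrite addrC p0_addt_gt0.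
    by rewrite addrC p0_addt_gt0.
  by rewrite ltrD// ltr_p0.
- by rewrite F'E => t _; exact: cV.
- rewrite F'E; apply/cvg_ex; exists (p0 0)^-1; apply: cvg_at_right_filter.
  exact: cV.
- by rewrite F'E; apply/cvg_ex; exists 0; exact: cvg_inv_p0.
- split; first by move=> t _; case: (d t).
  by apply: cvg_at_right_filter; exact: (is_derive_continuous d).
- apply/cvgryPge => A; near=> t.
  have tA : expR A <= t by near: t; by apply: nbhs_pinfty_ge; rewrite num_real.
  rewrite -[A]expRK ler_ln ?posrE ?expR_gt0//.
    by have := p0_gt0 t; lra.
  by rewrite addrC p0_addt_gt0.
- exact: continuous_subspaceT.
- move=> s _; rewrite mulr_ge0 ?expR_ge0//.
  by rewrite divr_ge0// addr_ge0 ?expR_ge0.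
Unshelve. all: by end_near. Qed.

Lemma continuous_weight0 z k x : 1 < x -> {for x, continuous
  (fun x => x ^+ k / Num.sqrt (x ^+ 2 - 1) * expR (- z * x))}.
Proof.
move=> x1; have s0 : 0 < x ^+ 2 - 1 by rewrite subr_gt0 exprn_egt1.
apply: cvgM; last first.
  apply: (@continuous_funC _ (@expR R)); first exact: continuous_expR.
  by apply: continuous_funM; [exact: cst_continuous|move=> t; exact: cvg_id].
apply: cvgM; first exact: exprn_continuous.
apply: cvgV; first by rewrite gt_eqF// sqrtr_gt0.
apply: (@continuous_funC _ Num.sqrt (fun x => x ^+ 2 - 1)).
  exact: sqrt_continuous.
by move=> t; apply: cvgB; [exact: exprn_continuous|exact: cvg_cst].
Qed.

Lemma measurable_weight0 z k : measurable_fun `](1 : R), +oo[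
  (fun x => x ^+ k / Num.sqrt (x ^+ 2 - 1) * expR (- z * x)).
Proof.
apply: open_continuous_measurable_fun => // x.
by rewrite inE/= in_itv/= andbT ; exact: continuous_weight0.
Qed.

(** The singular substitution [x = sqrt (1 + t^2)] at [x = 1]: on [x >= p0 a]
    with [a > 0] the integrand is continuous, and these rays exhaust
    the half-line. *)
Lemma integral_weight0 z k :
  (\int[leb]_(x in `[1%R, +oo[)
     (x ^+ k / Num.sqrt (x ^+ 2 - 1) * expR (- z * x))%:E
   = \int[leb]_(t in `[0%R, +oo[) (mker z k t)%:E)%E.
Proof.
pose h x := x ^+ k / Num.sqrt (x ^+ 2 - 1) * expR (- z * x).
pose a n : R := n.+1%:R^-1.
have a0 n : 0 < a n by rewrite invr_gt0.
have p0a n : 1 < p0 (a n).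
  by have := ltr_p0 (lexx 0) (a0 n); rewrite {1}/p0 expr0n /= addr0 sqrtr1.
have le_a i j : (i <= j)%N -> a j <= a i.
  by move=> ij; rewrite lef_pV2 ?posrE ?ltr0n// ler_nat ltnS.
have le_p0a i j : (i <= j)%N -> p0 (a j) <= p0 (a i).
  by move=> /le_a; apply: ler_p0; rewrite ltW.
have a_arch s : 0 < s -> exists n, a n <= s.
  move=> s0; have [n] := ltr_add_invr s0; rewrite add0r => ns.
  by exists n; exact: ltW.
have ch x : 1 < x -> {for x, continuous h} by exact: continuous_weight0.
have h0 x : 1 < x -> 0 <= h x.
  move=> x1; rewrite mulr_ge0 ?expR_ge0// divr_ge0 ?sqrtr_ge0// exprn_ge0//; lra.
have cm := continuous_measurable_fun (@continuous_mker R z k).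
have mh := measurable_weight0 z k.
rewrite -integral_itv_obnd_cbnd; last exact/measurable_EFinP.
rewrite -[RHS]integral_itv_obnd_cbnd; last first.
  by apply/measurable_EFinP; exact: measurable_funTS.
have d := @is_derive_p0 R.
have dE : (@p0 R)^`()%classic = (fun t => t / p0 t).
  by apply/funext => t; rewrite derive1E; case: (d t).
have step n : (\int[leb]_(x in `[p0 (a n), +oo[) (h x)%:E =
    \int[leb]_(t in `[a n, +oo[) (mker z k t)%:E)%E.
  rewrite increasing_ge0_integration_by_substitutiony.
  - apply: eq_integral => t; rewrite inE/= in_itv/= andbT => at_; congr EFin.
    have t0 : 0 < t by rewrite (lt_le_trans (a0 n)).
    rewrite dE; transitivity (h (p0 t) * (t / p0 t)) => //; rewrite /h /mker.
    rewrite sqr_p0 [1 + _]addrC addrK sqrtr_sqr gtr0_norm//.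
    by have := p0_gt0 t => x0; field; rewrite !gt_eqF.
  - move=> t s; rewrite !in_itv/= !andbT => t0 s0; apply: ltr_p0.
    by rewrite (le_trans _ t0)// ltW.
  - by rewrite dE => t _; exact: continuous_div_p0.
  - rewrite dE; apply/cvg_ex; exists (a n / p0 (a n)); apply: cvg_at_right_filter.
    exact: continuous_div_p0.
  - by rewrite dE; apply/cvg_ex; exists 1; exact: cvg_div_p0.
  - split; first by move=> t _; case: (d t).
    by apply: cvg_at_right_filter; exact: continuous_p0.
  - exact: cvg_p0.
  - apply/continuous_within_itvcyP; split.
      move=> x; rewrite in_itv/= andbT => px; apply: ch.
      exact: lt_trans px.
    by apply: cvg_at_right_filter; exact: ch.
  - move=> x; rewrite in_itv/= andbT => px; apply: h0.
    exact: lt_trans px.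
have cvgL : (\int[leb]_(x in `[p0 (a i), +oo[) (h x)%:E @[i --> \oo] -->
    \int[leb]_(x in \bigcup_i `[p0 (a i), +oo[%classic) (h x)%:E)%E.
  apply: ge0_nondecreasing_set_cvg_integral.
  - move=> i j ij; apply/subsetPset => t /=; rewrite !in_itv/= !andbT.
    by apply: le_trans; exact: le_p0a.
  - by move=> i; exact: measurable_itv.
  - move=> i; apply/measurable_EFinP; apply: measurable_funS mh => //.
    by move=> x /=; rewrite !in_itv/= !andbT; exact: lt_le_trans.
  - by move=> i x /=; rewrite in_itv/= andbT => ?; rewrite lee_fin h0// (lt_le_trans (p0a i)).
have cvgR : (\int[leb]_(t in `[a i, +oo[) (mker z k t)%:E @[i --> \oo] -->
    \int[leb]_(t in \bigcup_i `[a i, +oo[%classic) (mker z k t)%:E)%E.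
  apply: ge0_nondecreasing_set_cvg_integral.
  - move=> i j ij; apply/subsetPset => t /=; rewrite !in_itv/= !andbT.
    by apply: le_trans; exact: le_a.
  - by move=> i; exact: measurable_itv.
  - by move=> i; apply/measurable_EFinP; exact: measurable_funTS.
  - by move=> i t _; rewrite lee_fin mker_ge0.
have -> : `](1 : R), +oo[%classic = \bigcup_i `[p0 (a i), +oo[%classic.
  apply/seteqP; split => x /=; rewrite !in_itv/= !andbT; last first.
    by move=> [i _] /=; rewrite !in_itv/= !andbT; exact: lt_le_trans.
  move=> x1; have s0 : 0 < x ^+ 2 - 1 by rewrite subr_gt0 exprn_egt1.
  have [n] := a_arch (Num.sqrt (x ^+ 2 - 1)) ltac:(by rewrite sqrtr_gt0).
  move=> an; exists n => //=; rewrite in_itv/= andbT.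
  have xE : p0 (Num.sqrt (x ^+ 2 - 1)) = x.
    rewrite /p0 sqr_sqrtr ?ltW// addrC subrK sqrtr_sqr ger0_norm//; lra.
  by rewrite -xE; apply: ler_p0 an; rewrite ltW.
have -> : `](0 : R), +oo[%classic = \bigcup_i `[a i, +oo[%classic.
  apply/seteqP; split => x /=; rewrite !in_itv/= !andbT.
    by move=> /a_arch[n an]; exists n => //=; rewrite in_itv/= andbT.
  by move=> [i _] /=; rewrite !in_itv/= !andbT; exact: lt_le_trans.
move: cvgL; under eq_fun do rewrite step.
by move=> /cvg_lim <-//; move: cvgR => /cvg_lim <-.
Qed.

Lemma integrable_weight0 z k : 0 < z -> leb.-integrable `[1, +oo[
  (EFin \o (fun x => x ^+ k / Num.sqrt (x ^+ 2 - 1) * expR (- z * x))).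
Proof.
move=> z0; apply/integrableP; split.
  apply/measurable_EFinP/measurable_fun_itv_obnd_cbndP.
  exact: measurable_weight0.
under eq_integral => x.
  rewrite inE/= in_itv/= andbT => x1.
  rewrite ger0_norm; last first.
    rewrite mulr_ge0 ?expR_ge0// divr_ge0 ?sqrtr_ge0// exprn_ge0//; lra.
  over.
rewrite integral_weight0.
have /integrableP[_] := mom_integrable k z0; apply: le_lt_trans.
by under [leRHS]eq_integral do rewrite /= ger0_norm ?mker_ge0//.
Qed.

Lemma mker_signed_ge0 z k e t : -1 <= e <= 1 ->
  0 <= mker z k t * (1 + e * (t / p0 t)).
Proof.
move=> /andP[e1 e2]; rewrite mulr_ge0 ?mker_ge0//.
have x0 := p0_gt0 t; have h := p0_gtn t.
have : `|t / p0 t| < 1 by rewrite normf_div (gtr0_norm x0) ltr_pdivrMr ?mul1r.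
by rewrite ltr_norml => /andP[]; nra.
Qed.

(** The odd part integrates to zero, so only the even part of
    [x^(k-1) (1 + e t / x)] survives. *)
Lemma integral_mker_signed z k e : 0 < z -> -1 <= e <= 1 ->
  (\int[leb]_(t in [set: R]) (mker z k t * (1 + e * (t / p0 t)))%:E
   = (2 * mom z k)%:E)%E.
Proof.
move=> z0 e1; pose G t := mker z k t * (1 + e * (t / p0 t)).
have G0 t : 0 <= G t by exact: mker_signed_ge0.
have cG : continuous G.
  apply: continuous_funM; first exact: continuous_mker.
  apply: continuous_funD; first exact: cst_continuous.
  by apply: continuous_funM; [exact: cst_continuous|exact: continuous_div_p0].
have mG := continuous_measurable_fun cG.
have -> : [set: R] = `]-oo, 0] `|` `]0, +oo[.
  apply/seteqP; split => // t _ /=; rewrite !in_itv/= andbT.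
  by case: (leP t 0); [left|right].
rewrite ge0_integral_setU//=; last 3 first.
- by apply/measurable_EFinP; exact: measurable_funTS.
- by move=> t _; rewrite lee_fin G0.
- apply/disj_setPS => t /=; rewrite !in_itv/= andbT => -[t0 t1].
  by move: (lt_le_trans t1 t0); rewrite ltxx.
rewrite integral_itv_obnd_cbnd; last first.
  by apply/measurable_EFinP; exact: measurable_funTS.
have := @ge0_integration_by_substitutionNy R G 0; rewrite oppr0 => ->.
- rewrite -ge0_integralD//=.
  + under eq_integral => t _.
      rewrite -EFinD (_ : _ + _ = 2 * mker z k t); last first.
        by rewrite /G /mker p0N; ring.
      over.
    under eq_integral do rewrite EFinM.
    rewrite ge0_integralZl_EFin//=.
    - by rewrite EFinM /mom /Rintegral fineK// integrable_fin_num// mom_integrable.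
    - by move=> t _; rewrite lee_fin mker_ge0.
    - apply/measurable_EFinP; apply: measurable_funTS.
      exact: continuous_measurable_fun (@continuous_mker R z k).
  + by move=> t _; rewrite lee_fin.
  + apply/measurable_EFinP; apply: measurable_funTS.
    exact: (measurableT_comp mG).
  + by move=> t _; rewrite lee_fin G0.
  + by apply/measurable_EFinP; exact: measurable_funTS.
- exact: continuous_subspaceT.
- by move=> t _.
Qed.

End MomentSubstitution.

(** * Moment functionals on polynomials *)

Section MomentFunctional.
Variable R : realType.
Implicit Types (m : nat -> R) (A B : {poly R}).

(** The Riesz functional of the moment sequence [m]. *)
Definition momfun m A : R := \sum_(i < size A) A`_i * m i.

Arguments momfun m A : simpl never.

Lemma momfun_widen m n A : (size A <= n)%N -> momfun m A = \sum_(i < n) A`_i * m i.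
Proof.
move=> An; rewrite /momfun (big_ord_widen n (fun i => A`_i * m i) An) big_mkcond /=.
apply: eq_bigr => i _; case: ltnP => // Ai.
by rewrite nth_default ?mul0r.
Qed.

Lemma momfun_is_linear m : linear_for *%R (momfun m).
Proof.
move=> a A B; pose n := maxn (size (a *: A + B)) (maxn (size A) (size B)).
rewrite !(@momfun_widen _ n) ?leq_max ?leqnn ?orbT//.
rewrite mulr_sumr -big_split; apply: eq_bigr => i _ /=.
by rewrite coefD coefZ; ring.
Qed.

HB.instance Definition _ m :=
  GRing.isLinear.Build R {poly R} R *%R (momfun m) (momfun_is_linear m).

Lemma momfun_MXaddC m A c : momfun m (A * 'X + c%:P) = momfun (m \o S) A + c * m 0.
Proof.
rewrite (@momfun_widen _ (size A).+1); last first.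
  rewrite -cons_poly_def size_cons_poly; case: ifP => // _.
rewrite big_ord_recl addrC; congr (_ + _).
  by apply: eq_bigr => i _; rewrite coefD coefMX coefC /= addr0.
by rewrite coefD coefMX coefC /= add0r.
Qed.

Lemma momfunZ m a A : momfun (fun i => a * m i) A = a * momfun m A.
Proof. by rewrite mulr_sumr; apply: eq_bigr => i _; rewrite mulrCA. Qed.

Lemma momfunXn m n : momfun m 'X^n = m n.
Proof.
rewrite (@momfun_widen _ n.+1) ?size_polyXn// big_ord_recr big1 /=.
  by rewrite coefXn eqxx mul1r add0r.
by move=> i _; rewrite coefXn ltn_eqF ?mul0r.
Qed.

Lemma momfun_scale m a A : momfun m (a *: A) = a * momfun m A.
Proof. exact: linearZ. Qed.

Lemma momfunD m A B : momfun m (A + B) = momfun m A + momfun m B.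
Proof. exact: linearD. Qed.

Lemma momfunN m A : momfun m (- A) = - momfun m A.
Proof. exact: linearN. Qed.

Lemma momfunB m A B : momfun m (A - B) = momfun m A - momfun m B.
Proof. exact: linearB. Qed.

Lemma momfun0 m : momfun m 0 = 0.
Proof. exact: linear0. Qed.

Lemma momfun_sum m I (r : seq I) (Q : pred I) (F : I -> {poly R}) :
  momfun m (\sum_(i <- r | Q i) F i) = \sum_(i <- r | Q i) momfun m (F i).
Proof. exact: linear_sum. Qed.

(** By induction on [A], with the weight [e x * w x] for the quotient of [A] by
    ['X]. *)
Lemma integral_horner (D : set (measurableTypeR R)) (e w : R -> R) m A :
  measurable D ->
  (forall k, lebesgue_measure.-integrable D (EFin \o (fun x => e x ^+ k * w x))) ->
  (forall k, \int[lebesgue_measure]_(x in D) (e x ^+ k * w x) = m k) ->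
  lebesgue_measure.-integrable D (EFin \o (fun x => A.[e x] * w x)) /\
  \int[lebesgue_measure]_(x in D) (A.[e x] * w x) = momfun m A.
Proof.
move=> mD; elim/poly_ind: A w m => [|A c IH] w m intw wm.
  split.
    by apply: eq_integrable (integrable0 _ _) => // x _; rewrite /= horner0 mul0r.
  under eq_Rintegral do rewrite horner0 mul0r.
  by rewrite linear0 Rintegral_cst ?mul0r.
have [||int1 e1] := IH (fun x => e x * w x) (m \o S).
- move=> k; apply: eq_integrable (intw k.+1) => // x _.
  by rewrite /= exprSr mulrA.
- move=> k /=; rewrite -wm; apply: eq_Rintegral => x _.
  by rewrite exprSr mulrA.
have int2 : lebesgue_measure.-integrable D (EFin \o w).
  by apply: eq_integrable (intw 0) => // x _; rewrite /= expr0 mul1r.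
have e2 : \int[lebesgue_measure]_(x in D) w x = m 0.
  by rewrite -wm; apply: eq_Rintegral => x _; rewrite expr0 mul1r.
have int3 : lebesgue_measure.-integrable D (EFin \o (fun x => c * w x)).
  by apply: eq_integrable (integrableZl _ c int2) => // x _.
have E x : (A * 'X + c%:P).[e x] * w x = A.[e x] * (e x * w x) + c * w x.
  by rewrite hornerMXaddC; ring.
split.
  by apply: eq_integrable (integrableD _ int1 int3) => // x _; rewrite /= E.
under eq_Rintegral do rewrite E.
by rewrite RintegralD// RintegralZl// e1 e2 momfun_MXaddC.
Qed.

End MomentFunctional.

Section MomentIntegrals.
Variable R : realType.
Implicit Types (z u p t : R) (A : {poly R}).
Let leb := @lebesgue_measure R.

Let mkerE z k t : p0 t ^+ k * mker z 0 t = mker z k t.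
Proof. by rewrite /mker expr0 mul1r !mulrA. Qed.

Lemma momfun_momE z A : 0 < z ->
  leb.-integrable `[0, +oo[ (EFin \o (fun t => A.[p0 t] * mker z 0 t)) /\
  \int[leb]_(t in `[0, +oo[) (A.[p0 t] * mker z 0 t) = momfun (mom z) A.
Proof.
move=> z0; apply: integral_horner => // k.
  apply: eq_integrable (mom_integrable k z0) => // t _.
  by rewrite /= mkerE.
by apply: eq_Rintegral => t _; rewrite mkerE.
Qed.

(** By continuity [f] stays above half of [f t0] on an interval next to [t0]. *)
Lemma Rintegral_gt0 (f : R -> R) t0 : continuous f ->
  (forall t, 0 <= t -> 0 <= f t) -> leb.-integrable `[0, +oo[ (EFin \o f) ->
  0 < t0 -> 0 < f t0 -> 0 < \int[leb]_(t in `[0, +oo[) f t.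
Proof.
move=> cf f0 intf t00 ft0.
have [e e0 he] : exists2 e, 0 < e & forall t, `|t - t0| <= e -> f t0 / 2 <= f t.
  have /cvgrPdist_lt/(_ (f t0 / 2)) := cf t0.
  rewrite divr_gt0// => /(_ isT) /nbhs_ballP[e /= e0 he].
  exists (e / 2); first by rewrite divr_gt0.
  move=> t te; have := he t; rewrite /ball /= distrC => /(_ _)/wrap[].
    by rewrite (le_lt_trans te)// ltr_pdivrMr// ltr_pMr// ltr1n.
  by rewrite ltr_distl => /andP[]; lra.
pose d := Num.min e (t0 / 2).
have d0 : 0 < d by rewrite lt_min e0/= divr_gt0.
have sub : `[t0, t0 + d] `<=` `[0, +oo[.
  by move=> t /=; rewrite !in_itv/= andbT => /andP[h _]; apply: le_trans h; exact: ltW.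
have intd : leb.-integrable `[t0, t0 + d] (EFin \o f).
  exact: integrableS intf.
apply: (@lt_le_trans _ _ (\int[leb]_(t in `[t0, t0 + d]) f t)).
  apply: (@lt_le_trans _ _ (f t0 / 2 * d)); first by rewrite mulr_gt0// divr_gt0.
  have -> : f t0 / 2 * d = \int[leb]_(t in `[t0, t0 + d]) (f t0 / 2).
    rewrite Rintegral_cst//= lebesgue_measure_itv/= lte_fin ltrDl d0.
    by rewrite -EFinD/= addrAC subrr add0r.
  apply: le_Rintegral => //.
    apply: continuous_compact_integrable; first exact: segment_compact.
    by apply: continuous_subspaceT; exact: cst_continuous.
  move=> t /=; rewrite in_itv/= => /andP[h1 h2]; apply: he.
  rewrite ger0_norm ?subr_ge0//.
  by rewrite lerBlDl (le_trans h2)// lerD2l ge_min lexx.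
rewrite /Rintegral fine_le ?integrable_fin_num//.
apply: ge0_subset_integral => //.
  by case/integrableP: intf.
by move=> t /=; rewrite in_itv/= andbT lee_fin => /f0.
Qed.

Lemma momfun_mom_gt0 z A : 0 < z -> A != 0 ->
  (forall x, 1 <= x -> 0 <= A.[x]) -> 0 < momfun (mom z) A.
Proof.
move=> z0 A0 Apos; have [int <-] := momfun_momE A z0.
have [t0 t00 At0] : exists2 t, 0 < t & A.[p0 t] != 0.
  pose s := [seq p0 (i.+1%:R : R) | i <- iota 0 (size A)].
  have us : uniq s.
    rewrite map_inj_in_uniq ?iota_uniq// => i j _ _.
    move=> /(congr1 (fun x => x ^+ 2)); rewrite !sqr_p0 => /addrI/eqP.
    by rewrite eqrXn2// => /eqP/(mulrIn (oner_neq0 _))/succn_inj.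
  have : ~~ all (root A) s.
    apply/negP => h; have := max_poly_roots A0 h us.
    by rewrite size_map size_iota ltnn.
  move=> /allPn[_ /mapP[i _ ->] ri].
  by exists i.+1%:R.
apply: (Rintegral_gt0 (t0 := t0)) => //.
- apply: continuous_funM; last exact: continuous_mker.
  apply: (@continuous_funC _ (horner A)); first exact: continuous_horner.
  exact: continuous_p0.
- by move=> t _; rewrite mulr_ge0 ?mker_ge0// Apos ?p0_ge1.
- by rewrite mulr_gt0 ?mker_gt0// lt_neqAle eq_sym At0 Apos ?p0_ge1.
Qed.

Lemma mom_gt0 z k : 0 < z -> 0 < mom z k.
Proof.
move=> z0; rewrite -momfunXn; apply: momfun_mom_gt0 => //.
  by rewrite -size_poly_gt0 size_polyXn.
by move=> x x1; rewrite hornerXn exprn_ge0// (le_trans ler01).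
Qed.

Lemma weightE l z x : (l < 2)%N -> 1 <= x ->
  weight l z x = (mom z 1)^-1 *
    ((x ^+ 2 - 1) ^+ l * (x ^+ 0 / Num.sqrt (x ^+ 2 - 1) * expR (- z * x))).
Proof.
move=> l2 x1; rewrite /weight bessel_K1E -!mulrA; congr (_ * _).
rewrite expr0 mul1r mulrA; congr (_ * _).
have s0 : 0 <= x ^+ 2 - 1 by rewrite subr_ge0 exprn_ege1.
case: l l2 => [|[|//]] _.
  by rewrite expr0 mul1r sub0r powRN powR12_sqrt.
rewrite expr1 -{2}(sqr_sqrtr s0) -powR12_sqrt//.
rewrite (_ : 1%:R - 2^-1 = 2^-1); last by rewrite /=; field.
have [->|n0] := eqVneq ((x ^+ 2 - 1) `^ 2^-1) 0.
  by rewrite expr0n /= mul0r.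
by rewrite expr2 mulfK.
Qed.

(** The weight of index [1] is [x^2 - 1] times the weight of index [0], so both
    inner products come from the same moments. *)
Lemma wdot_horner l z (A B : {poly R}) : (l < 2)%N -> 0 < z ->
  wdot l z (horner A) (horner B) =
  momfun (mom z) (A * B * ('X^2 - 1) ^+ l) / mom z 1.
Proof.
move=> l2 z0; pose w x := x ^+ 0 / Num.sqrt (x ^+ 2 - 1) * expR (- z * x).
have [|||int e] := @integral_horner R `[1, +oo[ id w (mom z) (A * B * ('X^2 - 1) ^+ l).
- exact: measurable_itv.
- move=> k; apply: eq_integrable (integrable_weight0 k z0) => // x _.
  by rewrite /= /w expr0 mul1r !mulrA.
- move=> k; rewrite /mom /Rintegral -integral_weight0; congr fine.
  by apply: eq_integral => x _; rewrite /w expr0 mul1r !mulrA.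
rewrite -e mulrC -RintegralZl//.
apply: eq_Rintegral => x; rewrite inE/= in_itv/= andbT => x1.
rewrite weightE// !hornerM horner_exp !hornerE /=.
by rewrite -/(w x); ring.
Qed.

End MomentIntegrals.

(** * Lorentz boosts and the momentum inner product *)

Section BoostLimits.
Variable R : realType.
Implicit Types (c v p q : R).

Lemma boost_incr c v p q : 0 < c -> `|v| < 1 -> p < q ->
  c * (p - v * p0 p) < c * (q - v * p0 q).
Proof.
move=> c0 v1 pq; rewrite ltr_pM2l// -subr_gt0.
have a1 := p0_gtn p; have a2 := p0_gtn q.
have hs : (p0 q - p0 p) * (p0 q + p0 p) = (q - p) * (q + p).
  by rewrite -!subr_sqr !sqr_p0; ring.
have a3 : `|q + p| < p0 q + p0 p.
  by rewrite (le_lt_trans (ler_normD _ _))// ltrD.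
have s0 : 0 < p0 q + p0 p by rewrite addr_gt0 ?p0_gt0.
have a : `|p0 q - p0 p| <= q - p.
  rewrite -(ler_pM2r s0) -{1}(gtr0_norm s0) -normrM hs normrM.
  rewrite gtr0_norm ?subr_gt0// ler_wpM2l ?subr_ge0 ?ltW//.
have := ler_norm (v * (p0 q - p0 p)); rewrite normrM => h.
have : `|v| * `|p0 q - p0 p| < q - p.
  apply: le_lt_trans (ler_wpM2l (normr_ge0 _) a) _.
  by rewrite -[ltRHS]mul1r ltr_pM2r ?subr_gt0.
lra.
Qed.

Lemma cvg_boost c v : 0 < c -> `|v| < 1 ->
  c * (p - v * @p0 R p) @[p --> +oo] --> +oo.
Proof.
move=> c0 v1; apply/cvgryPge => A; near=> p.
have p1 : 1 <= p by near: p; apply: nbhs_pinfty_ge; rewrite num_real.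
have pA : (A / c + 1) / (1 - `|v|) <= p.
  by near: p; apply: nbhs_pinfty_ge; rewrite num_real.
rewrite -ler_pdivrMl// mulrC.
move: pA; rewrite ler_pdivrMr ?subr_gt0// => pA.
have p00 : 0 < p by apply: lt_le_trans p1.
have := p0_sub_le p00; have : p^-1 <= 1 by rewrite invf_le1.
have := ler_norm (v * p0 p); rewrite normrM (gtr0_norm (p0_gt0 _)).
have := p0_gt0 p; have := normr_ge0 v; nra.
Unshelve. all: by end_near. Qed.

Lemma cvg_boostNy c v : 0 < c -> `|v| < 1 ->
  c * (p - v * @p0 R p) @[p --> -oo] --> -oo.
Proof.
move=> c0 v1; apply/cvgNy_compNP.
rewrite (_ : _ \o _ = (fun p => - (c * (p - (- v) * @p0 R p)))); last first.
  by apply/funext => p /=; rewrite p0N; ring.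
by apply/cvgNrNy; apply: cvg_boost => //; rewrite normrN.
Qed.

End BoostLimits.

Section Boost.
Variable R : realType.
Variables (u : R).
Hypothesis u1 : `|u| < 1.
Implicit Types (z p t : R).
Let leb := @lebesgue_measure R.

Let sub_sqr_gt0 : 0 < 1 - u ^+ 2.
Proof.
by rewrite subr_gt0 -real_normK ?num_real// exprn_ilt1 ?normr_ge0.
Qed.

Lemma U0_gt0 : 0 < U0 u.
Proof. by rewrite invr_gt0 sqrtr_gt0. Qed.

Lemma sqr_U0 : U0 u ^+ 2 * (1 - u ^+ 2) = 1.
Proof. by rewrite /U0 exprVn sqr_sqrtr ?ltW// mulVf// gt_eqF. Qed.

(** Minus the spatial component of the momentum in the comoving frame: with
    [p = sinh b] and [u = tanh a] it is [- sinh (b - a)], while the energy is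
    [cosh (b - a)]. *)
Definition sig p := p_proj u p / U0 u.

Lemma sigE p : sig p = U1 u * p0 p - U0 u * p.
Proof.
rewrite /sig /p_proj /energy /U1; have U0n : U0 u != 0 by rewrite gt_eqF// U0_gt0.
have h := sqr_U0.
have -> : - p + u * U0 u * (U0 u * p0 p - u * U0 u * p)
   = u * (U0 u ^+ 2) * p0 p - p * (1 + u ^+ 2 * U0 u ^+ 2) by ring.
have -> : 1 + u ^+ 2 * U0 u ^+ 2 = U0 u ^+ 2 by rewrite -{1}h; ring.
by field.
Qed.

Lemma energy_gt0 p : 0 < energy u p.
Proof.
have -> : energy u p = U0 u * (p0 p - u * p) by rewrite /energy /U1; ring.
rewrite mulr_gt0 ?U0_gt0// subr_gt0 (le_lt_trans (ler_norm _))// normrM.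
apply: le_lt_trans (p0_gtn p); rewrite -[leRHS]mul1r ler_wpM2r//.
exact: ltW.
Qed.

Lemma sqr_energy p : energy u p ^+ 2 = 1 + sig p ^+ 2.
Proof.
rewrite sigE /energy /U1.
have -> : (U0 u * p0 p - u * U0 u * p) ^+ 2 =
  (u * U0 u * p0 p - U0 u * p) ^+ 2 + U0 u ^+ 2 * (1 - u ^+ 2) * (p0 p ^+ 2 - p ^+ 2).
  by ring.
by rewrite sqr_U0 sqr_p0; ring.
Qed.

Lemma p0_sig p : p0 (- sig p) = energy u p.
Proof.
rewrite p0N; apply/(@pexpIrn _ 2) => //; rewrite ?nnegrE ?ltW ?p0_gt0 ?energy_gt0//.
by rewrite sqr_p0 sqr_energy.
Qed.

Lemma is_derive_sig p : is_derive p 1 (fun p => - sig p) (energy u p / p0 p).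
Proof.
have -> : (fun p => - sig p) = (fun p => U0 u * p + - U1 u * p0 p).
  by apply/funext => q; rewrite sigE; ring.
have d1 := is_derive_funM (is_derive_cst (U0 u) p 1) (is_derive_id p 1).
have d2 := is_derive_funM (is_derive_cst (- U1 u) p 1) (is_derive_p0 p).
have d3 := is_derive_funD d1 d2; apply: (is_derive_eq d3).
by rewrite /energy /=; field; rewrite gt_eqF ?p0_gt0.
Qed.

(** Lorentz invariance: [dp / p0] is carried to itself by the boost. *)
Lemma integral_boost z k e : 0 < z -> -1 <= e <= 1 ->
  (\int[leb]_(p in [set: R])
     (energy u p ^+ k * (1 - e * (sig p / energy u p))
      * (expR (- z * energy u p) / p0 p))%:E
   = (2 * mom z k)%:E)%E.
Proof.
move=> z0 e1; rewrite -(integral_mker_signed k z0 e1).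
have sE : (fun p => - sig p) = (fun p => U0 u * (p - u * p0 p)).
  by apply/funext => p; rewrite sigE /U1; ring.
have F'E : (fun p => - sig p)^`()%classic = (fun p => energy u p / p0 p).
  by apply/funext => p; rewrite derive1E; case: (is_derive_sig p).
have F'E2 : (fun p => energy u p / p0 p) = (fun p => U0 u + - U1 u * (p / p0 p)).
  apply/funext => p; rewrite /energy; field.
  by rewrite gt_eqF ?p0_gt0.
rewrite [RHS](@increasing_ge0_integration_by_substitutionT _ (fun p => - sig p)).
- apply: eq_integral => p _; rewrite F'E; congr EFin.
  transitivity (mker z k (- sig p) * (1 + e * (- sig p / p0 (- sig p))) *
    (energy u p / p0 p)) => //.
  have x0 := p0_gt0 p; have E0 := energy_gt0 p.
  by rewrite /mker p0_sig; field; rewrite !gt_eqF.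
- by rewrite sE => p q; apply: boost_incr => //; exact: U0_gt0.
- rewrite F'E F'E2; apply: continuous_funD; first exact: cst_continuous.
  by apply: continuous_funM; [exact: cst_continuous|exact: continuous_div_p0].
- rewrite F'E F'E2; apply/cvg_ex; exists (U0 u + - U1 u * -1).
  apply: cvgD; first exact: cvg_cst.
  by apply: cvgM; [exact: cvg_cst|exact: cvg_div_p0Ny].
- rewrite F'E F'E2; apply/cvg_ex; exists (U0 u + - U1 u * 1).
  apply: cvgD; first exact: cvg_cst.
  by apply: cvgM; [exact: cvg_cst|exact: cvg_div_p0].
- by move=> p; case: (is_derive_sig p).
- by rewrite sE; apply: cvg_boostNy => //; exact: U0_gt0.
- by rewrite sE; apply: cvg_boost => //; exact: U0_gt0.
- apply: continuous_funM; first exact: continuous_mker.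
  apply: continuous_funD; first exact: cst_continuous.
  by apply: continuous_funM; [exact: cst_continuous|exact: continuous_div_p0].
- by move=> t; exact: mker_signed_ge0.
Qed.

Lemma continuous_energy : continuous (energy u).
Proof.
rewrite (_ : energy u = (fun p => U0 u * p0 p + - U1 u * p)); last first.
  by apply/funext => p; rewrite /energy; ring.
apply: continuous_funD; apply: continuous_funM; try exact: cst_continuous.
  exact: continuous_p0.
by move=> p; exact: cvg_id.
Qed.

Lemma continuous_sig : continuous sig.
Proof.
rewrite (_ : sig = (fun p => U1 u * p0 p + - U0 u * p)); last first.
  by apply/funext => p; rewrite sigE; ring.
apply: continuous_funD; apply: continuous_funM; try exact: cst_continuous.
  exact: continuous_p0.
by move=> p; exact: cvg_id.
Qed.

Definition boost_weight z p := expR (- z * energy u p) / p0 p.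

Lemma integrable_boost z k e : 0 < z -> -1 <= e <= 1 ->
  leb.-integrable [set: R] (EFin \o (fun p =>
    energy u p ^+ k * (1 - e * (sig p / energy u p)) * boost_weight z p)).
Proof.
move=> z0 e1; have h := integral_boost k z0 e1.
have h0 p : 0 <= energy u p ^+ k * (1 - e * (sig p / energy u p)) * boost_weight z p.
  have := @mker_signed_ge0 R z k e (- sig p) e1; rewrite /mker p0_sig.
  have x0 := p0_gt0 p; have E0 := energy_gt0 p.
  set a := _ * _ => a0; suff -> : energy u p ^+ k * (1 - e * (sig p / energy u p)) *
     boost_weight z p = a * (energy u p / p0 p) by rewrite mulr_ge0// divr_ge0// ltW.
  by rewrite /a /boost_weight; field; rewrite !gt_eqF.
apply/integrableP; split.
  apply/measurable_EFinP; apply: continuous_measurable_fun.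
  have cE := continuous_energy.
  apply: continuous_funM.
    apply: continuous_funM.
      by apply: (@continuous_funC _ (fun x => x ^+ k)) => //; exact: exprn_continuous.
    rewrite (_ : (fun p => _) = (fun p => 1 + - e * (sig p * (energy u p)^-1))); last first.
      by apply/funext => p; ring.
    apply: continuous_funD; first exact: cst_continuous.
    apply: continuous_funM; first exact: cst_continuous.
    apply: continuous_funM; first exact: continuous_sig.
    by move=> p; apply: cvgV; [rewrite gt_eqF ?energy_gt0|exact: cE].
  apply: continuous_funM; last first.
    by move=> p; apply: cvgV; [rewrite gt_eqF ?p0_gt0|exact: continuous_p0].
  apply: (@continuous_funC _ (@expR R)); first exact: continuous_expR.
  by apply: continuous_funM => //; exact: cst_continuous.
under eq_integral => p _ do rewrite /= ger0_norm//.
by rewrite h ltry.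
Qed.

Lemma Rintegral_boost z k e : 0 < z -> -1 <= e <= 1 ->
  \int[leb]_(p in [set: R])
     (energy u p ^+ k * (1 - e * (sig p / energy u p)) * boost_weight z p)
   = 2 * mom z k.
Proof. by move=> z0 e1; rewrite /Rintegral integral_boost. Qed.

Lemma boost_even z (A : {poly R}) : 0 < z ->
  leb.-integrable [set: R] (EFin \o (fun p => A.[energy u p] * boost_weight z p)) /\
  \int[leb]_(p in [set: R]) (A.[energy u p] * boost_weight z p)
  = 2 * momfun (mom z) A.
Proof.
move=> z0; rewrite -momfunZ; apply: integral_horner => // k.
  have h : (-1 : R) <= 0 <= (1 : R) by apply/andP; split; lra.
  apply: eq_integrable (integrable_boost k z0 h) => // p _.
  by rewrite /= mul0r subr0 mulr1.
have h : (-1 : R) <= 0 <= (1 : R) by apply/andP; split; lra.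
rewrite -(Rintegral_boost k z0 h); apply: eq_Rintegral => p _.
by rewrite mul0r subr0 mulr1.
Qed.

Lemma boost_odd z (A : {poly R}) : 0 < z ->
  leb.-integrable [set: R]
    (EFin \o (fun p => sig p * A.[energy u p] * boost_weight z p)) /\
  \int[leb]_(p in [set: R]) (sig p * A.[energy u p] * boost_weight z p) = 0.
Proof.
move=> z0.
have h0 : (-1 : R) <= 0 <= (1 : R) by apply/andP; split; lra.
have h1 : (-1 : R) <= -1 <= (1 : R) by apply/andP; split; lra.
have E k p : energy u p ^+ k * (sig p * boost_weight z p) =
    energy u p ^+ k.+1 * (1 - (-1) * (sig p / energy u p)) * boost_weight z p -
    energy u p ^+ k.+1 * (1 - 0 * (sig p / energy u p)) * boost_weight z p.
  by rewrite exprS; field; rewrite gt_eqF ?energy_gt0.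
have [|||] := @integral_horner R setT (energy u) (fun p => sig p * boost_weight z p) (fun=> 0) A.
- exact: measurableT.
- move=> k.
  apply: eq_integrable (integrableB _ (integrable_boost k.+1 z0 h1)
    (integrable_boost k.+1 z0 h0)) => // p _.
  by rewrite /= E.
- move=> k; under eq_Rintegral do rewrite E.
  by rewrite RintegralB ?Rintegral_boost ?subrr//; exact: integrable_boost.
have AE p : A.[energy u p] * (sig p * boost_weight z p) =
   sig p * A.[energy u p] * boost_weight z p by ring.
move=> int e; split.
  by apply: eq_integrable int => // p _; rewrite /= AE.
under eq_Rintegral do rewrite -AE.
by rewrite e /momfun big1// => i _; rewrite mulr0.
Qed.

(** Pairing two functions [g (A(E) + sigma B(E))]: since [sigma^2 = E^2 - 1],
    the inner product reduces to the moment functional. *)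
Lemma pdot_horner theta (A B C D : {poly R}) : 0 < theta ->
  pdot u theta
    (fun p => gJ u theta p * (A.[energy u p] + sig p * B.[energy u p]))
    (fun p => gJ u theta p * (C.[energy u p] + sig p * D.[energy u p])) =
  momfun (mom theta^-1) (A * C + B * D * ('X^2 - 1)) / mom theta^-1 1.
Proof.
move=> th0; have z0 : 0 < theta^-1 by rewrite invr_gt0.
set z := theta^-1 in z0 *.
have [int1 e1] := boost_even (A * C + B * D * ('X^2 - 1)) z0.
have [int2 e2] := boost_odd (A * D + B * C) z0.
have K0 : mom z 1 != 0 by rewrite gt_eqF// mom_gt0.
transitivity (\int[leb]_(p in [set: R]) ((2 * mom z 1)^-1 *
   ((A * C + B * D * ('X^2 - 1)).[energy u p] * boost_weight z p +
    sig p * (A * D + B * C).[energy u p] * boost_weight z p))).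
  apply: eq_Rintegral => p _.
  rewrite /gJ bessel_K1E -/z /boost_weight !hornerE /=.
  have -> : energy u p ^+ 2 = 1 + sig p ^+ 2 by rewrite sqr_energy.
  have e0 := expR_gt0 (- z * energy u p); have x0 := p0_gt0 p.
  by field; rewrite !gt_eqF// mom_gt0.
rewrite RintegralZl//; last first.
  by apply: eq_integrable (integrableD _ int1 int2) => // p _.
by rewrite RintegralD// e1 e2 addr0; field.
Qed.

End Boost.

(** * Orthonormal polynomials of a positive moment sequence *)

Section OrthonormalFamilies.
Variable R : realType.
Implicit Types (w : nat -> R) (A B : {poly R}) (P : nat -> {poly R}).

Definition positive_moments w :=
  forall A, A != 0 -> (forall x, 1 <= x -> 0 <= A.[x]) -> 0 < momfun w A.

Definition orthonormal_family w P :=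
  (forall n, size (P n) = n.+1 /\ 0 < lead_coef (P n)) /\
  (forall i j, momfun w (P i * P j) = (i == j)%:R).

(** Gram-Schmidt on the monomials, carried along as a list because each step
    uses all the polynomials before it. *)
Fixpoint gram_schmidt w n : seq {poly R} :=
  if n is k.+1 then
    let s := gram_schmidt w k in
    let Q := 'X^k - \sum_(p <- s) momfun w ('X^k * p) *: p in
    rcons s ((Num.sqrt (momfun w (Q * Q)))^-1 *: Q)
  else [::].

(** Unlike [opoly], this family is given by a formula in the moments, hence is
    differentiable in them. *)
Definition gs w n := (gram_schmidt w n.+1)`_n.

Definition gs_dir w n : {poly R} :=
  'X^n - \sum_(i < n) momfun w ('X^n * gs w i) *: gs w i.

Lemma size_gram_schmidt w n : size (gram_schmidt w n) = n.
Proof. by elim: n => //= n IH; rewrite size_rcons IH. Qed.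

Lemma nth_gram_schmidt w n i : (i < n)%N -> (gram_schmidt w n)`_i = gs w i.
Proof.
elim: n => // n IH; rewrite ltnS leq_eqVlt => /orP[/eqP->//|lt_in].
by rewrite /= nth_rcons size_gram_schmidt lt_in IH.
Qed.

Lemma gsE w n :
  gs w n = (Num.sqrt (momfun w (gs_dir w n * gs_dir w n)))^-1 *: gs_dir w n.
Proof.
rewrite {1}/gs /= nth_rcons size_gram_schmidt ltnn eqxx.
rewrite (big_nth 0) size_gram_schmidt big_mkord.
suff -> : \sum_(i < n) momfun w ('X^n * (gram_schmidt w n)`_i) *: (gram_schmidt w n)`_i =
  \sum_(i < n) momfun w ('X^n * gs w i) *: gs w i by [].
by apply: eq_bigr => i _; rewrite nth_gram_schmidt.
Qed.

Definition orthonormal_upto w P n :=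
  (forall k, (k < n)%N -> size (P k) = k.+1) /\
  (forall i j, (i < n)%N -> (j < n)%N -> momfun w (P i * P j) = (i == j)%:R).

Section Expansion.
Variables (w : nat -> R) (P : nat -> {poly R}).

Lemma orthonormal_expand n A : orthonormal_upto w P n -> (size A <= n)%N ->
  A = \sum_(i < n) momfun w (A * P i) *: P i.
Proof.
elim: n A => [|n IH] A [sP oP] sA.
  by rewrite big_ord0; apply/eqP; rewrite -size_poly_eq0 -leqn0.
have oPn : orthonormal_upto w P n.
  by split=> [k kn|i j /ltnW ? /ltnW ?]; [apply: sP; exact: ltnW|exact: oP].
have sPn := sP n (ltnSn n).
pose a := A`_n / lead_coef (P n).
have lc0 : lead_coef (P n) != 0.
  by rewrite lead_coef_eq0 -size_poly_eq0 sPn.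
have sB : (size (A - a *: P n)%R <= n)%N.
  apply/leq_sizeP => j; rewrite leq_eqVlt => /orP[/eqP<-|nj].
    have -> : (A - a *: P n)`_n = A`_n - a * lead_coef (P n).
      by rewrite coefB coefZ lead_coefE sPn.
    by rewrite divfK ?subrr.
  rewrite coefB coefZ !nth_default ?mulr0 ?subr0//; last by rewrite (leq_trans sA).
  by rewrite sPn.
have EB := IH _ oPn sB.
have AE : A = \sum_(i < n) momfun w ((A - a *: P n) * P i) *: P i + a *: P n.
  by rewrite -EB subrK.
have c1 (i : nat) : (i < n)%N -> momfun w (P n * P i) = 0.
  by move=> lt_in; rewrite oP ?ltnS ?(ltnW lt_in)// eqn_leq leqNgt lt_in.
have cn : momfun w (A * P n) = a.
  rewrite AE mulrDl mulr_suml momfunD momfun_sum big1 ?add0r.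
    by rewrite -scalerAl momfun_scale oP// eqxx mulr1.
  by move=> i _; rewrite -scalerAl momfun_scale [P i * _]mulrC c1// mulr0.
rewrite big_ord_recr /= cn {1}AE; congr (_ + _).
apply: eq_bigr => i _; rewrite mulrBl -scalerAl momfunB momfun_scale c1//.
by rewrite mulr0 subr0.
Qed.

Lemma orthonormal_orth n A : orthonormal_upto w P n.+1 -> (size A <= n)%N ->
  momfun w (P n * A) = 0.
Proof.
move=> oP sA; have oPn : orthonormal_upto w P n.
  by split=> [k kn|i j /ltnW ? /ltnW ?]; [apply: oP.1; exact: ltnW|exact: oP.2].
rewrite (orthonormal_expand oPn sA) mulr_sumr momfun_sum big1// => i _ /=.
rewrite -scalerAr momfun_scale oP.2 ?ltnS ?(ltnW (ltn_ord i))//.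
by rewrite eqn_leq leqNgt ltn_ord mulr0.
Qed.

End Expansion.

Section GramSchmidt.
Variables (w : nat -> R).
Hypothesis w0 : positive_moments w.

Lemma momfun_sqr_gt0 A : A != 0 -> 0 < momfun w (A * A).
Proof.
move=> A0; apply: w0; first by rewrite mulf_neq0.
by move=> x _; rewrite hornerM -expr2 sqr_ge0.
Qed.

Lemma gs_dirP n : orthonormal_upto w (gs w) n ->
  [/\ size (gs_dir w n) = n.+1, gs_dir w n \is monic &
      forall i, (i < n)%N -> momfun w (gs_dir w n * gs w i) = 0].
Proof.
move=> oP; rewrite /gs_dir; set S := \sum_(_ < _) _.
have sS : (size S < size ('X^n : {poly R}))%N.
  rewrite size_polyXn ltnS (leq_trans (size_sum _ _ _))//.
  apply/bigmax_leqP => i _; rewrite (leq_trans (size_scale_leq _ _))// oP.1//.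
split.
- by rewrite size_polyDl ?size_polyN// size_polyXn.
- by rewrite monicE lead_coefDl ?size_polyN// lead_coefXn.
- move=> i lt_in; rewrite mulrBl momfunB mulr_suml momfun_sum.
  rewrite (bigD1 (Ordinal lt_in)) //= -scalerAl momfun_scale oP.2// eqxx mulr1.
  rewrite big1 ?addr0 ?subrr// => j ji.
  rewrite -scalerAl momfun_scale oP.2// (_ : (j == i :> nat) = false) ?mulr0//.
  by apply/negbTE; apply: contra ji => /eqP ji; apply/eqP/val_inj.
Qed.

Lemma gs_orthonormal_upto n : orthonormal_upto w (gs w) n /\
  forall k, (k < n)%N -> 0 < lead_coef (gs w k).
Proof.
elim: n => [//|n [IH lIH]]; have [sQ mQ oQ] := gs_dirP IH.
have Q0 : gs_dir w n != 0 by rewrite monic_neq0.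
have N0 : 0 < Num.sqrt (momfun w (gs_dir w n * gs_dir w n)).
  by rewrite sqrtr_gt0 momfun_sqr_gt0.
have on i : (i < n)%N -> momfun w (gs w n * gs w i) = 0.
  by move=> /oQ h; rewrite gsE -scalerAl momfun_scale h mulr0.
have nn : momfun w (gs w n * gs w n) = 1.
  rewrite gsE -scalerAl -scalerAr !momfun_scale mulrA -expr2 exprVn.
  by rewrite sqr_sqrtr ?mulVf// ?gt_eqF ?ltW// momfun_sqr_gt0.
split; last first.
  move=> k; rewrite ltnS leq_eqVlt => /orP[/eqP->|/lIH//].
  by rewrite gsE lead_coefZ (monicP mQ) mulr1 invr_gt0.
split.
  move=> k; rewrite ltnS leq_eqVlt => /orP[/eqP->|/IH.1//].
  by rewrite gsE size_scale ?invr_eq0 ?gt_eqF.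
move=> i j; rewrite !ltnS (leq_eqVlt i) (leq_eqVlt j) => /orP[/eqP->|lt_in] /orP[/eqP->|lt_jn].
- by rewrite eqxx.
- by rewrite on// eqn_leq leqNgt lt_jn.
- by rewrite mulrC on// eq_sym eqn_leq leqNgt lt_in.
- exact: IH.2.
Qed.

Lemma gs_orthonormal : orthonormal_family w (gs w).
Proof.
split=> [n|i j].
  by have [[sP _] lP] := gs_orthonormal_upto n.+1; rewrite sP ?lP.
have [[_ oP] _] := gs_orthonormal_upto (maxn i j).+1.
by apply: oP; rewrite ltnS ?leq_maxl ?leq_maxr.
Qed.

Lemma orthonormal_familyW P n : orthonormal_family w P -> orthonormal_upto w P n.
Proof. by move=> [sP oP]; split=> [k _|i j _ _]; [case: (sP k)|exact: oP]. Qed.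

(** The components of [P n] along the earlier polynomials are forced by
    orthogonality, and its norm and sign fix the leading coefficient. *)
Lemma orthonormal_unique P : orthonormal_family w P -> forall n, P n = gs w n.
Proof.
move=> fP; elim/ltn_ind => n IH.
have [sP cP] := fP.1 n; have oP := orthonormal_familyW n fP.
set c := lead_coef (P n) in cP.
have c0 : c != 0 by rewrite gt_eqF.
have PE : P n = c *: gs_dir w n.
  have sB : (size (c^-1 *: P n - 'X^n)%R <= n)%N.
    apply/leq_sizeP => j; rewrite leq_eqVlt => /orP[/eqP<-|nj].
      have -> : (c^-1 *: P n - 'X^n)`_n = c^-1 * c - 1.
        by rewrite coefB coefZ coefXn eqxx /c lead_coefE sP.
      by rewrite mulVf// subrr.
    rewrite coefB coefZ coefXn gtn_eqF// nth_default ?mulr0 ?subr0//.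
    by rewrite sP.
  have := orthonormal_expand oP sB.
  move=> /(congr1 (fun A => c *: (A + 'X^n))).
  rewrite subrK scalerA mulfV// scale1r => ->; congr (_ *: _).
  rewrite /gs_dir addrC; congr (_ + _); rewrite -sumrN; apply: eq_bigr => i _.
  rewrite mulrBl momfunB -scalerAl momfun_scale fP.2.
  by rewrite eqn_leq leqNgt ltn_ord mulr0 sub0r scaleNr IH.
rewrite gsE PE; congr (_ *: _).
have := fP.2 n n; rewrite eqxx PE -scalerAl -scalerAr !momfun_scale mulrA -expr2.
set N := momfun _ _ => h.
have -> : N = (c^-1) ^+ 2.
  by rewrite exprVn -[RHS]mul1r -[X in X / _]h mulrAC mulfV ?mul1r// expf_neq0.
by rewrite sqrtr_sqr gtr0_norm ?invr_gt0// invrK.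
Qed.

End GramSchmidt.

(** Reproducing property of the Christoffel-Darboux kernel. *)
Lemma reproducing w P n A a : orthonormal_family w P -> (size A <= n)%N ->
  \sum_(k < n) (P k).[a] * momfun w (A * P k) = A.[a].
Proof.
move=> fP sA; rewrite {2}(orthonormal_expand (orthonormal_familyW n fP) sA).
by rewrite horner_sum; apply: eq_bigr => k _; rewrite hornerZ mulrC.
Qed.

End OrthonormalFamilies.

(** * Zeros of orthonormal polynomials *)

Section Zeros.
Variable R : realType.
Implicit Types (w : nat -> R) (A B : {poly R}) (P : nat -> {poly R}) (s : seq R).

Let prodX s : {poly R} := \prod_(r <- s) ('X - r%:P).

(** Take for [s] the roots of odd multiplicity beyond [1]: multiplying by their
    linear factors removes all sign changes. *)
Lemma sign_changes A : A != 0 -> exists s,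
  [/\ uniq s, all (fun r => (1 < r) && root A r) s &
   (forall x, 1 <= x -> 0 <= (A * prodX s).[x]) \/
   (forall x, 1 <= x -> (A * prodX s).[x] <= 0)].
Proof.
have [n] := ubnP (size A); elim: n A => // n IH A sA A0.
have [[r [r1 rr]]|noroot] := pselect (exists r, 1 < r /\ root A r); last first.
  exists [::]; split => //; rewrite /prodX big_nil mulr1.
  have [pos|/existsNP[x /not_implyP[x1 /negP]]] :=
    pselect (forall x, 1 <= x -> 0 <= A.[x]); first by left.
  rewrite -ltNge => Ax; right => y y1; rewrite leNgt; apply/negP => Ay.
  apply: noroot.
  have [xy|yx|xy] := ltgtP x y.
  - have [|c cxy rc] := poly_ivtoo (p := A) (ltW xy); first by rewrite nmulr_rlt0.
    exists c; split=> //; move: cxy; rewrite in_itv/= => /andP[xc _].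
    exact: le_lt_trans xc.
  - have [|c cxy rc] := poly_ivtoo (p := A) (ltW yx); first by rewrite nmulr_llt0.
    exists c; split=> //; move: cxy; rewrite in_itv/= => /andP[xc _].
    exact: le_lt_trans xc.
  - by move: (lt_trans Ax Ay); rewrite xy ltxx.
have /factor_theorem[B AE] := rr.
have B0 : B != 0 by apply: contraNneq A0 => B0; rewrite AE B0 mul0r.
have sB : (size B < n)%N.
  by move: sA; rewrite AE size_Mmonic ?monicXsubC// size_XsubC addn2 /= ltnS.
have [s [us rs ss]] := IH _ sB B0.
have rsA : all (fun x => (1 < x) && root A x) s.
  apply/allP => x /(allP rs)/andP[-> rx]; rewrite AE rootM rx//.
have [rs_in|rs_notin] := boolP (r \in s).
  exists (rem r s); split; first exact: rem_uniq.
    by apply/allP => x /mem_rem /(allP rsA).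
  have AB : A * prodX (rem r s) = B * prodX s.
    by rewrite AE /prodX (perm_big _ (perm_to_rem rs_in)) big_cons mulrA.
  by rewrite AB.
exists (r :: s); split; first by rewrite /= rs_notin.
  by rewrite /= r1 rr.
have AB x : (A * prodX (r :: s)).[x] = (x - r) ^+ 2 * (B * prodX s).[x].
  rewrite AE /prodX big_cons !hornerM !hornerXsubC expr2; ring.
by case: ss => ss; [left|right] => x x1; rewrite AB;
  [apply: mulr_ge0|apply: mulr_ge0_le0]; rewrite ?sqr_ge0 ?ss.
Qed.

(** An orthogonal polynomial with fewer than [n] sign changes would be
    orthogonal to a polynomial that makes the product one-signed. *)
Lemma orthonormal_zeros w P n : positive_moments w -> orthonormal_family w P ->
  let s := rootsR (P n) in
  [/\ size s = n, uniq s, all (fun r => 1 < r) s &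
      P n = lead_coef (P n) *: \prod_(r <- s) ('X - r%:P)].
Proof.
move=> w0 fP /=; have [sP cP] := fP.1 n.
have P0 : P n != 0 by rewrite -size_poly_eq0 sP.
have [s [us rs ss]] := sign_changes P0.
have rts : all (root (P n)) s by apply/allP => x /(allP rs)/andP[].
have szs : (size s <= n)%N by have := max_poly_roots P0 rts us; rewrite sP ltnS.
have sn : size s = n.
  apply/eqP; rewrite eqn_leq szs leqNgt; apply/negP => lt_sn.
  have m0 : momfun w (P n * prodX s) = 0.
    apply: (orthonormal_orth (orthonormal_familyW n.+1 fP)).
    by rewrite /prodX size_prod_XsubC.
  have Q0 : P n * prodX s != 0.
    by rewrite mulf_neq0// /prodX monic_neq0// monic_prod_XsubC.
  case: ss => ss; first by have := w0 _ Q0 ss; rewrite m0 ltxx.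
  have := w0 (- (P n * prodX s)); rewrite momfunN m0 oppr0 ltxx oppr_eq0.
  move=> /(_ Q0) h; suff : false by [].
  by apply: h => x x1; rewrite hornerN oppr_ge0 ss.
have prm : perm_eq (rootsR (P n)) s.
  apply: uniq_perm => //; first exact: uniq_roots.
  move=> x; rewrite -(roots_on_rootsR P0) in_itv/=; apply/idP/idP => [rx|/(allP rts)//].
  apply: contraT => xs; have := max_poly_roots P0 (rs := x :: s).
  by rewrite /= rx rts xs us sP sn ltnn => /(_ isT isT).
split.
- by rewrite (perm_size prm).
- exact: uniq_roots.
- by rewrite (perm_all _ prm); apply/allP => x /(allP rs)/andP[].
- rewrite (perm_big _ prm); apply: all_roots_prod_XsubC => //.
    by rewrite sP sn.
  by rewrite uniq_rootsE.
Qed.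

End Zeros.

(** * Self-adjoint matrices and definite pencils *)

Section SelfAdjoint.
Variables (R : realType) (n : nat) (A S : 'M[R]_n.+1).
Hypothesis S_pos : forall v : 'rV[R]_n.+1, v != 0 -> 0 < (v *m S *m v^T) 0 0.
Hypothesis A_adj : A *m S = S *m A^T.

Lemma form_ge0 (v : 'rV[R]_n.+1) : 0 <= (v *m S *m v^T) 0 0.
Proof.
have [->|/S_pos/ltW//] := eqVneq v 0; by rewrite !mul0mx mxE.
Qed.

Lemma form_adj (v w : 'rV[R]_n.+1) : v *m A *m S *m w^T = v *m S *m (w *m A)^T.
Proof. by rewrite trmx_mul -!mulmxA [A *m _]mulmxA A_adj !mulmxA. Qed.

(** A complex eigenvector splits into real and imaginary parts [x], [y]; moving
    [A] across the form between them annihilates the imaginary part of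
    the eigenvalue. *)
Lemma selfadjoint_real (z : R[i]) :
  eigenvalue (map_mx (real_complex R) A) z -> exists2 r, z = real_complex R r & eigenvalue A r.
Proof.
move=> /eigenvalueP[v vA v0]; pose x := map_mx (@complex.Re R) v.
pose y := map_mx (@complex.Im R) v; case: z vA => a b vA.
have ReM (p q : R[i]) : complex.Re (p * q) = complex.Re p * complex.Re q - complex.Im p * complex.Im q.
  by case: p q => [? ?] [? ?].
have ImM (p q : R[i]) : complex.Im (p * q) = complex.Re p * complex.Im q + complex.Im p * complex.Re q.
  by case: p q => [? ?] [? ?].
have xA : x *m A = a *: x - b *: y.
  apply/rowP => j; have := congr1 (fun u : 'rV_n.+1 => complex.Re (u 0 j)) vA.
  rewrite !mxE ReM raddf_sum /= => <-; apply: eq_bigr => k _.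
  by rewrite !mxE ReM /= mulr0 subr0.
have yA : y *m A = b *: x + a *: y.
  apply/rowP => j; have := congr1 (fun u : 'rV_n.+1 => complex.Im (u 0 j)) vA.
  rewrite !mxE ImM raddf_sum /= addrC => <-; apply: eq_bigr => k _.
  by rewrite !mxE ImM /= mulr0 add0r.
have xy0 : (x != 0) || (y != 0).
  rewrite -negb_and; apply: contra v0 => /andP[/eqP x0 /eqP y0].
  apply/eqP/rowP => j; move/rowP/(_ j): x0; move/rowP/(_ j): y0.
  by rewrite !mxE; case: (v 0 j) => ? ? /= -> ->.
have b0 : b = 0.
  have E1 : x *m A *m S *m y^T = a *: (x *m S *m y^T) - b *: (y *m S *m y^T).
    by rewrite xA !mulmxBl -!scalemxAl.
  have E2 : x *m S *m (y *m A)^T = b *: (x *m S *m x^T) + a *: (x *m S *m y^T).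
    by rewrite yA linearD /= !linearZ /= mulmxDr -!scalemxAr.
  have := form_adj x y; rewrite E1 E2.
  have pos : 0 < (x *m S *m x^T) 0 0 + (y *m S *m y^T) 0 0.
    by case/orP: xy0 => /S_pos h; [rewrite ltr_pwDl// form_ge0|rewrite ltr_wpDl// form_ge0].
  move: pos; move: (x *m S *m x^T) (y *m S *m y^T) (x *m S *m y^T) => X Y Z pos.
  move=> /(congr1 (fun u : 'M[R]_1 => u 0 0)); rewrite !mxE => h.
  apply: (mulIf (lt0r_neq0 pos)); rewrite mul0r; lra.
exists a; first by rewrite b0.
move: xA yA; rewrite b0 !scale0r subr0 add0r => xA yA.
by apply/eigenvalueP; case/orP: xy0 => h; [exists x|exists y].
Qed.

Lemma horner_adj p : horner_mx A p *m S = S *m (horner_mx A p)^T.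
Proof.
elim/poly_ind: p => [|p c IH]; first by rewrite rmorph0 mul0mx trmx0 mulmx0.
rewrite rmorphD rmorphM /= horner_mx_X horner_mx_C mulmxDl linearD /= mulmxDr.
congr (_ + _); last first.
  by rewrite tr_scalar_mx -scalar_mxC.
rewrite -mulmxA A_adj mulmxA IH -mulmxA -trmx_mul; congr (_ *m _^T).
have : horner_mx A 'X * horner_mx A p = horner_mx A p * horner_mx A 'X.
  by rewrite -!rmorphM mulrC.
by rewrite horner_mx_X.
Qed.

(** A self-adjoint matrix [N] of square zero vanishes, since the square norm of
    [v N] is the pairing of [v N^2] with [v]. *)
Lemma horner_adj_reduced p k : horner_mx A (p ^+ k) = 0 -> horner_mx A p = 0.
Proof.
have sq (B : 'M[R]_n.+1) : B *m S = S *m B^T -> B *m B = 0 -> B = 0.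
  move=> B_adj BB.
  apply/row_matrixP => i; rewrite row0; apply/eqP/negPn/negP => Bi.
  have BSB : B *m S *m B^T = 0 by rewrite -mulmxA -B_adj mulmxA BB mul0mx.
  have := S_pos Bi; rewrite rowE trmx_mul.
  by rewrite !mulmxA -(mulmxA _ B S) -(mulmxA _ (B *m S)) BSB mulmx0 mul0mx mxE ltxx.
elim: k => [|[|k] IH].
- by rewrite expr0 rmorph1 => /eqP; rewrite oner_eq0.
- by rewrite expr1.
move=> h; apply: IH; apply: sq (horner_adj _) _; rewrite mulmxE -rmorphM /=.
have -> : p ^+ k.+1 * p ^+ k.+1 = p ^+ k.+2 * p ^+ k by rewrite !exprS; ring.
by rewrite rmorphM /= h mul0r.
Qed.

(** The roots of the minimal polynomial are real, and they are simple because a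
    power of their reduced product annihilates [A]. *)
Lemma selfadjoint_diagonalizable : diagonalizable A.
Proof.
pose f := real_complex R.
have [s sE] := closed_field_poly_normal (mxminpoly (map_mx f A)).
rewrite (monicP (mxminpoly_monic _)) scale1r in sE.
have sreal z : z \in s -> exists r, z = f r.
  move=> zs; have : eigenvalue (map_mx f A) z.
    by rewrite eigenvalue_root_min sE root_prod_XsubC.
  by move=> /selfadjoint_real[r -> _]; exists r.
have {sreal} [rs sE2] : exists rs, s = map f rs.
  elim: s {sE} sreal => [|z s IH] h; first by exists [::].
  have [r ->] := h z (mem_head _ _).
  have [|rs ->] := IH; first by move=> y ys; apply: h; rewrite inE ys orbT.
  by exists (r :: rs).
have pE : mxminpoly A = \prod_(r <- rs) ('X - r%:P).
  apply: (map_poly_inj f); rewrite -mxminpoly_map sE sE2 big_map rmorph_prod /=.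
  by apply: eq_bigr => r _; rewrite rmorphB /= map_polyX map_polyC.
apply/diagonalizableP; exists (undup rs); first exact: undup_uniq.
apply/mxminpoly_minP; apply: (@horner_adj_reduced _ (size rs)).
apply/mxminpoly_minP; rewrite pE.
have : {subset rs <= undup rs} by move=> r; rewrite mem_undup.
move: (undup rs) => u; set U := \prod_(x <- u) _.
elim: (rs) => [|r t IH] sub; first by rewrite big_nil expr0.
rewrite big_cons exprS dvdp_mul//; last first.
  by apply: IH => y yt; apply: sub; rewrite inE yt orbT.
by rewrite dvdp_XsubCl root_prod_XsubC sub// mem_head.
Qed.

(** The eigenspaces fill the space and each of them is a line, so there are as
    many as the dimension. *)
Lemma simple_diagonalizable_spectrum :
  (forall a (v w : 'rV[R]_n.+1), v *m A = a *: v -> w *m A = a *: w ->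
     exists c : R * R, c != 0 /\ c.1 *: v + c.2 *: w = 0) ->
  real_distinct_spectrum A.
Proof.
move=> simp; have /diagonalizablePeigen[rs urs rsE] := selfadjoint_diagonalizable.
have rk a : (\rank (eigenspace A a) <= 1)%N.
  rewrite leqNgt; apply/negP => rk2.
  pose B := row_base (eigenspace A a).
  have Bfree : row_free B by exact: row_base_free.
  have rkpos : (0 < \rank (eigenspace A a))%N by exact: ltnW.
  pose i0 : 'I_(\rank (eigenspace A a)) := Ordinal rkpos.
  pose i1 : 'I_(\rank (eigenspace A a)) := Ordinal rk2.
  have eigB i : row i B *m A = a *: row i B.
    apply/eigenspaceP; apply: submx_trans (row_sub _ _) _.
    by rewrite eq_row_base.
  have [[c1 c2] /= [c0 h]] := simp a _ _ (eigB i0) (eigB i1).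
  have : (c1 *: delta_mx 0 i0 + c2 *: delta_mx 0 i1 : 'rV_(\rank (eigenspace A a))) *m B = 0.
    by rewrite mulmxDl -!scalemxAl -!rowE.
  move/eqP; rewrite mulmx_free_eq0// => /eqP/rowP hd.
  have := hd i0; have := hd i1; rewrite !mxE !eqxx /= ?mulr1 ?mulr0 ?add0r ?addr0.
  by move=> c20 c10; move: c0; rewrite c10 c20 eqxx.
pose es := [seq r <- rs | eigenvalue A r].
have nes : (n.+1 <= size es)%N.
  rewrite -(mxrank1 R n.+1) -rsE.
  apply: (@leq_trans (\sum_(r <- rs) \rank (eigenspace A r))).
    elim: (rs) => [|r t IH]; first by rewrite !big_nil mxrank0.
    by rewrite !big_cons (leq_trans (mxrank_adds_leqif _ _).1)// leq_add2l.
  rewrite size_filter -sum1_count [X in (_ <= X)%N]big_mkcond /=.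
  apply: leq_sum => r _; case: ifPn => //.
  by rewrite negbK => /eqP ->; rewrite mxrank0.
exists (take n.+1 es); split.
- by rewrite size_takel.
- by rewrite take_uniq// filter_uniq.
- by apply/allP => r /mem_take; rewrite mem_filter => /andP[].
Qed.

Lemma selfadjoint_spectral_radius :
  (forall a, eigenvalue A a -> `|a| < 1) -> spectral_radius A < 1.
Proof.
move=> lt1; rewrite /spectral_radius; set E := [set _ | _].
have cp0 : char_poly A != 0 by rewrite monic_neq0// char_poly_monic.
have [b b1 Eb] : exists2 b, b < 1 & ubound E b.
  have [b b1 hb] : exists2 b : R, b < 1 &
      forall r, r \in rootsR (char_poly A) -> `|r| <= b.
    have : forall r, r \in rootsR (char_poly A) -> `|r| < 1.
      move=> r; rewrite -(roots_on_rootsR cp0) in_itv /= -eigenvalue_root_char.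
      exact: lt1.
    elim: (rootsR _) => [|r s IH] h; first by exists 0.
    have [|b b1 hb] := IH; first by move=> x xs; apply: h; rewrite inE xs orbT.
    exists (Num.max b `|r|); first by rewrite gt_max b1 h ?mem_head.
    by move=> x; rewrite inE le_max => /predU1P[->|/hb ->]; rewrite ?lexx ?orbT.
  exists b => // _ [z /selfadjoint_real[r -> er] ->].
  have -> : ComplexField.Normc.normc (real_complex R r) = `|r|.
    by rewrite /= expr0n addr0 sqrtr_sqr.
  by apply: hb; rewrite -(roots_on_rootsR cp0) in_itv /= -eigenvalue_root_char.
have [[e Ee]|/forallNP E0] := pselect (exists e, E e).
  by apply: le_lt_trans b1; apply: ge_sup => //; exists e.
rewrite (_ : E = set0) ?sup0//.
by apply/seteqP; split => // e /E0.
Qed.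

End SelfAdjoint.

Lemma posdef_unit (R : realType) n (T : 'M[R]_n) :
  (forall v : 'rV[R]_n, v != 0 -> 0 < (v *m T *m v^T) 0 0) -> T \in unitmx.
Proof.
move=> T_pos; rewrite -row_free_unit -kermx_eq0.
apply/rowV0P => v /sub_kermxP vT; apply/eqP; apply: contraT => /T_pos.
by rewrite vT mul0mx mxE ltxx.
Qed.

(** The generalized eigenproblem [v X = a v T] of a positive definite pencil is
    the ordinary one of the matrix [(T D)^-1 (X D)], self-adjoint for
    the form [D^-1 T^-1 D^-T]. *)
Lemma pencil_hyperbolic (R : realType) n (T X D : 'M[R]_n.+1) :
  T^T = T -> X^T = X -> D \in unitmx ->
  (forall v : 'rV[R]_n.+1, v != 0 -> 0 < (v *m T *m v^T) 0 0) ->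
  (forall v : 'rV[R]_n.+1, v != 0 ->
     `|(v *m X *m v^T) 0 0| < (v *m T *m v^T) 0 0) ->
  (forall a (v w : 'rV[R]_n.+1), `|a| < 1 ->
     v *m X = a *: (v *m T) -> w *m X = a *: (w *m T) ->
     exists c : R * R, c != 0 /\ c.1 *: v + c.2 *: w = 0) ->
  let B := invmx (T *m D) *m (X *m D) in
  [/\ T *m D \in unitmx, real_distinct_spectrum B, diagonalizable B &
      spectral_radius B < 1].
Proof.
move=> Ts Xs Du T_pos X_lt simp B; have Tu := posdef_unit T_pos.
have TDu : T *m D \in unitmx by rewrite unitmx_mul Tu Du.
pose S := invmx D *m invmx T *m (invmx D)^T.
have BE : B = invmx D *m invmx T *m X *m D.
  rewrite /B (_ : invmx (T *m D) = invmx D *m invmx T) ?mulmxA//.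
  by rewrite -[T *m D]/(T * D) -[invmx]/(GRing.inv) invrM.
have TVs : (invmx T)^T = invmx T by rewrite trmx_inv Ts.
pose Y (v : 'rV[R]_n.+1) := v *m invmx D *m invmx T.
have YT v : Y v *m T = v *m invmx D by rewrite /Y mulmxKV.
have Y0 (v : 'rV[R]_n.+1) : v != 0 -> Y v != 0.
  apply: contra => /eqP Yv; rewrite -[v](mulmxKV Du) -YT Yv !mul0mx//.
have YS (v : 'rV[R]_n.+1) : v *m S *m v^T = Y v *m T *m (Y v)^T.
  by rewrite YT /Y !trmx_mul TVs /S !mulmxA.
have S_pos (v : 'rV[R]_n.+1) : v != 0 -> 0 < (v *m S *m v^T) 0 0.
  by move=> v0; rewrite YS T_pos// Y0.
have B_adj : B *m S = S *m B^T.
  rewrite BE /S !trmx_mul TVs Xs !mulmxA mulmxK// -!mulmxA; congr (_ *m (_ *m _)).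
  by rewrite [RHS]mulmxA -trmx_mul mulmxV// trmx1 mul1mx.
have eigY a (v : 'rV[R]_n.+1) : v *m B = a *: v -> Y v *m X = a *: (Y v *m T).
  move=> vB; rewrite YT scalemxAl -vB BE /Y !mulmxA mulmxK//.
have lt1 a : eigenvalue B a -> `|a| < 1.
  move=> /eigenvalueP[v /eigY vB v0]; have := X_lt _ (Y0 _ v0).
  have := T_pos _ (Y0 _ v0); rewrite vB -scalemxAl.
  move: (Y v *m T *m _) => Q Q0; rewrite mxE normrM (gtr0_norm Q0).
  by rewrite -ltr_pdivlMr// divff// gt_eqF.
split=> //.
- apply: (simple_diagonalizable_spectrum S_pos B_adj) => a v w va wa.
  have [v0|v0] := eqVneq v 0.
    by exists (1, 0); rewrite xpair_eqE oner_eq0 /= v0 scaler0 scale0r addr0.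
  have a1 : `|a| < 1 by apply: lt1; apply/eigenvalueP; exists v.
  have [c [c0 h]] := simp a _ _ a1 (eigY _ _ va) (eigY _ _ wa).
  exists c; split=> //.
  have : Y (c.1 *: v + c.2 *: w) = 0 by rewrite /Y !mulmxDl -!scalemxAl.
  by move=> Yc; apply/eqP; apply: contraT => /Y0; rewrite Yc eqxx.
- exact: (selfadjoint_diagonalizable S_pos B_adj).
- exact: (selfadjoint_spectral_radius S_pos B_adj).
Qed.

(** * Multiplication forms on the hyperbola *)

Section PolynomialPencil.
Variable R : realType.
Implicit Types (p q A : {poly R}) (a b c x : R).

Lemma exists_nonroot A : A != 0 -> exists2 x, 1 < x & A.[x] != 0.
Proof.
move=> A0; pose s := [seq (i.+2%:R : R) | i <- iota 0 (size A)].
have us : uniq s.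
  rewrite map_inj_in_uniq ?iota_uniq// => i j _ _.
  by move=> /(mulrIn (oner_neq0 _))/succn_inj/succn_inj.
have : ~~ all (root A) s.
  apply/negP => h; have := max_poly_roots A0 h us.
  by rewrite size_map size_iota ltnn.
move=> /allPn[_ /mapP[i _ ->] ri].
by exists i.+2%:R => //; rewrite ltr1n.
Qed.

Variable w : nat -> R.
Hypothesis w_pos : positive_moments w.

Lemma momfun_ge0 A : (forall x, 1 <= x -> 0 <= A.[x]) -> 0 <= momfun w A.
Proof.
by have [->|A0 h] := eqVneq A 0; [rewrite momfun0|exact/ltW/w_pos].
Qed.

(** Even part of [(a x + b s) (p + s q) (p' + s q')] modulo [s^2 = x^2 - 1]:
    the form of multiplication by [a x + b s] on the span of
    [p + s q], the functions on both branches of the hyperbola. *)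
Definition hyp_form a b p q p' q' : R :=
  momfun w (a%:P * 'X * (p * p' + ('X^2 - 1) * (q * q')) +
            b%:P * ('X^2 - 1) * (p * q' + q * p')).

Lemma hyp_formC a b p q p' q' : hyp_form a b p q p' q' = hyp_form a b p' q' p q.
Proof. by rewrite /hyp_form; congr (momfun w _); ring. Qed.

Lemma hyp_formDl a b c p q p2 q2 p' q' :
  hyp_form a b (c *: p + p2) (c *: q + q2) p' q' =
  c * hyp_form a b p q p' q' + hyp_form a b p2 q2 p' q'.
Proof.
rewrite /hyp_form -momfun_scale -momfunD; congr (momfun w _).
by rewrite -!mul_polyC; ring.
Qed.

Lemma hyp_form0l a b p' q' : hyp_form a b 0 0 p' q' = 0.
Proof. by rewrite /hyp_form !mul0r !mulr0 !addr0 !mulr0 addr0 momfun0. Qed.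

Lemma hyp_form_suml (I : finType) a b (F : I -> R) (p q : I -> {poly R}) p' q' :
  hyp_form a b (\sum_i F i *: p i) (\sum_i F i *: q i) p' q' =
  \sum_i F i * hyp_form a b (p i) (q i) p' q'.
Proof.
elim/big_rec3 : _ => [|i x A B _ IH]; first by rewrite hyp_form0l.
by rewrite hyp_formDl IH.
Qed.

(** On each branch [x + b s] with [|b| <= 1] is positive. *)
Lemma hyp_form_gt0 b p q : `|b| <= 1 -> (p != 0) || (q != 0) ->
  0 < hyp_form 1 b p q p q.
Proof.
move=> b1 pq0; rewrite /hyp_form; set T := (X in momfun _ X).
(* The value is [x (p^2 + s^2 q^2) + 2 b s (p (s q))], and [s < x]. *)
have TE x : 1 <= x -> let s := Num.sqrt (x ^+ 2 - 1) in
    T.[x] = (x - s) * (p.[x] ^+ 2 + (s * q.[x]) ^+ 2) +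
      s * ((p.[x] + b * (s * q.[x])) ^+ 2 + (1 - b ^+ 2) * (s * q.[x]) ^+ 2).
  move=> x1 s; have sE : x ^+ 2 = 1 + s ^+ 2.
    by rewrite sqr_sqrtr ?subr_ge0 ?exprn_ege1//; ring.
  by rewrite /T !hornerE /= sE; ring.
have s_lt x : 1 <= x -> Num.sqrt (x ^+ 2 - 1) < x.
  move=> x1; have x0 : 0 < x by rewrite (lt_le_trans ltr01).
  rewrite -(@ltr_pXn2r _ 2) ?nnegrE ?sqrtr_ge0 ?(ltW x0)//.
  by rewrite sqr_sqrtr ?subr_ge0 ?exprn_ege1// gtrBl.
have b2 : 0 <= 1 - b ^+ 2.
  by rewrite subr_ge0 -real_normK ?num_real// exprn_ile1.
have snd_ge0 x : 0 <= Num.sqrt (x ^+ 2 - 1) *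
   ((p.[x] + b * (Num.sqrt (x ^+ 2 - 1) * q.[x])) ^+ 2 +
    (1 - b ^+ 2) * (Num.sqrt (x ^+ 2 - 1) * q.[x]) ^+ 2).
  by rewrite mulr_ge0 ?sqrtr_ge0// addr_ge0 ?sqr_ge0// mulr_ge0 ?sqr_ge0.
apply: w_pos; last first.
  move=> x x1; rewrite TE// addr_ge0// mulr_ge0//.
    by rewrite subr_ge0 ltW// s_lt.
  by rewrite addr_ge0 ?sqr_ge0.
have [x x1 pqx] : exists2 x, 1 < x & (p.[x] != 0) || (q.[x] != 0).
  by case/orP: pq0 => /exists_nonroot[x x1 h]; exists x; rewrite ?h ?orbT.
suff : T.[x] != 0 by apply: contraNneq => ->; rewrite horner0.
rewrite TE ?ltW// gt_eqF// ltr_pwDl// mulr_gt0 ?subr_gt0 ?s_lt ?ltW//.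
have s0 : 0 < Num.sqrt (x ^+ 2 - 1) by rewrite sqrtr_gt0 subr_gt0 exprn_egt1.
case/orP: pqx => h.
  by rewrite ltr_pwDl ?sqr_ge0// lt_neqAle sqr_ge0 eq_sym sqrf_eq0 h.
by rewrite ltr_wpDl ?sqr_ge0// lt_neqAle sqr_ge0 eq_sym sqrf_eq0 mulf_neq0// gt_eqF.
Qed.

(** For [y = x + s] the multiplier [(1 - c^2) x + (1 + c^2) s] is
    [y^-1 (y - c) (y + c)]. The hypothesis on the coefficients says that [p + s q]
    has no [y^M] term; then [(y - c) (p + s q)] is again in the span, and testing
    against it gives its square with the positive weight [1 + c y^-1]. *)
Lemma hyp_kernel M c p q : 0 < c -> (0 < M)%N ->
  (size p <= M.+1)%N -> (size q <= M)%N -> p`_M + q`_M.-1 = 0 ->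
  (forall p' q', (size p' <= M.+1)%N -> (size q' <= M)%N ->
     hyp_form (1 - c ^+ 2) (1 + c ^+ 2) p q p' q' = 0) ->
  p = 0 /\ q = 0.
Proof.
move=> c0 M0 sp sq pq ker.
(* [P + s Q] is [(y - c) (p + s q)]. *)
pose P := ('X - c%:P) * p + ('X^2 - 1) * q.
pose Q := p + ('X - c%:P) * q.
have PQ0 : P = 0 /\ Q = 0.
  have : hyp_form (1 - c ^+ 2) (1 + c ^+ 2) p q P Q = 0.
    apply: ker; apply/leq_sizeP => j Mj.
      have -> : P = 'X * p - c *: p + ('X^2 * q - q).
        by rewrite /P -mul_polyC; ring.
      case: j Mj => [//|j Mj].
      rewrite !coefD !coefN coefZ coefXM coefXnM /= [p`_j.+1]nth_default; last exact: leq_trans Mj.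
      rewrite [q`_j.+1]nth_default; last by (apply: leq_trans sq _; lia).
      rewrite mulr0 !subr0; case: j Mj => [|j] Mj; first by lia.
      rewrite ltnS subSS subn1 /=; move: Mj; rewrite leq_eqVlt => /orP[/eqP[Mj]|Mj].
        by move: pq; rewrite Mj.
      by rewrite !nth_default ?addr0//; [apply: leq_trans sq _|apply: leq_trans sp _]; lia.
    have -> : Q = p + ('X * q - c *: q) by rewrite /Q -mul_polyC; ring.
    case: j Mj => [|j] Mj; first by lia.
    rewrite !coefD !coefN coefZ coefXM /= [q`_j.+1]nth_default; last exact: leq_trans Mj.
    rewrite mulr0 subr0; move: Mj; rewrite leq_eqVlt => /orP[/eqP Mj|Mj].
      by move: pq; rewrite Mj.
    by rewrite !nth_default ?addr0//; [apply: leq_trans sq _|apply: leq_trans sp _]; lia.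
  have -> : hyp_form (1 - c ^+ 2) (1 + c ^+ 2) p q P Q =
      momfun w (P ^+ 2 + ('X^2 - 1) * Q ^+ 2) + c * hyp_form 1 (-1) P Q P Q.
    rewrite /hyp_form -momfun_scale -momfunD; congr (momfun w _).
    by rewrite /P /Q -!mul_polyC !(polyCD, polyCN, polyCB, polyC_exp, polyC1); ring.
  have ge0 A B : 0 <= momfun w (A ^+ 2 + ('X^2 - 1) * B ^+ 2).
    apply: momfun_ge0 => x x1.
    rewrite !(hornerD, hornerM, hornerN, horner_exp, hornerX, hornerC).
    by rewrite -!expr2 addr_ge0 ?sqr_ge0// mulr_ge0 ?sqr_ge0// subr_ge0 exprn_ege1.
  have {ge0} := ge0 P Q.
  have [|] := boolP ((P != 0) || (Q != 0)).
    move=> /(@hyp_form_gt0 (-1)); rewrite normrN1 lexx => /(_ isT) h ge0 e.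
    by move: (ltr_wpDl ge0 (mulr_gt0 c0 h)); rewrite e ltxx.
  by rewrite negb_or !negbK => /andP[/eqP -> /eqP ->] _ _.
case: PQ0 => P0 Q0.
have pE : p = - (('X - c%:P) * q) by rewrite -[p]subr0 -Q0 /Q; ring.
suff q0 : q = 0 by rewrite pE q0 mulr0 oppr0.
have : ((2 * c) *: 'X - (1 + c ^+ 2)%:P) * q = 0.
  by rewrite -P0 /P pE -!mul_polyC !(polyCD, polyCM, polyC_exp); ring.
have hE : ((2 * c) *: 'X - (1 + c ^+ 2)%:P).[0] = - (1 + c ^+ 2).
  by rewrite !hornerE /=; ring.
move=> /eqP; rewrite mulf_eq0 => /orP[/eqP/(congr1 (horner^~ 0))|/eqP//].
by rewrite hE horner0 => /eqP; rewrite oppr_eq0 gt_eqF// ltr_pwDl ?sqr_ge0.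
Qed.

End PolynomialPencil.

(** * The two weights and their orthonormal polynomials *)

Section WeightMoments.
Variables (R : realType) (z : R).
Hypothesis z0 : 0 < z.
Implicit Types (A B : {poly R}) (l : nat).

(** The moments of [omega^(l)], normalized by [K_1 = mom z 1]. *)
Definition wmom (z : R) l k : R :=
  momfun (mom z) ('X^k * ('X^2 - 1) ^+ l) / mom z 1.

Lemma momfun_wmom l A :
  momfun (wmom z l) A = momfun (mom z) (A * ('X^2 - 1) ^+ l) / mom z 1.
Proof.
have -> : A * ('X^2 - 1) ^+ l = \sum_(i < size A) A`_i *: ('X^i * ('X^2 - 1) ^+ l).
  rewrite -{1}(coefK A) poly_def mulr_suml.
  by apply: eq_bigr => i _; rewrite scalerAl.
rewrite momfun_sum mulr_suml; apply: eq_bigr => i _.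
by rewrite momfun_scale -mulrA.
Qed.

Lemma momfun_wmom0 A : momfun (wmom z 0) A = momfun (mom z) A / mom z 1.
Proof. by rewrite momfun_wmom expr0 mulr1. Qed.

Lemma momfun_wmom1 A : momfun (wmom z 1) A = momfun (wmom z 0) (A * ('X^2 - 1)).
Proof. by rewrite !momfun_wmom expr0 mulr1 expr1. Qed.

Lemma wmom_positive l : positive_moments (wmom z l).
Proof.
move=> A A0 Apos; rewrite momfun_wmom divr_gt0 ?mom_gt0//.
have X1 : 'X^2 - 1 != 0 :> {poly R} by rewrite -size_poly_gt0 size_XnsubC.
apply: momfun_mom_gt0 => //; first by rewrite mulf_neq0 ?expf_neq0.
move=> x x1; rewrite hornerM horner_exp mulr_ge0 ?Apos// exprn_ge0//.
by rewrite !hornerE /= subr_ge0 exprn_ege1.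
Qed.

Lemma wdot_wmom l A B : (l < 2)%N ->
  wdot l z (horner A) (horner B) = momfun (wmom z l) (A * B).
Proof. by move=> l2; rewrite wdot_horner// momfun_wmom. Qed.

Lemma opoly_orthonormal l : (l < 2)%N ->
  orthonormal_family (wmom z l) (opoly l z).
Proof.
move=> l2; have fE P : orthonormal_polys l z P <-> orthonormal_family (wmom z l) P.
  split=> -[sP oP]; split=> // i j.
    by rewrite -wdot_wmom.
  by rewrite wdot_wmom.
have /fE ex := gs_orthonormal (wmom_positive l).
by apply/fE; exact: (xgetPex (fun=> 0) (ex_intro _ _ ex)).
Qed.

Lemma opoly_gs l n : (l < 2)%N -> opoly l z n = gs (wmom z l) n.
Proof.
by move=> l2; exact: (orthonormal_unique (opoly_orthonormal l2)).
Qed.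

Lemma wmom01 : wmom z 0 1 = 1.
Proof. by rewrite /wmom expr0 mulr1 momfunXn divff// gt_eqF// mom_gt0. Qed.

(** Integration by parts; this is the ideal gas law [p = rho theta]. *)
Lemma wmom0_pressure : momfun (wmom z 0) ('X^2 - 1) = z^-1.
Proof.
have K0 : mom z 1 != 0 by rewrite gt_eqF// mom_gt0.
rewrite momfun_wmom0 momfunB -(expr0 'X) !momfunXn.
have := mom_by_parts 0 z0; rewrite mul1r mul0r subr0 => h.
by apply: (mulfI (lt0r_neq0 z0)); rewrite mulrA h; field; rewrite gt_eqF.
Qed.

End WeightMoments.

Section RecurrenceCoefficients.
Variables (R : realType) (z : R).
Hypothesis z0 : 0 < z.
Implicit Types (A B : {poly R}) (l : nat).

Let P l n := opoly l z n.
Let L l := momfun (wmom z l).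

Lemma opoly_size l n : (l < 2)%N -> size (P l n) = n.+1.
Proof. by move=> l2; have [h _] := opoly_orthonormal z0 l2; case: (h n). Qed.

Lemma lc_gt0 l n : (l < 2)%N -> 0 < lc z l n.
Proof. by move=> l2; have [h _] := opoly_orthonormal z0 l2; case: (h n). Qed.

Lemma opoly_lcE l n : (l < 2)%N -> (P l n)`_n = lc z l n.
Proof. by move=> l2; rewrite /lc lead_coefE opoly_size. Qed.

Lemma opoly_orth l n A : (l < 2)%N -> (size A <= n)%N -> L l (P l n * A) = 0.
Proof.
move=> l2; apply: orthonormal_orth.
exact: orthonormal_familyW (opoly_orthonormal z0 l2).
Qed.

(** Only the component of [A] along [P_n] contributes, and it is read off from
    the coefficient of degree [n]. *)
Lemma opoly_lead l n A : (l < 2)%N -> (size A <= n.+1)%N ->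
  L l (P l n * A) = A`_n / lc z l n.
Proof.
move=> l2 sA; have l0 := lc_gt0 n l2.
have lE := opoly_lcE n l2.
pose a := A`_n / lc z l n.
have sB : (size (A - a *: P l n)%R <= n)%N.
  apply/leq_sizeP => j; rewrite leq_eqVlt => /orP[/eqP<-|nj].
    by rewrite coefB coefZ lE divfK ?subrr// gt_eqF.
  rewrite coefB coefZ !nth_default ?mulr0 ?subr0//; last by rewrite (leq_trans sA).
  by rewrite opoly_size.
have := opoly_orth l2 sB.
rewrite mulrBr /L momfunB -scalerAr momfun_scale (opoly_orthonormal z0 l2).2 eqxx mulr1.
by move/eqP; rewrite subr_eq0 => /eqP.
Qed.

Lemma zeros_sum l n : (l < 2)%N ->
  \sum_(1 <= i < n.+1) xz z l n i = \sum_(r <- zeros l z n) r.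
Proof.
move=> l2; have [sz _ _ _] := orthonormal_zeros n (wmom_positive z0 l) (opoly_orthonormal z0 l2).
by rewrite big_add1 [RHS](big_nth 0) /zeros sz; apply: eq_bigr.
Qed.

Lemma opoly_subleading l n : (l < 2)%N -> (0 < n)%N ->
  (P l n)`_n.-1 = - lc z l n * \sum_(1 <= i < n.+1) xz z l n i.
Proof.
move=> l2 n0.
have [sz _ _ PE] := orthonormal_zeros n (wmom_positive z0 l) (opoly_orthonormal z0 l2).
rewrite zeros_sum// {1}/P PE coefZ -/(lc z l n) mulNr -mulrN; congr (_ * _).
by have := @coefPn_prod_XsubC _ (zeros l z n); rewrite /zeros sz -lt0n => ->.
Qed.

(** The products of zeros in the definition of the state are values of the
    orthonormal polynomials at the origin. *)
Lemma opoly_const l n : (l < 2)%N ->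
  (P l n).[0] = lc z l n * \prod_(1 <= i < n.+1) - xz z l n i.
Proof.
move=> l2.
have [sz _ _ PE] := orthonormal_zeros n (wmom_positive z0 l) (opoly_orthonormal z0 l2).
rewrite {1}/P PE hornerZ -/(lc z l n); congr (_ * _).
rewrite horner_prod big_add1 [LHS](big_nth 0) sz; apply: eq_bigr => i _.
by rewrite hornerXsubC sub0r.
Qed.

End RecurrenceCoefficients.

(** * The flux matrices as multiplication forms *)

Section FluxMatrices.
Variables (R : realType) (z : R).
Hypothesis z0 : 0 < z.
Implicit Types (A B : {poly R}) (l : nat).

Let P l n := opoly l z n.
Let L l := momfun (wmom z l).
Let zl0 : (0 < 2)%N := isT.
Let zl1 : (1 < 2)%N := isT.

Lemma jacobiE l m (i j : 'I_m) : (l < 2)%N ->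
  jacobi z l m i j = L l ('X * (P l i * P l j)).
Proof.
move=> l2; rewrite mxE.
have off (a b : nat) : (a < b)%N -> L l ('X * (P l a * P l b)) =
    if b == a.+1 then rec_a z l a else 0.
  move=> ab; rewrite (_ : 'X * _ = P l b * ('X * P l a)); last by ring.
  rewrite /L opoly_lead//; last first.
    by rewrite (leq_trans (size_polyMleq _ _))// size_polyX opoly_size.
  rewrite coefXM (gtn_eqF (leq_ltn_trans _ ab))//.
  case: eqP => [->|/eqP ba] /=.
    by rewrite /rec_a opoly_lcE.
  by rewrite nth_default ?mul0r// opoly_size//; lia.
have [->|ij] := eqVneq i j.
  rewrite /rec_b (_ : (fun x => _) = horner ('X * P l j)); last first.
    by apply/funext => x; rewrite hornerM hornerX.
  by rewrite wdot_wmom// -mulrA.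
have [lt_ij|lt_ji|/val_inj eij] := ltngtP i j; last by rewrite eij eqxx in ij.
  rewrite off//; case: ifP => // _.
  by rewrite ifF//; apply/negbTE; lia.
rewrite ifF; last by apply/negbTE; lia.
by rewrite (mulrC (P l i)) off.
Qed.

(** Multiplication by [s] maps [s P_k^(1)] to [(x^2 - 1) P_k^(1)], of degree
    [k + 2]: its expansion in the [P_j^(0)] has three terms, given by leading
    coefficients for [j = k, k + 2] and by a subleading one for [j = k + 1]. *)
Lemma jacobi_rectE m (k : 'I_m) (j : 'I_m.+1) :
  jacobi_rect z m k j = L 0 (('X^2 - 1) * (P 1 k * P 0 j)).
Proof.
rewrite mxE.
pose C := ('X^2 - 1) * P 1 k.
have CE : C = 'X^2 * P 1 k - P 1 k by rewrite /C; ring.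
have sC : (size C <= k.+3)%N.
  rewrite (leq_trans (size_polyMleq _ _))// opoly_size// size_XnsubC//.
have E1 A B : L 0 (('X^2 - 1) * (A * B)) = L 1 (A * B).
  by rewrite /L momfun_wmom1// mulrC.
case: eqP => [jk|/eqP jk].
  by rewrite E1 jk /L opoly_lead ?opoly_size// opoly_lcE.
have ECP (n : nat) : ('X^2 - 1) * (P 1 k * P 0 n) = P 0 n * C by rewrite /C; ring.
case: eqP => [jk1|/eqP jk1].
  pose r := rec_r z k.+1.
  have rE : r = C`_k.+2 / lc z 0 k.+2.
    rewrite /r /rec_r /=; congr (_ / _).
    rewrite CE coefB coefXnM /= subn2 /= [X in _ - X]nth_default ?opoly_size// subr0.
    by rewrite opoly_lcE.
  rewrite ECP jk1.
  have -> : L 0 (P 0 k.+1 * C) = L 0 (P 0 k.+1 * (C - r *: P 0 k.+2)).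
    rewrite mulrBr /L momfunB -scalerAr momfun_scale (opoly_orthonormal z0 zl0).2.
    by rewrite ltn_eqF// mulr0 subr0.
  have sB : (size (C - r *: P 0 k.+2)%R <= k.+2)%N.
    apply/leq_sizeP => i; rewrite leq_eqVlt => /orP[/eqP<-|ki].
      have lE := opoly_lcE z0 k.+2 zl0.
      by rewrite coefB coefZ lE rE divfK ?subrr// gt_eqF// lc_gt0.
    rewrite coefB coefZ !nth_default ?mulr0 ?subr0//; last by rewrite (leq_trans sC).
    by rewrite opoly_size.
  rewrite /L opoly_lead//.
  have l2 := lc_gt0 z0 k.+2 zl0; have l1 := lc_gt0 z0 k.+1 zl0.
  have hC : C`_k.+1 = - lc z 1 k * \sum_(1 <= i < k.+1) xz z 1 k i.
    rewrite CE coefB coefXnM [X in _ - X]nth_default ?opoly_size// subr0.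
    case: ltnP => [|k2]; last by rewrite subn2 /= (opoly_subleading z0 zl1).
    rewrite ltnS ltnS leqn0 => /eqP ->.
    by rewrite big_geq// mulr0.
  have hP : (P 0 k.+2)`_k.+1 = - lc z 0 k.+2 * \sum_(1 <= i < k.+3) xz z 0 k.+2 i.
    exact: (opoly_subleading (n := k.+2) z0 zl0 isT).
  rewrite coefB coefZ hC hP /rec_q /r /rec_r /=; field.
  by rewrite !gt_eqF.
case: eqP => [jk2|/eqP jk2].
  rewrite ECP jk2 /L opoly_lead// /rec_r /=; congr (_ / _).
  rewrite CE coefB coefXnM /= subn2 /= [X in _ - X]nth_default ?opoly_size// subr0.
  by rewrite opoly_lcE.
have [jk3|jk3] := ltnP k j.
  by rewrite ECP /L opoly_orth//; apply: leq_trans sC _; lia.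
rewrite E1 /L opoly_orth// opoly_size//.
by rewrite ltn_neqAle jk jk3.
Qed.

End FluxMatrices.

Section FluxForm.
Variables (R : realType) (z : R) (M : nat).
Hypothesis z0 : 0 < z.
Implicit Types (v w : 'rV[R]_(M.+1 + M)) (a b : R).

Let P l n := opoly l z n.
Let L l := momfun (wmom z l).
Let zl0 : (0 < 2)%N := isT.
Let zl1 : (1 < 2)%N := isT.
Let form := hyp_form (wmom z 0).

Definition even_part v : {poly R} := \sum_(k < M.+1) v 0 (lshift M k) *: P 0 k.
Definition odd_part v : {poly R} := \sum_(k < M) v 0 (rshift M.+1 k) *: P 1 k.

Let pe (i : 'I_(M.+1 + M)) : {poly R} :=
  match fintype.split i with inl k => P 0 k | inr _ => 0 end.
Let qe (i : 'I_(M.+1 + M)) : {poly R} :=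
  match fintype.split i with inl _ => 0 | inr k => P 1 k end.

Let pel k : pe (lshift M k) = P 0 k.
Proof. by rewrite /pe (unsplitK (inl k : 'I_M.+1 + 'I_M)%type). Qed.
Let per k : pe (rshift M.+1 k) = 0.
Proof. by rewrite /pe (unsplitK (inr k : 'I_M.+1 + 'I_M)%type). Qed.
Let qel k : qe (lshift M k) = 0.
Proof. by rewrite /qe (unsplitK (inl k : 'I_M.+1 + 'I_M)%type). Qed.
Let qer k : qe (rshift M.+1 k) = P 1 k.
Proof. by rewrite /qe (unsplitK (inr k : 'I_M.+1 + 'I_M)%type). Qed.

Lemma even_partE v : even_part v = \sum_i v 0 i *: pe i.
Proof.
rewrite big_split_ord /= [X in _ = _ + X]big1 ?addr0.
  by apply: eq_bigr => k _; rewrite pel.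
by move=> k _; rewrite per scaler0.
Qed.

Lemma odd_partE v : odd_part v = \sum_i v 0 i *: qe i.
Proof.
rewrite big_split_ord /= [X in _ = X + _]big1 ?add0r.
  by apply: eq_bigr => k _; rewrite qer.
by move=> k _; rewrite qel scaler0.
Qed.

Lemma hyp_formE a b (p q p' q' : {poly R}) : form a b p q p' q' =
  a * L 0 ('X * (p * p')) + a * L 1 ('X * (q * q')) +
  b * (L 0 (('X^2 - 1) * (q' * p)) + L 0 (('X^2 - 1) * (q * p'))).
Proof.
rewrite /form /hyp_form /L momfun_wmom1// -!momfunD -!momfun_scale -!momfunD.
by congr (momfun _ _); rewrite -!mul_polyC; ring.
Qed.

Lemma flux_entry a b (i j : 'I_(M.+1 + M)) :
  (a *: A0 z M + b *: A1 z M) i j = form a b (pe i) (qe i) (pe j) (qe j).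
Proof.
rewrite hyp_formE mxE [(a *: A0 z M) i j]mxE [(b *: A1 z M) i j]mxE /A0 /A1.
have mx0 m n (r : 'I_m) (s : 'I_n) : (0 : 'M[R]_(m, n)) r s = 0 by rewrite mxE.
have trE m n (B : 'M[R]_(m, n)) r s : B^T r s = B s r by rewrite mxE.
have L0' l : L l 0 = 0 by rewrite /L momfun0.
case: (split_ordP i) => k ->; case: (split_ordP j) => k' ->;
  rewrite ?pel ?per ?qel ?qer ?mul0r ?mulr0 ?L0' ?mulr0 ?add0r ?addr0.
- by rewrite !block_mxEul mx0 jacobiE// !mulr0 !addr0.
- by rewrite !block_mxEur mx0 trE jacobi_rectE// mulr0 add0r.
- by rewrite !block_mxEdl mx0 jacobi_rectE// mulr0 add0r.
- by rewrite !block_mxEdr mx0 jacobiE// !mulr0 !addr0.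
Qed.

Lemma flux_form a b v w : (v *m (a *: A0 z M + b *: A1 z M) *m w^T) 0 0 =
  form a b (even_part v) (odd_part v) (even_part w) (odd_part w).
Proof.
rewrite !even_partE !odd_partE /form hyp_formC hyp_form_suml mxE.
apply: eq_bigr => j _; rewrite [w^T _ _]mxE mulrC; congr (_ * _).
rewrite hyp_formC hyp_form_suml mxE; apply: eq_bigr => i _.
by rewrite flux_entry.
Qed.

Lemma size_even_part v : (size (even_part v) <= M.+1)%N.
Proof.
rewrite (leq_trans (size_sum _ _ _))//; apply/bigmax_leqP => k _.
by rewrite (leq_trans (size_scale_leq _ _))// opoly_size.
Qed.

Lemma size_odd_part v : (size (odd_part v) <= M)%N.
Proof.
rewrite (leq_trans (size_sum _ _ _))//; apply/bigmax_leqP => k _.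
by rewrite (leq_trans (size_scale_leq _ _))// opoly_size.
Qed.

Lemma parts_eq0 v : even_part v = 0 -> odd_part v = 0 -> v = 0.
Proof.
have coord l n (c : 'I_n -> R) (k : 'I_n) : (l < 2)%N ->
    L l ((\sum_(i < n) c i *: P l i) * P l k) = c k.
  move=> l2; rewrite mulr_suml /L momfun_sum (bigD1 k)//= -scalerAl momfun_scale.
  rewrite (opoly_orthonormal z0 l2).2 eqxx mulr1 big1 ?addr0// => i ik.
  rewrite -scalerAl momfun_scale (opoly_orthonormal z0 l2).2.
  by rewrite (_ : (_ == _ :> nat) = false) ?mulr0//; exact/negbTE.
move=> p0 q0; apply/rowP => i; rewrite mxE; case: (split_ordP i) => k ->.
  by rewrite -(coord 0%N _ (fun k => v 0 (lshift M k)))// -/(even_part v) p0 mul0r /L momfun0.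
by rewrite -(coord 1%N _ (fun k => v 0 (rshift M.+1 k)))// -/(odd_part v) q0 mul0r /L momfun0.
Qed.

Lemma parts_surj (p q : {poly R}) : (size p <= M.+1)%N -> (size q <= M)%N ->
  exists v, even_part v = p /\ odd_part v = q.
Proof.
move=> sp sq.
exists (row_mx (\row_(k < M.+1) L 0 (p * P 0 k)) (\row_(k < M) L 1 (q * P 1 k))).
split; [rewrite [RHS](orthonormal_expand (orthonormal_familyW _ (opoly_orthonormal z0 zl0)) sp)
       |rewrite [RHS](orthonormal_expand (orthonormal_familyW _ (opoly_orthonormal z0 zl1)) sq)].
  by apply: eq_bigr => k _; rewrite row_mxEl mxE.
by apply: eq_bigr => k _; rewrite row_mxEr mxE.
Qed.

Lemma even_part_lin a b v w : even_part (a *: v + b *: w) = a *: even_part v + b *: even_part w.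
Proof.
rewrite /even_part !scaler_sumr -big_split; apply: eq_bigr => k _.
by rewrite !mxE /= scalerDl !scalerA.
Qed.

Lemma odd_part_lin a b v w : odd_part (a *: v + b *: w) = a *: odd_part v + b *: odd_part w.
Proof.
rewrite /odd_part !scaler_sumr -big_split; apply: eq_bigr => k _.
by rewrite !mxE /= scalerDl !scalerA.
Qed.

Lemma flux_form_gt0 b v : `|b| <= 1 -> v != 0 ->
  0 < (v *m (A0 z M + b *: A1 z M) *m v^T) 0 0.
Proof.
move=> b1 v0; rewrite -[A0 z M]scale1r flux_form.
apply: (hyp_form_gt0 (wmom_positive z0 0) b1).
rewrite -negb_and; apply: contra v0 => /andP[/eqP p0 /eqP q0].
by apply/eqP/parts_eq0.
Qed.

(** Some combination of the two solutions has no top coefficient in [x + s], and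
    [hyp_kernel] with [c^2 = (1 + m) / (1 - m)] makes it vanish. *)
Lemma flux_simple m v w : (0 < M)%N -> `|m| < 1 ->
  v *m (- m *: A0 z M + A1 z M) = 0 -> w *m (- m *: A0 z M + A1 z M) = 0 ->
  exists c : R * R, c != 0 /\ c.1 *: v + c.2 *: w = 0.
Proof.
move=> M0; rewrite ltr_norml => /andP[m1 m2] vA wA.
pose top u := (even_part u)`_M + (odd_part u)`_M.-1.
suff ker u : u *m (- m *: A0 z M + A1 z M) = 0 -> top u = 0 -> u = 0.
  have top_lin a b : top (a *: v + b *: w) = a * top v + b * top w.
    by rewrite /top even_part_lin odd_part_lin !coefD !coefZ; ring.
  have kerl a b : (a *: v + b *: w) *m (- m *: A0 z M + A1 z M) = 0.
    by rewrite mulmxDl -!scalemxAl vA wA !scaler0 addr0.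
  have [tv|tv] := eqVneq (top v) 0.
    exists (1, 0); split; first by rewrite xpair_eqE oner_eq0.
    by apply: ker => //; rewrite top_lin tv mulr0 mul0r addr0.
  exists (top w, - top v); split; first by rewrite xpair_eqE oppr_eq0 (negbTE tv) andbF.
  by apply: ker => //=; rewrite top_lin; ring.
move=> uA ut; pose c := Num.sqrt ((1 + m) / (1 - m)).
have c0 : 0 < c by rewrite sqrtr_gt0 divr_gt0//; lra.
have cE : c ^+ 2 = (1 + m) / (1 - m) by rewrite sqr_sqrtr// divr_ge0//; lra.
have [] := hyp_kernel (wmom_positive z0 0) c0 M0 (size_even_part u) (size_odd_part u) ut.
  move=> p q sp sq; have [w' [<- <-]] := parts_surj sp sq.
  rewrite -/form -flux_form.
  have -> : (1 - c ^+ 2) *: A0 z M + (1 + c ^+ 2) *: A1 z M =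
     (2 / (1 - m)) *: (- m *: A0 z M + A1 z M).
    rewrite cE scalerDr scalerA; congr (_ *: _ + _ *: _); field.
      by rewrite gt_eqF//; lra.
    by rewrite gt_eqF//; lra.
  by rewrite -scalemxAr uA scaler0 mul0mx mxE.
exact: parts_eq0.
Qed.

End FluxForm.

(** * Reduction to the invertibility of the change of variables *)

Lemma moment_label_inj : injective moment_label.
Proof.
move=> i j; rewrite /moment_label.
have hi := odd_double_half i; have hj := odd_double_half j.
case: eqP => [->|/eqP i0]; case: eqP => [->|/eqP j0] //.
- by case: ifP => oj // [] /eqP; lia.
- by case: ifP => oi // [] /eqP; lia.
by case: ifP => oi; case: ifP => oj // [] e; move: hi hj; rewrite oi oj; lia.
Qed.

Section Reduction.
Variables (R : realType) (M : nat).
Hypothesis M0 : (0 < M)%N.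

Lemma perm_matrix_mulT : perm_matrix R M *m (perm_matrix R M)^T = 1%:M.
Proof.
apply/matrixP => i j.
have := perm_matrixP (fun l => (l == moment_label j)%:R : R) M0.
move=> /(congr1 (fun A : 'cV[R]_(M.+1 + M) => A i 0)).
rewrite [RHS]mxE => h.
transitivity ((moment_label i == moment_label j)%:R : R); last first.
  by rewrite !mxE (inj_eq moment_label_inj) (inj_eq val_inj).
rewrite -h !mxE; apply: eq_bigr => k _; rewrite !mxE.
by rewrite [moment_label j == _]eq_sym.
Qed.

Lemma perm_matrix_mulTl : (perm_matrix R M)^T *m perm_matrix R M = 1%:M.
Proof. exact: mulmx1C perm_matrix_mulT. Qed.

Lemma jacobi_sym (z : R) l m : 0 < z -> (l < 2)%N -> (jacobi z l m)^T = jacobi z l m.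
Proof.
move=> z0 l2; apply/matrixP => i j; rewrite mxE !jacobiE//.
by rewrite [opoly l z j * _]mulrC.
Qed.

Lemma A0_sym (z : R) : 0 < z -> (A0 z M)^T = A0 z M.
Proof. by move=> z0; rewrite /A0 tr_block_mx !trmx0 !jacobi_sym. Qed.

Lemma A1_sym (z : R) : (A1 z M)^T = A1 z M.
Proof. by rewrite /A1 tr_block_mx !trmx0 trmxK. Qed.

(** Up to the permutation, the pencil [M^x - a M^t] is a multiple of
    [A1 - m A0], where [m = (u - a) / (1 - a u)] is the relativistic velocity
    difference. *)
Lemma hyperbolic_of_unit (W : 'cV[R]_(M.+1 + M)) :
  `|u_ W| < 1 -> 0 < theta_ W -> Dmx W \in unitmx ->
  B0 W \in unitmx /\ real_distinct_spectrum (Bmx W) /\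
  diagonalizable (Bmx W) /\ spectral_radius (Bmx W) < 1.
Proof.
move=> u1 th0 Du; have z0 : 0 < (theta_ W)^-1 by rewrite invr_gt0.
set u := u_ W in u1; set z := (theta_ W)^-1 in z0.
pose Pm := perm_matrix R M.
have PPt : Pm *m Pm^T = 1%:M := perm_matrix_mulT.
have PtP : Pm^T *m Pm = 1%:M := perm_matrix_mulTl.
pose St := U0 u *: A0 z M - U1 u *: A1 z M.
pose Sx := U1 u *: A0 z M - U0 u *: A1 z M.
have TE : Mt W = Pm *m St *m Pm^T by [].
have XE : Mx W = Pm *m Sx *m Pm^T by [].
have symm (S : 'M[R]_(M.+1 + M)) : S^T = S -> (Pm *m S *m Pm^T)^T = Pm *m S *m Pm^T.
  by move=> Ss; rewrite !trmx_mul trmxK Ss mulmxA.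
have Sts : St^T = St by rewrite /St linearB /= !linearZ /= A0_sym// A1_sym.
have Sxs : Sx^T = Sx by rewrite /Sx linearB /= !linearZ /= A0_sym// A1_sym.
have Uu := U0_gt0 u1.
have u1' := u1; rewrite ltr_norml in u1'; case/andP: u1' => um up.
have P0 (v : 'rV[R]_(M.+1 + M)) : v != 0 -> v *m Pm != 0.
  apply: contra => /eqP vP; apply/eqP.
  by rewrite -[v]mulmx1 -PPt mulmxA vP mul0mx.
have formE (S : 'M[R]_(M.+1 + M)) (v : 'rV[R]_(M.+1 + M)) :
    v *m (Pm *m S *m Pm^T) *m v^T = (v *m Pm) *m S *m (v *m Pm)^T.
  by rewrite trmx_mul !mulmxA.
have St_pos (y : 'rV[R]_(M.+1 + M)) : y != 0 -> 0 < (y *m St *m y^T) 0 0.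
  move=> y0; have -> : St = U0 u *: (A0 z M + (- u) *: A1 z M).
    by rewrite scalerDr scalerA /St /U1 mulrN [u * _]mulrC scaleNr.
  rewrite -scalemxAr -scalemxAl mxE mulr_gt0// flux_form_gt0// normrN ltW//.
have Sx_lt (y : 'rV[R]_(M.+1 + M)) : y != 0 ->
    `|(y *m Sx *m y^T) 0 0| < (y *m St *m y^T) 0 0.
  move=> y0.
  have comb e : e = 1 \/ e = -1 -> 0 < (y *m St *m y^T) 0 0 + e * (y *m Sx *m y^T) 0 0.
    move=> e1.
    have e_norm : `|- e| <= 1 by case: e1 => ->; rewrite ?opprK ?normrN normr1.
    have := flux_form_gt0 z0 e_norm y0.
    have pos : 0 < U0 u + e * U1 u.
      have -> : U0 u + e * U1 u = U0 u * (1 + e * u) by rewrite /U1; ring.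
      by rewrite mulr_gt0//; case: e1 => ->; lra.
    rewrite -(pmulr_rgt0 _ pos).
    have <- : (y *m ((U0 u + e * U1 u) *: (A0 z M + - e *: A1 z M)) *m y^T) 0 0 =
        (U0 u + e * U1 u) * (y *m (A0 z M + - e *: A1 z M) *m y^T) 0 0.
      by rewrite -scalemxAr -scalemxAl mxE.
    have -> : (U0 u + e * U1 u) *: (A0 z M + - e *: A1 z M) = St + e *: Sx.
      rewrite /St /Sx; move: (A0 z M) (A1 z M) => X Y; apply/matrixP => i j.
      by rewrite !mxE; case: e1 => ->; ring.
    have -> : y *m (St + e *: Sx) *m y^T = y *m St *m y^T + e *: (y *m Sx *m y^T).
      by rewrite mulmxDr mulmxDl -scalemxAr -scalemxAl.
    by move: (y *m St *m y^T) (y *m Sx *m y^T) => X Y; rewrite !mxE.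
  have := comb 1 (or_introl erefl); have := comb (-1) (or_intror erefl).
  by rewrite ltr_norml => *; apply/andP; split; lra.
have := @pencil_hyperbolic R (M + M) (Mt W) (Mx W) (Dmx W).
move=> /(_ _ _ Du)[].
- by rewrite TE symm.
- by rewrite XE symm.
- by move=> v v0; rewrite TE formE St_pos// P0.
- by move=> v v0; rewrite TE XE !formE Sx_lt// P0.
- move=> a v w; rewrite ltr_norml => /andP[am ap].
  pose m := (u - a) / (1 - a * u).
  have au0 : 0 < 1 - a * u by nra.
  have m1 : `|m| < 1.
    rewrite ltr_norml /m; apply/andP; split.
      by rewrite ltr_pdivlMr//; nra.
    by rewrite ltr_pdivrMr//; nra.
  have keq (y : 'rV[R]_(M.+1 + M)) : y *m Mx W = a *: (y *m Mt W) ->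
      (y *m Pm) *m (- m *: A0 z M + A1 z M) = 0.
    rewrite TE XE => h.
    have {}h : y *m Pm *m Sx = a *: (y *m Pm *m St).
      have := congr1 (fun B => B *m Pm) h.
      by rewrite -scalemxAl !mulmxA -!(mulmxA _ Pm^T) PtP !mulmx1.
    have -> : - m *: A0 z M + A1 z M = - (U0 u * (1 - a * u))^-1 *: (Sx - a *: St).
      rewrite /St /Sx /U1 /m; move: (A0 z M) (A1 z M) => X Y; apply/matrixP => i j.
      by rewrite !mxE; field; rewrite !gt_eqF.
    by rewrite -scalemxAr mulmxBr -scalemxAr h subrr scaler0.
  move=> /keq hv /keq hw; have [c [c0 h]] := flux_simple z0 M0 m1 hv hw.
  exists c; split=> //.
  have := congr1 (fun B => B *m Pm^T) h.
  by rewrite mulmxDl -!scalemxAl -!mulmxA PPt !mulmx1 mul0mx.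
- by move=> Bu rs dg sr.
Qed.

End Reduction.

(** * Differentiable families of polynomials *)

Section PolynomialFamilies.
Variable R : realType.
Implicit Types (z y : R) (Q T : R -> {poly R}).

Lemma is_derive_funV (f : R -> R) z a : is_derive z 1 f a -> f z != 0 ->
  is_derive z 1 (fun y => (f y)^-1) (- a / f z ^+ 2).
Proof.
move=> df f0; have := is_deriveV f0 df => h; apply: (is_derive_eq h).
by rewrite /GRing.scale /=; field.
Qed.

Lemma is_derive_funsum n (h : 'I_n -> R -> R) z (dh : 'I_n -> R) :
  (forall i, is_derive z 1 (h i) (dh i)) ->
  is_derive z 1 (fun y => \sum_(i < n) h i y) (\sum_(i < n) dh i).
Proof.
move=> H; have := @is_derive_sum _ _ _ n h z 1 dh H.
by rewrite (_ : \sum_(i < n) h i = fun y => \sum_(i < n) h i y) ?fct_sumE.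
Qed.

(** The uniform degree bound turns evaluations and moment functionals into sums
    with a fixed number of terms, which can be differentiated termwise. *)
Definition pdiff z Q (dQ : {poly R}) :=
  (exists n, forall y, (size (Q y) <= n)%N) /\
  forall i, is_derive z 1 (fun y => (Q y)`_i) dQ`_i.

(** The degree bound passes to the derivative, so that the two sums over the
    coefficients have the same range. *)
Lemma pdiff_size z Q dQ n : pdiff z Q dQ -> (forall y, (size (Q y) <= n)%N) ->
  (size dQ <= n)%N.
Proof.
move=> [_ dQE] sQ; apply/leq_sizeP => j nj.
have := dQE j; rewrite (_ : (fun y => _) = cst 0); last first.
  by apply/funext => y /=; rewrite nth_default// (leq_trans (sQ y)).
by move=> [_ <-]; rewrite derive_cst.
Qed.

Lemma pdiff_cst z (A : {poly R}) : pdiff z (fun=> A) 0.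
Proof.
split; first by exists (size A).
by move=> i; rewrite coef0; exact: is_derive_cst.
Qed.

Lemma pdiffD z Q T dQ dT : pdiff z Q dQ -> pdiff z T dT ->
  pdiff z (fun y => Q y + T y) (dQ + dT).
Proof.
move=> [[n nQ] dQE] [[m mT] dTE]; split.
  exists (maxn n m) => y; rewrite (leq_trans (size_polyD _ _))//.
  by rewrite geq_max !leq_max nQ mT orbT.
move=> i; rewrite coefD; under eq_fun do rewrite coefD.
exact: is_derive_funD.
Qed.

Lemma pdiffZ z (c : R -> R) dc Q dQ : is_derive z 1 c dc -> pdiff z Q dQ ->
  pdiff z (fun y => c y *: Q y) (dc *: Q z + c z *: dQ).
Proof.
move=> dcE [[n nQ] dQE]; split.
  by exists n => y; rewrite (leq_trans (size_scale_leq _ _)).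
move=> i; rewrite coefD !coefZ; under eq_fun do rewrite coefZ.
exact: is_derive_funM.
Qed.

Lemma pdiffN z Q dQ : pdiff z Q dQ -> pdiff z (fun y => - Q y) (- dQ).
Proof.
move=> h; have := pdiffZ (is_derive_cst (-1 : R) z 1) h.
rewrite scale0r add0r scaleN1r /=.
by under eq_fun do rewrite scaleN1r.
Qed.

Lemma pdiffM z Q T dQ dT : pdiff z Q dQ -> pdiff z T dT ->
  pdiff z (fun y => Q y * T y) (dQ * T z + Q z * dT).
Proof.
move=> [[n nQ] dQE] [[m mT] dTE]; split.
  exists (n + m)%N => y; rewrite (leq_trans (size_polyMleq _ _))//.
  by rewrite (leq_trans (leq_pred _))// leq_add.
move=> i; rewrite coefD !coefM -big_split /=.
under eq_fun do rewrite coefM.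
by apply: is_derive_funsum => j; exact: is_derive_funM.
Qed.

Lemma pdiff_sum z n (Q : 'I_n -> R -> {poly R}) :
  (forall i, exists dQ, pdiff z (Q i) dQ) ->
  exists dS, pdiff z (fun y => \sum_(i < n) Q i y) dS.
Proof.
elim: n Q => [|n IH] Q dQ.
  by exists 0; under eq_fun do rewrite big_ord0; exact: pdiff_cst.
have [dS hS] := IH _ (fun i => dQ (widen_ord (leqnSn n) i)).
have [dT hT] := dQ ord_max.
by exists (dS + dT); under eq_fun do rewrite big_ord_recr /=; exact: pdiffD.
Qed.

Lemma pdiff_horner z Q dQ x : pdiff z Q dQ ->
  is_derive z 1 (fun y => (Q y).[x]) dQ.[x].
Proof.
move=> h; have [[n nQ] dQE] := h; have sd := pdiff_size h nQ.
rewrite (horner_coef_wide _ sd); under eq_fun do rewrite (horner_coef_wide _ (nQ _)).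
apply: is_derive_funsum => i.
have := is_derive_funM (dQE i) (is_derive_cst (x ^+ i) z 1).
by rewrite mulr0 addr0.
Qed.

Lemma pdiff_momfun z (w : R -> nat -> R) dw Q dQ :
  (forall k, is_derive z 1 (w^~ k) (dw k)) -> pdiff z Q dQ ->
  is_derive z 1 (fun y => momfun (w y) (Q y)) (momfun (w z) dQ + momfun dw (Q z)).
Proof.
move=> dwE h; have [[n nQ] dQE] := h; have sd := pdiff_size h nQ.
rewrite (momfun_widen _ sd) (momfun_widen _ (nQ z)) -big_split /=.
under eq_fun do rewrite (momfun_widen _ (nQ _)).
by apply: is_derive_funsum => i; exact: is_derive_funM.
Qed.

Lemma size_gs (w : nat -> R) n : (size (gs w n) <= n.+1)%N.
Proof.
elim/ltn_ind: n => n IH; rewrite gsE (leq_trans (size_scale_leq _ _))//.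
rewrite /gs_dir (leq_trans (size_polyD _ _))// geq_max size_polyXn leqnn size_polyN.
rewrite (leq_trans (size_sum _ _ _))//; apply/bigmax_leqP => i _.
rewrite (leq_trans (size_scale_leq _ _))// (leq_trans (IH _ (ltn_ord i)))//.
by rewrite ltnS ltnW.
Qed.

Lemma pdiff_gs z (w : R -> nat -> R) dw n : positive_moments (w z) ->
  (forall k, is_derive z 1 (w^~ k) (dw k)) ->
  exists dQ, pdiff z (fun y => gs (w y) n) dQ.
Proof.
move=> wpos dwE; elim/ltn_ind: n => n IH.
have [dS hS] : exists dS, pdiff z (fun y => gs_dir (w y) n) dS.
  have [|dT hT] := @pdiff_sum z n
    (fun i y => momfun (w y) ('X^n * gs (w y) i) *: gs (w y) i).
    move=> i; have [dQ hQ] := IH _ (ltn_ord i).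
    have h1 := pdiffM (pdiff_cst z 'X^n) hQ.
    by eexists; apply: pdiffZ hQ; exact: pdiff_momfun dwE h1.
  by eexists; rewrite /gs_dir; apply: pdiffD (pdiff_cst z _) (pdiffN hT).
have -> : (fun y => gs (w y) n) = (fun y =>
    (Num.sqrt (momfun (w y) (gs_dir (w y) n * gs_dir (w y) n)))^-1 *: gs_dir (w y) n).
  by apply/funext => y; rewrite gsE.
have [_ mono _] := gs_dirP (gs_orthonormal_upto wpos n).1.
have N0 := momfun_sqr_gt0 wpos (monic_neq0 mono).
have h1 := pdiff_momfun dwE (pdiffM hS hS).
have h2 := is_derive_compE h1 (is_derive1_sqrt N0) erefl.
have s0 : Num.sqrt (momfun (w z) (gs_dir (w z) n * gs_dir (w z) n)) != 0.
  by rewrite gt_eqF// sqrtr_gt0.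
have h3 := is_derive_funV h2 s0.
by eexists; exact: pdiffZ h3 hS.
Qed.

End PolynomialFamilies.

(** * Temperature dependence of the moments *)

Section ThermalDerivative.
Variables (R : realType) (z : R).
Hypothesis z0 : 0 < z.
Implicit Types (y : R) (Q : R -> {poly R}) (A : {poly R}).

Let kap : R := mom z 2 / mom z 1.

(** The derivative of the moments in [z]: differentiation multiplies the
    normalized weight by [kap - x], as the derivative of [K_1 = mom z 1] is
    [- mom z 2]. *)
Definition dwmom l k : R := - wmom z l k.+1 + kap * wmom z l k.

Lemma is_derive_momfun_mom A :
  is_derive z 1 (fun y => momfun (mom y) A) (- momfun (mom z) ('X * A)).
Proof.
have := pdiff_momfun (fun k => is_derive_mom k z0) (pdiff_cst z A).
rewrite momfun0 add0r => h; apply: (is_derive_eq h).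
have -> : 'X * A = A * 'X + 0%:P by rewrite polyC0 addr0 mulrC.
rewrite momfun_MXaddC mul0r addr0.
rewrite -mulN1r -momfunZ; congr (momfun _ _); apply/funext => k /=.
by rewrite mulN1r.
Qed.

Lemma is_derive_wmom l k : is_derive z 1 (fun y => wmom y l k) (dwmom l k).
Proof.
have K0 : mom z 1 != 0 by rewrite gt_eqF// mom_gt0.
have h1 := is_derive_momfun_mom ('X^k * ('X^2 - 1) ^+ l).
have h2 := is_derive_funV (is_derive_mom 1 z0) K0.
have h3 := is_derive_funM h1 h2; apply: (is_derive_eq h3).
have -> : 'X * ('X^k * ('X^2 - 1) ^+ l) = 'X^(k.+1) * ('X^2 - 1) ^+ l :> {poly R}.
  by rewrite mulrA -exprS.
rewrite /dwmom /wmom /kap.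
by set c1 := momfun _ ('X^(k.+1) * _); set c2 := momfun _ _; field.
Qed.

Lemma momfun_dwmom l A : momfun (dwmom l) A =
  momfun (wmom z l) (- ('X * A) + kap *: A).
Proof.
have -> : - ('X * A) + kap *: A = (- A) * 'X + 0%:P + kap *: A.
  by rewrite polyC0 addr0; ring.
rewrite momfunD momfun_scale momfun_MXaddC mul0r addr0 momfunN.
rewrite -mulN1r -!momfunZ /momfun -big_split; apply: eq_bigr => i _ /=.
by rewrite /dwmom; ring.
Qed.

Lemma pdiff_gs_wmom l n : exists dQ, pdiff z (fun y => gs (wmom y l) n) dQ.
Proof.
apply: (pdiff_gs n (wmom_positive z0 l)) => k; exact: is_derive_wmom.
Qed.

(** The right-hand side is the pairing with the derivative of the weighted
    family, whose weight contributes the factor [kap - x]. *)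
Lemma is_derive_pairing l Q dQ : pdiff z Q dQ ->
  is_derive z 1 (fun y => momfun (wmom y l) (Q y))
    (momfun (wmom z l) (dQ - 'X * Q z + kap *: Q z)).
Proof.
move=> hQ; have h := pdiff_momfun (is_derive_wmom l) hQ.
by apply: (is_derive_eq h); rewrite momfun_dwmom -momfunD addrA.
Qed.

(** The normalization by [K_1] freezes the moment of order one. *)
Lemma dwmom1 : dwmom 0 1 = 0.
Proof.
have K0 : mom z 1 != 0 by rewrite gt_eqF// mom_gt0.
by rewrite /dwmom /wmom expr0 !mulr1 !momfunXn /kap; field.
Qed.

Let variance (a b c : R) : 0 < a -> 
  (forall t, 0 < c - 2 * t * b + t ^+ 2 * a) -> b ^+ 2 < a * c.
Proof.
move=> a0 h; have := h (b / a).
have -> : c - 2 * (b / a) * b + (b / a) ^+ 2 * a = (a * c - b ^+ 2) / a.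
  by field; rewrite gt_eqF.
by rewrite pmulr_lgt0 ?invr_gt0// subr_gt0.
Qed.

(* Cauchy-Schwarz for [1] and [x]: integrate [(x - t)^2] for every [t]. *)
Let mom_schwarz k : mom z k.+1 ^+ 2 < mom z k * mom z k.+2.
Proof.
apply: variance; first exact: mom_gt0.
move=> t; have -> : mom z k.+2 - 2 * t * mom z k.+1 + t ^+ 2 * mom z k =
    momfun (mom z) ('X^k * ('X - t%:P) ^+ 2).
  have -> : 'X^k * ('X - t%:P) ^+ 2 = 'X^(k.+2) - (2 * t) *: 'X^(k.+1) + t ^+ 2 *: 'X^k.
    by rewrite -!mul_polyC !exprS !polyCM; ring.
  by rewrite momfunD momfunB !momfun_scale !momfunXn.
apply: momfun_mom_gt0 => //.
  by rewrite mulf_neq0 ?expf_neq0 ?polyX_eq0 ?polyXsubC_eq0.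
move=> x x1; rewrite hornerM hornerXn horner_exp mulr_ge0 ?sqr_ge0//.
by rewrite exprn_ge0// (le_trans ler01).
Qed.

(** As the moment of order one is frozen, the sign is that of the strict
    Cauchy-Schwarz inequality between the moments 1, 2, 3. *)
Lemma dwmom2_neq0 : dwmom 0 2 != 0.
Proof.
have K0 : mom z 1 != 0 by rewrite gt_eqF// mom_gt0.
have := mom_schwarz 1.
rewrite /dwmom /wmom expr0 !mulr1 !momfunXn /kap => h.
have -> : - (mom z 3 / mom z 1) + mom z 2 / mom z 1 * (mom z 2 / mom z 1) =
  - ((mom z 1 * mom z 3 - mom z 2 ^+ 2) / mom z 1 ^+ 2) by field.
by rewrite oppr_eq0 mulf_neq0 ?invr_eq0 ?expf_neq0// gt_eqF// subr_gt0.
Qed.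

Lemma dwmom0_neq0 : dwmom 0 0 != 0.
Proof.
have K0 : mom z 1 != 0 by rewrite gt_eqF// mom_gt0.
have := mom_schwarz 0.
rewrite /dwmom /wmom expr0 !mulr1 !momfunXn /kap => h.
have -> : - (mom z 1 / mom z 1) + mom z 2 / mom z 1 * (mom z 0 / mom z 1) =
  ((mom z 0 * mom z 2 - mom z 1 ^+ 2) / mom z 1 ^+ 2) by field.
by rewrite mulf_neq0 ?invr_eq0 ?expf_neq0// gt_eqF// subr_gt0.
Qed.

(** This is [L (delta f) = z L (s f)] for the derivation [delta x = s],
    [delta s = x] and [f = s q]: [delta] generates the boosts, which leave the
    invariant measure unchanged and act on [e^(-z x)] by the factor [- z s]. *)
Lemma wmom_by_parts (q : {poly R}) :
  momfun (wmom z 0) ('X * q + ('X^2 - 1) * q^`()) =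
  z * momfun (wmom z 0) (('X^2 - 1) * q).
Proof.
rewrite -(coefK q) poly_def.
apply: (big_ind (fun q : {poly R} => momfun (wmom z 0)
  ('X * q + ('X^2 - 1) * q^`()) = z * momfun (wmom z 0) (('X^2 - 1) * q))).
- by rewrite deriv0 !mulr0 addr0 momfun0 mulr0.
- move=> A B hA hB; rewrite derivD !mulrDr [in RHS]momfunD mulrDr -hA -hB -momfunD.
  by congr (momfun _ _); ring.
move=> i _; move: (q`_i) (nat_of_ord i) => c k.
rewrite derivZ -!scalerAr -scalerDr !momfun_scale mulrCA; congr (_ * _).
rewrite !momfun_wmom0 derivXn mulrA; congr (_ / _).
have := mom_by_parts k z0.
have -> : ('X^2 - 1) * 'X^k = 'X^(k.+2) - 'X^k :> {poly R}.
  by rewrite mulrBl mul1r -exprD.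
rewrite [in X in _ -> X]momfunB !momfunXn => ->.
have -> : 'X * 'X^k + ('X^2 - 1) * ('X^(k.-1) *+ k) =
    'X^(k.+1) + k%:R *: ('X^2 * 'X^(k.-1)) - k%:R *: 'X^(k.-1) :> {poly R}.
  by rewrite -!mul_polyC polyC_natr -mulr_natl (exprS 'X k); ring.
rewrite momfunB momfunD !momfun_scale !momfunXn -natr1.
case: k => [|k]; first by rewrite !mul0r addr0 add0r mul1r.
by rewrite -exprD add2n momfunXn /=; ring.
Qed.

End ThermalDerivative.

(** * The ansatz in closed form *)

Section ClosedForm.
Variable R : realType.
Implicit Types (z u p : R) (l n j : nat).

(** Minus the Christoffel-Darboux kernel at the origin: its pairing with a
    polynomial [A] of degree less than [n] is [- A.[0]]. *)
Definition kernel0 z l n : {poly R} :=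
  - \sum_(k < n) (gs (wmom z l) k).[0] *: gs (wmom z l) k.

(** The ansatz is linear in the coordinates other than [u] and [theta]: the
    coordinate [j] multiplies [g (even_shape + s odd_shape)]. The shapes are
    written with [gs], so that they are differentiable in [z]. *)
Definition even_shape z j : {poly R} :=
  match j with
  | 0 => 1
  | 1 | 2 | 4 => 0
  | 3 => kernel0 z 0 3
  | _ => if (moment_label j).1 == 0%N
         then gs (wmom z 0) (moment_label j).2 else 0
  end.

Definition odd_shape z j : {poly R} :=
  match j with
  | 0 | 1 | 2 | 3 => 0
  | 4 => kernel0 z 1 2
  | _ => if (moment_label j).1 == 0%N
         then 0 else gs (wmom z 1) (moment_label j).2
  end.

Definition even_profile M (W : 'cV[R]_(M.+1 + M)) z :=
  \sum_j W j 0 *: even_shape z j.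

Definition odd_profile M (W : 'cV[R]_(M.+1 + M)) z :=
  \sum_j W j 0 *: odd_shape z j.

Lemma kernel0_horner z l n x : 0 < z -> (l < 2)%N ->
  (kernel0 z l n).[x] = - \sum_(0 <= k < n) (opoly l z k).[0] * (opoly l z k).[x].
Proof.
move=> z0 l2; rewrite hornerN horner_sum big_mkord; congr (- _); apply: eq_bigr => k _.
by rewrite hornerZ -opoly_gs.
Qed.

Lemma moment_label_lt2 j : ((moment_label j).1 < 2)%N.
Proof. by rewrite /moment_label; case: ifP => // _; case: ifP. Qed.

Section Entries.
Variables (M : nat) (W : 'cV[R]_(M.+1 + M)).
Let z := (theta_ W)^-1.

Definition coefs (i : nat) : R :=
  if M == 1%N then (if i == 0%N then rho_ W / lc z 0 0 else 0)
  else match i with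
       | 0 => rho_ W / lc z 0 0 - lc z 0 0 * Pi_ W
       | 1 => lc z 0 1 * xz z 0 1 1 * Pi_ W
       | 2 => - lc z 1 0 * n1_ W
       | 3 => - lc z 0 2 * xz z 0 2 1 * xz z 0 2 2 * Pi_ W
       | 4 => lc z 1 1 * xz z 1 1 1 * n1_ W
       | _ => coordW W i
       end.

Lemma coordWE (i : 'I_(M.+1 + M)) : W i 0 = coordW W i.
Proof. by rewrite /coordW inord_val. Qed.

Lemma fvecE (i : 'I_(M.+1 + M)) : fvec W i 0 = coefs i.
Proof.
rewrite mxE /coefs -/z; case: ifP => // _.
by rewrite coordWE; case: (nat_of_ord i) => [|[|[|[|[|k]]]]].
Qed.

Definition basis_fun z E s (i : nat) : R :=
  (opoly (moment_label i).1 z (moment_label i).2).[E] * s ^+ (moment_label i).1.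

Definition shape_fun z E s j : R :=
  (even_shape z j).[E] + s * (odd_shape z j).[E].

Lemma F_basis p : F W p = gJ (u_ W) (theta_ W) p *
  \sum_(0 <= i < M.+1 + M)
     basis_fun z (energy (u_ W) p) (sig (u_ W) p) i * coefs i.
Proof.
rewrite big_mkord /F mulr_sumr; apply: eq_bigr => i _.
by rewrite fvecE mulrA [in RHS]mulrA.
Qed.

Lemma profile_fun y E s :
  (even_profile W y).[E] + s * (odd_profile W y).[E] =
  \sum_(0 <= j < M.+1 + M) coordW W j * shape_fun y E s j.
Proof.
rewrite big_mkord /even_profile /odd_profile !horner_sum mulr_sumr -big_split.
apply: eq_bigr => i _; rewrite !hornerZ coordWE /shape_fun mulrDr.
by congr (_ + _); rewrite mulrCA.
Qed.

End Entries.

Lemma opoly_const0 z l : 0 < z -> (l < 2)%N -> (opoly l z 0).[0] = lc z l 0.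
Proof. by move=> z0 l2; rewrite (opoly_const z0 0 l2) big_geq// mulr1. Qed.

Lemma opoly_const1 z l : 0 < z -> (l < 2)%N ->
  (opoly l z 1).[0] = - (lc z l 1 * xz z l 1 1).
Proof. by move=> z0 l2; rewrite (opoly_const z0 1 l2) big_nat1 mulrN. Qed.

Lemma opoly_const2 z l : 0 < z -> (l < 2)%N ->
  (opoly l z 2).[0] = lc z l 2 * (xz z l 2 1 * xz z l 2 2).
Proof.
move=> z0 l2; rewrite (opoly_const z0 2 l2); congr (_ * _).
by rewrite big_nat_recr//= big_nat1 mulrNN.
Qed.

Let sum3 (f : nat -> R) : \sum_(0 <= i < 3) f i = f 0%N + f 1%N + f 2%N.
Proof. by rewrite !big_nat_recr//= big_geq// add0r. Qed.

Let sum2 (f : nat -> R) : \sum_(0 <= i < 2) f i = f 0%N + f 1%N.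
Proof. by rewrite !big_nat_recr//= big_geq// add0r. Qed.

Let sum5 (f : nat -> R) :
  \sum_(0 <= i < 5) f i = f 0%N + f 1%N + f 2%N + f 3%N + f 4%N.
Proof. by rewrite !big_nat_recr//= big_geq// add0r. Qed.

(** Beyond the first five entries the state is the vector of coefficients. On
    the first five, [c_n x_1 ... x_n] is up to sign the value of [P_n] at the
    origin, so that the terms in [Pi] and in [n^1] add up to kernels. *)
Lemma FE M (W : 'cV[R]_(M.+1 + M)) p : (0 < M)%N -> 0 < theta_ W ->
  let E := energy (u_ W) p in
  F W p = gJ (u_ W) (theta_ W) p *
    ((even_profile W (theta_ W)^-1).[E] +
     sig (u_ W) p * (odd_profile W (theta_ W)^-1).[E]).
Proof.
move=> M0 th0 E.
have z0 : 0 < (theta_ W)^-1 by rewrite invr_gt0.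
rewrite F_basis profile_fun -/E; congr (_ * _).
move: (sig _ _) E => s E.
have l0 : (0 < 2)%N by []. have l1 : (1 < 2)%N by [].
have c00 : lc (theta_ W)^-1 0 0 != 0 by rewrite gt_eqF// lc_gt0.
have P00 x : (opoly 0 (theta_ W)^-1 0).[x] = lc (theta_ W)^-1 0 0.
  have sP := opoly_size z0 0 l0.
  by rewrite (size1_polyC (eq_leq sP)) hornerC (opoly_lcE z0 0 l0).
case: M W M0 th0 z0 c00 P00 => [//|[|M]] W _ th0 z0 c00 P00.
  rewrite !sum3 /coefs /shape_fun /basis_fun /even_shape /odd_shape.
  rewrite /=; move: P00; generalize (opoly 0 (theta_ W)^-1) (opoly 1 (theta_ W)^-1) => P Q P00.
  rewrite P00 /rho_.
  rewrite !horner0 !hornerC !mulr0 !addr0 !mulr0 !addr0 !mulr1.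
  by rewrite mulrC divfK.
have le5 : (5 <= M.+3 + M.+2)%N by lia.
rewrite (big_cat_nat _ le5)//= [in RHS](big_cat_nat _ le5)//=; congr (_ + _); last first.
  apply: eq_big_nat => i /andP[i5 iM].
  have := moment_label_lt2 i.
  case: i i5 iM => [|[|[|[|[|i]]]]] // _ _.
  rewrite /coefs /shape_fun /basis_fun /=.
  case: (moment_label _).1 => [|[|//]] _ /=.
    by rewrite -opoly_gs// horner0; ring.
  by rewrite -opoly_gs// horner0; ring.
rewrite !sum5 /coefs /shape_fun /basis_fun (_ : M.+2 == 1%N = false)//.
rewrite /even_shape /odd_shape /=.
move: (theta_ W)^-1 z0 c00 P00 => z z0 c00 P00.
rewrite (kernel0_horner 3 E z0 l0) (kernel0_horner 2 E z0 l1).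
rewrite sum3 sum2.
rewrite !horner0 !hornerC /=.
have e01 := opoly_const1 z0 l0; have e02 := opoly_const2 z0 l0.
have e10 := opoly_const0 z0 l1; have e11 := opoly_const1 z0 l1.
move: e01 e02 e10 e11 P00.
generalize (opoly 0 z) (opoly 1 z) => P Q.
move=> e01 e02 e10 e11 P00.
rewrite e01 e02 e10 e11.
rewrite !P00 /rho_ /Pi_ /n1_ expr0 expr1.
clear e01 e02 e10 e11 P00.
move: (P 1%N).[E] (P 2%N).[E] (Q 0%N).[E] (Q 1%N).[E] => P1 P2 Q0 Q1.
move: (coordW W 0) (coordW W 1) (coordW W 2) (coordW W 3) (coordW W 4).
move: (xz z 0 1 1) (xz z 0 2 1) (xz z 0 2 2) (xz z 1 1 1).
move: (lc z 0 0) (lc z 0 1) (lc z 0 2) (lc z 1 0) (lc z 1 1) c00.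
by move=> c c1 c2 d0 d1 c00 x1 x2 x3 x4 r0 r1 r2 r3 r4; field.
Qed.

End ClosedForm.

(** * Partial derivatives of the ansatz *)

Section StateDerivative.
Variable R : realType.
Implicit Types (z u p : R) (A B : {poly R}).

Lemma derive_line (V : normedModType R) (f : V -> R) (a v : V) :
  'D_v f a = 'D_1 (fun h : R => f (h *: v + a)) 0.
Proof.
rewrite /derive; congr (lim (_ @ 0^')); apply/funext => h /=.
by rewrite /shift /= !addr0 scale0r add0r /GRing.scale /= mulr1.
Qed.

Lemma is_derive_shift (f : R -> R) (x a : R) :
  is_derive x 1 f a -> is_derive (0 : R) 1 (fun h => f (h + x)) a.
Proof.
move=> df; have d1 := is_derive_funD (is_derive_id (0 : R) 1) (is_derive_cst x (0 : R) 1).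
have df' : is_derive (0 + cst x (0 : R)) 1 f a by rewrite /= add0r.
by apply: (is_derive_compE d1 df'); rewrite addr0 mulr1.
Qed.

Lemma is_derive_U0 u : `|u| < 1 -> is_derive u 1 (@U0 R) (u * U0 u ^+ 3).
Proof.
move=> u1; have d0 : 0 < 1 - u ^+ 2.
  by rewrite subr_gt0 -real_normK ?num_real// expr_lt1.
have s0 : Num.sqrt (1 - u ^+ 2) != 0 by rewrite gt_eqF// sqrtr_gt0.
have d1 := is_derive_funX 2 (is_derive_id u (1 : R)).
have d2 := is_derive_funD (is_derive_cst (1 : R) u 1)
  (is_derive_funM (is_derive_cst (- 1 : R) u 1) d1).
have d0' : 0 < cst 1 u + cst (- 1) u * u ^+ 2 by rewrite /= mulN1r.
have d3 := is_derive_compE d2 (is_derive1_sqrt d0') erefl.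
have s0' : Num.sqrt (cst 1 u + cst (- 1) u * u ^+ 2) != 0 by rewrite /= mulN1r.
have d4 := is_derive_funV d3 s0'.
have -> : @U0 R = fun u => (Num.sqrt (cst 1 u + cst (- 1) u * u ^+ 2))^-1.
  by apply/funext => y; rewrite /= mulN1r.
apply: (is_derive_eq d4); rewrite /= mulN1r /U0 mul0r !add0r.
by field.
Qed.

Lemma cube_U0 u : `|u| < 1 -> U0 u ^+ 3 = U0 u + u ^+ 2 * U0 u ^+ 3.
Proof. by move=> u1; rewrite -[in X in X + _](mulr1 (U0 u)) -(sqr_U0 u1); ring. Qed.

Lemma is_derive_energy_velocity u p : `|u| < 1 ->
  is_derive u 1 (fun u => energy u p) (U0 u ^+ 2 * sig u p).
Proof.
move=> u1; have d1 := is_derive_U0 u1.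
have d2 := is_derive_funM d1 (is_derive_cst (p0 p) u 1).
have d3 := is_derive_funM (is_derive_id u (1 : R)) d1.
have d4 := is_derive_funM d3 (is_derive_cst (- p) u 1).
have d5 := is_derive_funD d2 d4.
have -> : (fun u => energy u p) =
  fun u => U0 u * cst (p0 p) u + u * U0 u * cst (- p) u.
  by apply/funext => y; rewrite /energy /U1 /= mulrN.
apply: (is_derive_eq d5); rewrite /= sigE// /U1 !mulr0 !addr0 mul1r.
rewrite [LHS](_ : _ = U0 u ^+ 2 * (u * U0 u * p0 p - U0 u * p) + p * (U0 u ^+ 3 - (U0 u + u ^+ 2 * U0 u ^+ 3))); last by ring.
by rewrite -(cube_U0 u1) subrr mulr0 addr0.
Qed.

Lemma is_derive_sig_velocity u p : `|u| < 1 ->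
  is_derive u 1 (fun u => sig u p) (U0 u ^+ 2 * energy u p).
Proof.
move=> u1; have d1 := is_derive_U0 u1.
have d3 := is_derive_funM (is_derive_id u (1 : R)) d1.
have d4 := is_derive_funM d3 (is_derive_cst (p0 p) u 1).
have d2 := is_derive_funM d1 (is_derive_cst (- p) u 1).
have d5 := is_derive_funD d4 d2.
apply: (@near_eq_is_derive _ _ _
  (fun u => u * U0 u * cst (p0 p) u + U0 u * cst (- p) u)).
  have : \near u, `|u| < 1.
    have c : continuous (fun y : R => `|y|) by exact: norm_continuous.
    by near=> y; near: y; exact: (cvgr_lt _ (c u)).
  move=> H; near=> y; rewrite sigE /=; first by rewrite /U1 mulrN.
  by near: y.
apply: (is_derive_eq d5); rewrite /energy /U1 /= !mulr0 !addr0 mul1r.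
rewrite [LHS](_ : _ = U0 u ^+ 2 * (U0 u * p0 p - u * U0 u * p) + - p0 p * (U0 u ^+ 3 - (U0 u + u ^+ 2 * U0 u ^+ 3))); last by ring.
by rewrite -(cube_U0 u1) subrr mulr0 addr0.
Unshelve. all: by end_near.
Qed.

Let kap z : R := mom z 2 / mom z 1.

Lemma is_derive_gJ_velocity u (th : R) p : `|u| < 1 ->
  is_derive u 1 (fun u => gJ u th p)
    (gJ u th p * (- th^-1 * (U0 u ^+ 2 * sig u p))).
Proof.
move=> u1; have d1 := is_derive_energy_velocity p u1.
have d2 := is_derive_funM (is_derive_cst (- th^-1) u 1) d1.
have d3 := is_derive_compE d2 (is_derive_expR _) erefl.
have d4 := is_derive_funM (is_derive_cst (2 * bessel_K 1 th^-1)^-1 u 1) d3.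
by apply: (is_derive_eq d4); rewrite /gJ /= !mul0r !add0r !mulrA.
Qed.

Lemma is_derive_gJ_inverse_temperature u z p : 0 < z ->
  is_derive z 1 (fun z => gJ u z^-1 p) (gJ u z^-1 p * (kap z - energy u p)).
Proof.
move=> z0; have K0 : mom z 1 != 0 by rewrite gt_eqF// mom_gt0.
set e := energy u p.
have -> : (fun z => gJ u z^-1 p) = fun z => (2 * mom z 1)^-1 * expR (- e * z).
  by apply/funext => y; rewrite /gJ invrK bessel_K1E mulNr [y * _]mulrC -mulNr.
have d1 := is_derive_funM (is_derive_cst (2 : R) z 1) (is_derive_mom 1 z0).
have n0 : cst 2 z * mom z 1 != 0 :> R by rewrite mulf_neq0//= pnatr_eq0.
have d2 := is_derive_funV d1 n0.
have d3 := is_derive_funM (is_derive_cst (- e) z 1) (is_derive_id z (1 : R)).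
have d4 := is_derive_compE d3 (is_derive_expR _) erefl.
apply: (is_derive_eq (is_derive_funM d2 d4)).
rewrite /gJ invrK bessel_K1E -/e /= (_ : - z * e = - e * z) /kap; last by ring.
by move: (expR _) => x; field.
Qed.

Variables (M : nat) (W : 'cV[R]_(M.+1 + M)).
Hypotheses (M0 : (0 < M)%N) (u1 : `|u_ W| < 1) (th0 : 0 < theta_ W).

Let z := (theta_ W)^-1.
Let z0 : 0 < z.
Proof. by rewrite invr_gt0. Qed.

Let shift_coord (h : R) (j : 'I_(M.+1 + M)) k : (k < M.+1 + M)%N ->
  coordW (h *: delta_mx j 0 + W) k = h * (k == j)%:R + coordW W k.
Proof.
by move=> kN; rewrite /coordW !mxE eqxx andbT -val_eqE /= inordK.
Qed.

Let shift_even (h : R) j y :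
  even_profile (h *: delta_mx j 0 + W) y = even_profile W y + h *: even_shape y j.
Proof.
rewrite [RHS]addrC /even_profile.
transitivity (\sum_i (h * (i == j)%:R) *: even_shape y i +
              \sum_i W i 0 *: even_shape y i).
  by rewrite -big_split; apply: eq_bigr => i _; rewrite !mxE eqxx andbT scalerDl.
congr (_ + _); rewrite (bigD1 j)//= big1 => [|i /negPf ->].
  by rewrite eqxx mulr1 addr0.
by rewrite mulr0 scale0r.
Qed.

Let shift_odd (h : R) j y :
  odd_profile (h *: delta_mx j 0 + W) y = odd_profile W y + h *: odd_shape y j.
Proof.
rewrite [RHS]addrC /odd_profile.
transitivity (\sum_i (h * (i == j)%:R) *: odd_shape y i +
              \sum_i W i 0 *: odd_shape y i).
  by rewrite -big_split; apply: eq_bigr => i _; rewrite !mxE eqxx andbT scalerDl.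
congr (_ + _); rewrite (bigD1 j)//= big1 => [|i /negPf ->].
  by rewrite eqxx mulr1 addr0.
by rewrite mulr0 scale0r.
Qed.

Let pdiff_shapes j :
  (exists dQ, pdiff z (fun y => even_shape y j) dQ) /\
  (exists dQ, pdiff z (fun y => odd_shape y j) dQ).
Proof.
have kern l n : exists dQ, pdiff z (fun y => kernel0 y l n) dQ.
  have [|dS hS] := @pdiff_sum R z n
    (fun k y => (gs (wmom y l) k).[0] *: gs (wmom y l) k).
    move=> k; have [dQ hQ] := pdiff_gs_wmom z0 l k.
    by eexists; exact: pdiffZ (pdiff_horner 0 hQ) hQ.
  by eexists; exact: pdiffN hS.
have c A : exists dQ, pdiff z (fun=> A) dQ by exists 0; exact: pdiff_cst.
have g l n : exists dQ, pdiff z (fun y => gs (wmom y l) n) dQ.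
  exact: pdiff_gs_wmom.
case: j => [|[|[|[|[|j]]]]].
- by split; exact: c.
- by split; exact: c.
- by split; exact: c.
- by split; [exact: kern | exact: c].
- by split; [exact: c | exact: kern].
rewrite /even_shape /odd_shape; case: (_ == 0%N).
  by split; [exact: g | exact: c].
by split; [exact: c | exact: g].
Qed.

Lemma pdiff_even_profile : exists dA, pdiff z (even_profile W) dA.
Proof.
apply: pdiff_sum => j; have [[dQ hQ] _] := pdiff_shapes j.
by eexists; exact: pdiffZ (is_derive_cst _ _ _) hQ.
Qed.

Lemma pdiff_odd_profile : exists dB, pdiff z (odd_profile W) dB.
Proof.
apply: pdiff_sum => j; have [_ [dQ hQ]] := pdiff_shapes j.
by eexists; exact: pdiffZ (is_derive_cst _ _ _) hQ.
Qed.

Variables dA dB : {poly R}.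
Hypotheses (hA : pdiff z (even_profile W) dA) (hB : pdiff z (odd_profile W) dB).

Let A := even_profile W z.
Let B := odd_profile W z.
Let U := U0 (u_ W).

(** The two components of the partial derivatives of [F]. For [j = 1] use
    [dx/du = U^2 s], [ds/du = U^2 x] and the factor [- z dx/du] from [g]; for
    [j = 2] use [dz/dtheta = - z^2] and the factor [kap - x] from [g]. *)
Definition even_tangent j : {poly R} :=
  match j with
  | 1 => U ^+ 2 *: ('X * B + ('X^2 - 1) * B^`() - z *: (('X^2 - 1) * B))
  | 2 => - z ^+ 2 *: (dA - 'X * A + kap z *: A)
  | _ => even_shape z j
  end.

Definition odd_tangent j : {poly R} :=
  match j with
  | 1 => U ^+ 2 *: (A^`() - z *: A)
  | 2 => - z ^+ 2 *: (dB - 'X * B + kap z *: B)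
  | _ => odd_shape z j
  end.

Lemma derive_F (j : 'I_(M.+1 + M)) p :
  'D_(delta_mx j 0) (fun W' => F W' p) W =
  gJ (u_ W) (theta_ W) p *
    ((even_tangent j).[energy (u_ W) p] +
     sig (u_ W) p * (odd_tangent j).[energy (u_ W) p]).
Proof.
have N1 : (1 < M.+1 + M)%N by lia.
have N2 : (2 < M.+1 + M)%N by lia.
rewrite derive_line.
have ue h : u_ (h *: delta_mx j 0 + W) = h * (1 == j)%N%:R + u_ W.
  exact: shift_coord.
have te h : theta_ (h *: delta_mx j 0 + W) = h * (2 == j)%N%:R + theta_ W.
  exact: shift_coord.
have [j1|j1] := eqVneq (nat_of_ord j) 1%N.
  have -> : (fun h : R => F (h *: delta_mx j 0 + W) p) = fun h : R =>
     (fun v => gJ v (theta_ W) p * (A.[energy v p] + sig v p * B.[energy v p]))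
     (h + u_ W).
    apply/funext => h; have th' : theta_ (h *: delta_mx j 0 + W) = theta_ W.
      by rewrite te j1 mulr0 add0r.
    rewrite FE ?th'// ue j1 mulr1 shift_even shift_odd j1.
    by rewrite /= !scaler0 !addr0.
  have de := is_derive_energy_velocity p u1.
  have dA' := is_derive_compE de (is_derive_poly A _) erefl.
  have dB' := is_derive_compE de (is_derive_poly B _) erefl.
  have d1 := is_derive_funD dA' (is_derive_funM (is_derive_sig_velocity p u1) dB').
  have d2 := is_derive_funM (is_derive_gJ_velocity (theta_ W) p u1) d1.
  have [_ ->] := is_derive_shift d2.
  rewrite j1 /even_tangent /odd_tangent -/z -/U.
  have e2 : ('X^2 - 1 : {poly R}).[energy (u_ W) p] = sig (u_ W) p ^+ 2.
    by rewrite hornerD hornerN hornerXn hornerC sqr_energy// addrC addKr.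
  rewrite !(hornerD, hornerN, hornerZ) !hornerM e2 hornerX.
  move: (gJ _ _ _) (energy _ _) (sig _ _) => g x s.
  move: A.[x] B.[x] A^`().[x] B^`().[x] => a b a' b'.
  by ring.
have [j2|j2] := eqVneq (nat_of_ord j) 2%N.
  have ue' h : u_ (h *: delta_mx j 0 + W) = u_ W.
    by rewrite ue j2 mulr0 add0r.
  pose G y := gJ (u_ W) y^-1 p * ((even_profile W y).[energy (u_ W) p] +
              sig (u_ W) p * (odd_profile W y).[energy (u_ W) p]).
  have dG := is_derive_funM (is_derive_gJ_inverse_temperature (u_ W) p z0)
    (is_derive_funD (pdiff_horner (energy (u_ W) p) hA)
      (is_derive_funM (is_derive_cst (sig (u_ W) p) z 1)
        (pdiff_horner (energy (u_ W) p) hB))).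
  have dz := is_derive_funV (is_derive_id (theta_ W) (1 : R)) (lt0r_neq0 th0).
  have dGz := is_derive_shift (is_derive_compE dz (dG : is_derive (theta_ W)^-1 1 G _) erefl).
  have near_th : \forall h \near (0 : R), - theta_ W < h.
    by apply: (@cvgr_gt _ _ _ _ id 0 cvg_id); rewrite oppr_lt0.
  have eqF : \forall h \near (0 : R),
      G (h + theta_ W)^-1 = F (h *: delta_mx j 0 + W) p.
    apply: filterS near_th => h hth.
    have th' : theta_ (h *: delta_mx j 0 + W) = h + theta_ W by rewrite te j2 mulr1.
    rewrite FE ?th'// -?ltrBlDr ?sub0r//.
    by rewrite ue' shift_even shift_odd j2 /= !scaler0 !addr0 /G invrK.
  have [_ ->] := near_eq_is_derive eqF dGz.
  rewrite j2 /even_tangent /odd_tangent invrK /= -/A -/B -/(kap z).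
  rewrite !(hornerD, hornerN, hornerZ) !hornerM hornerX.
  have -> : - z ^+ 2 = -1 / theta_ W ^+ 2 by rewrite /z exprVn mulN1r.
  move: (gJ _ _ _) (energy _ _) (sig _ _) (-1 / _) => g x s y.
  move: A.[x] B.[x] dA.[x] dB.[x] (kap z) => a b a' b' k.
  by ring.
have -> : (fun h : R => F (h *: delta_mx j 0 + W) p) = fun h : R =>
   gJ (u_ W) (theta_ W) p * ((A.[energy (u_ W) p] + sig (u_ W) p * B.[energy (u_ W) p])
      + h * ((even_shape z j).[energy (u_ W) p] +
             sig (u_ W) p * (odd_shape z j).[energy (u_ W) p])).
  apply/funext => h; have th' : theta_ (h *: delta_mx j 0 + W) = theta_ W.
    by rewrite te [_ == _]eq_sym (negPf j2) mulr0 add0r.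
  have ue' : u_ (h *: delta_mx j 0 + W) = u_ W.
    by rewrite ue [_ == _]eq_sym (negPf j1) mulr0 add0r.
  rewrite FE ?th'// ue' shift_even shift_odd !hornerD !hornerZ -/A -/B -/z.
  by congr (_ * _); ring.
have d1 := is_derive_funM (is_derive_id (0 : R) 1) (is_derive_cst
  ((even_shape z j).[energy (u_ W) p] +
             sig (u_ W) p * (odd_shape z j).[energy (u_ W) p]) (0 : R) 1).
have d2 := is_derive_funD (is_derive_cst (A.[energy (u_ W) p] + sig (u_ W) p * B.[energy (u_ W) p]) (0 : R) 1) d1.
have d3 := is_derive_funM (is_derive_cst (gJ (u_ W) (theta_ W) p) (0 : R) 1) d2.
have [_ ->] := d3; rewrite /= !mul0r !add0r addr0 mul1r.
by move: j1 j2; rewrite /even_tangent /odd_tangent; case: (nat_of_ord j) => [|[|[|k]]].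
Qed.

End StateDerivative.

(** * Pairings with polynomials of low degree *)

Section ProfilePairings.
Variables (R : realType) (M : nat).
Hypothesis M0 : (0 < M)%N.
Implicit Types (y : R) (V : 'cV[R]_(M.+1 + M)) (A : {poly R}).

(** For [M = 1] the state has no bulk pressure and no diffusion flux: there is no
    coordinate 3 or 4. *)
Definition bulk V : R := if M == 1%N then 0 else coordW V 3.
Definition diffusion V : R := if M == 1%N then 0 else coordW V 4.

Lemma kernel0_pairing y l n A : 0 < y -> (size A <= n)%N ->
  momfun (wmom y l) (kernel0 y l n * A) = - A.[0].
Proof.
move=> y0 sA; rewrite mulNr momfunN mulr_suml momfun_sum; congr (- _).
rewrite -[RHS](reproducing 0 (gs_orthonormal (wmom_positive y0 l)) sA).
by apply: eq_bigr => k _; rewrite -scalerAl momfun_scale [A * _]mulrC.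
Qed.

Lemma gs_pairing_eq0 y l n A : 0 < y -> (size A <= n)%N ->
  momfun (wmom y l) (gs (wmom y l) n * A) = 0.
Proof.
move=> y0; apply: orthonormal_orth.
exact: orthonormal_familyW (gs_orthonormal (wmom_positive y0 l)).
Qed.

Let label_tail j : (5 <= j)%N ->
  if (moment_label j).1 == 0%N then (3 <= (moment_label j).2)%N
  else (2 <= (moment_label j).2)%N.
Proof.
move=> j5; rewrite /moment_label; have -> : (j == 0%N) = false by lia.
by have := odd_double_half j; have := uphalf_half j; rewrite -uphalfE;
  case: (odd j) => /=; lia.
Qed.

Let sum_coord (f : nat -> R) (V : 'cV[R]_(M.+1 + M)) :
  \sum_j V j 0 * f j = \sum_(0 <= j < M.+1 + M) coordW V j * f j.
Proof. by rewrite big_mkord; apply: eq_bigr => j _; rewrite coordWE. Qed.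

Let sum_head (f : nat -> R) V : f 1%N = 0 -> f 2%N = 0 ->
  (forall j, (5 <= j)%N -> f j = 0) ->
  \sum_j V j 0 * f j = coordW V 0 * f 0%N + bulk V * f 3%N + diffusion V * f 4%N.
Proof.
move=> f1 f2 f5; rewrite sum_coord /bulk /diffusion.
have [M1|M1] := eqVneq M 1%N.
  rewrite [in index_iota _ _]M1 !big_nat_recr//= big_geq// f1 f2 !mul0r.
  by rewrite !mulr0 !addr0 add0r.
have le5 : (5 <= M.+1 + M)%N by lia.
have tail0 : \sum_(5 <= j < M.+1 + M) coordW V j * f j = 0.
  by rewrite big_nat; apply: big1 => j /andP[j5 _]; rewrite f5// mulr0.
rewrite (big_cat_nat _ le5)//= tail0 addr0.
by rewrite !big_nat_recr//= big_geq// f1 f2 !mulr0 !addr0 add0r.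
Qed.

(** The coordinates from 5 on multiply polynomials of degree at least 3, which
    are orthogonal to [A]; the bulk pressure multiplies a reproducing kernel. *)
Lemma even_profile_pairing y V A : 0 < y -> (size A <= minn M.+1 3)%N ->
  momfun (wmom y 0) (even_profile V y * A) =
  coordW V 0 * momfun (wmom y 0) A - bulk V * A.[0].
Proof.
move=> y0; rewrite leq_min => /andP[sM s3].
rewrite /even_profile mulr_suml momfun_sum.
transitivity (\sum_j V j 0 * momfun (wmom y 0) (even_shape y j * A)).
  by apply: eq_bigr => j _; rewrite -scalerAl momfun_scale.
rewrite (sum_head (f := fun j => momfun (wmom y 0) (even_shape y j * A))) /even_shape ?mul0r ?momfun0//.
  by rewrite mul1r kernel0_pairing// mulr0 addr0 mulrN.
move=> [|[|[|[|[|j]]]]]// _; have := @label_tail j.+1.+4 isT.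
case: ifP => _ k2; last by rewrite mul0r momfun0.
by rewrite gs_pairing_eq0// (leq_trans s3).
Qed.

Lemma odd_profile_pairing y V A : 0 < y -> (size A <= minn M 2)%N ->
  momfun (wmom y 1) (odd_profile V y * A) = - (diffusion V * A.[0]).
Proof.
move=> y0; rewrite leq_min => /andP[sM s2].
rewrite /odd_profile mulr_suml momfun_sum.
transitivity (\sum_j V j 0 * momfun (wmom y 1) (odd_shape y j * A)).
  by apply: eq_bigr => j _; rewrite -scalerAl momfun_scale.
rewrite (sum_head (f := fun j => momfun (wmom y 1) (odd_shape y j * A))) /odd_shape ?mul0r ?momfun0//.
  by rewrite kernel0_pairing// !mulr0 !add0r mulrN.
move=> [|[|[|[|[|j]]]]]// _; have := @label_tail j.+1.+4 isT.
case: ifP => _ k2; first by rewrite mul0r momfun0.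
by rewrite gs_pairing_eq0// (leq_trans s2).
Qed.

End ProfilePairings.

Section TangentPairings.
Variables (R : realType) (M : nat) (W : 'cV[R]_(M.+1 + M)).
Hypotheses (M0 : (0 < M)%N) (u1 : `|u_ W| < 1) (th0 : 0 < theta_ W).

Let z := (theta_ W)^-1.
Let z0 : 0 < z.
Proof. by rewrite invr_gt0. Qed.

Variables dA dB : {poly R}.
Hypotheses (hA : pdiff z (even_profile W) dA) (hB : pdiff z (odd_profile W) dB).

Let L := momfun (wmom z 0).
Let S : {poly R} := 'X^2 - 1.
Let ET := even_tangent W dA.
Let OT := odd_tangent W dB.
Let U := U0 (u_ W).
Let A := even_profile W z.
Let B := odd_profile W z.

Implicit Types (p q : {poly R}).

Let near_z : \forall y \near z, 0 < y.
Proof. by apply: (@cvgr_gt _ _ _ _ id z cvg_id). Qed.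

(** The velocity derivative is moved to the test polynomial by
    [wmom_by_parts], which lowers its degree and exchanges the parities. *)
Lemma velocity_even_pairing p : (size p <= minn M.+1 3)%N ->
  L (ET 1 * p) = U ^+ 2 * (diffusion W * p^`().[0]).
Proof.
move=> sp; have sp' : (size p^`() <= minn M 2)%N.
  have := size_poly _ _ : (size p^`() <= (size p).-1)%N.
  by move: sp; rewrite !leq_min => /andP[h1 h2] h3; apply/andP; split; lia.
rewrite /ET /even_tangent -/z -/B -/U -scalerAl [LHS]momfun_scale; congr (_ * _).
have h := wmom_by_parts z0 (B * p).
have -> : ('X * B + ('X^2 - 1) * B^`() - z *: (('X^2 - 1) * B)) * p =
  ('X * (B * p) + ('X^2 - 1) * (B * p)^`()) - z *: (('X^2 - 1) * (B * p))
  - B * p^`() * ('X^2 - 1).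
  by rewrite derivM -!mul_polyC; ring.
rewrite [LHS]momfunB momfunB h momfun_scale subrr sub0r -momfun_wmom1.
by rewrite odd_profile_pairing// opprK.
Qed.

Lemma velocity_odd_pairing q : (size q <= minn M 2)%N ->
  L (OT 1 * (q * S)) =
  - (U ^+ 2 * (rho_ W * L ('X * q + S * q^`()) + bulk W * q^`().[0])).
Proof.
move=> sq; pose r := 'X * q + S * q^`().
have sr : (size r <= minn M.+1 3)%N.
  have [q0|q0] := eqVneq q 0; first by rewrite /r q0 deriv0 !mulr0 addr0 size_poly0.
  have sq0 : (0 < size q)%N by rewrite size_poly_gt0.
  have sq' := size_poly _ _ : (size q^`() <= (size q).-1)%N.
  have h1 := size_polyMleq 'X q; have h2 := size_polyMleq S q^`().
  have h3 := size_polyD ('X * q) (S * q^`()); rewrite -/r in h3.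
  move: sq h1 h2 h3; rewrite size_polyX size_XnsubC// !leq_min leq_max.
  by move=> /andP[k1 k2] h1 h2 /orP[h3|h3]; apply/andP; split; lia.
have r0 : r.[0] = - q^`().[0].
  by rewrite /r /S !hornerE /= expr0n /=; ring.
rewrite /OT /odd_tangent -/z -/A -/U -scalerAl [LHS]momfun_scale -mulrN.
congr (_ * _); have h := wmom_by_parts z0 (A * q).
have -> : (A^`() - z *: A) * (q * S) =
  ('X * (A * q) + ('X^2 - 1) * (A * q)^`()) - z *: (('X^2 - 1) * (A * q))
  - A * r.
  by rewrite derivM -!mul_polyC /r /S; ring.
rewrite [LHS]momfunB momfunB h momfun_scale subrr sub0r.
by rewrite even_profile_pairing// r0 mulrN opprK.
Qed.

(** The pairing is the derivative of [rho L_z (p) - Pi p(0)] in [z], in which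
    only the first term depends on [z]. *)
Lemma thermal_even_pairing p : (size p <= minn M.+1 3)%N ->
  L (ET 2 * p) = - (z ^+ 2 * (rho_ W * momfun (dwmom z 0) p)).
Proof.
move=> sp; rewrite /ET /even_tangent -/z -/A -scalerAl [LHS]momfun_scale mulNr.
congr (- (_ * _)).
have d1 := is_derive_pairing z0 0 (pdiffM hA (pdiff_cst z p)).
have d2 := pdiff_momfun (is_derive_wmom z0 0) (pdiff_cst z p).
have d3 := is_derive_funM (is_derive_cst (rho_ W) z 1) d2.
have d4 := is_derive_funD d3 (is_derive_cst (- (bulk W * p.[0])) z 1).
have e : \forall y \near z, cst (rho_ W) y * momfun (wmom y 0) p +
    cst (- (bulk W * p.[0])) y = momfun (wmom y 0) (even_profile W y * p).
  by apply: filterS near_z => y y0; rewrite even_profile_pairing.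
have [_ e4] := near_eq_is_derive e d4; have [_ e1] := d1.
move: e1; rewrite e4 momfun0 mul0r /= !add0r addr0 => ->.
by congr (momfun _ _); rewrite mulr0 addr0 -!mul_polyC /A; ring.
Qed.

Lemma thermal_odd_pairing q : (size q <= minn M 2)%N -> L (OT 2 * (q * S)) = 0.
Proof.
move=> sq; rewrite /OT /odd_tangent -/z -/B -scalerAl [LHS]momfun_scale.
rewrite [_ * (q * S)]mulrA -[momfun _ (_ * S)]momfun_wmom1.
have d1 := is_derive_pairing z0 1 (pdiffM hB (pdiff_cst z q)).
have e : \forall y \near z, cst (- (diffusion W * q.[0])) y =
    momfun (wmom y 1) (odd_profile W y * q).
  by apply: filterS near_z => y y0; rewrite odd_profile_pairing.
have [_ e4] := near_eq_is_derive e (is_derive_cst (- (diffusion W * q.[0])) z 1).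
have [_ e1] := d1; move: e1; rewrite e4 => e1.
rewrite [X in _ * X](_ : _ = 0) ?mulr0// [RHS]e1.
by congr (momfun _ _); rewrite mulr0 addr0 -!mul_polyC /B; ring.
Qed.

End TangentPairings.

(** * Injectivity of the change of variables *)

Section Injectivity.
Variables (R : realType) (M : nat) (W : 'cV[R]_(M.+1 + M)).
Hypotheses (M0 : (0 < M)%N) (u1 : `|u_ W| < 1) (th0 : 0 < theta_ W).
Hypothesis rho0 : 0 < rho_ W.
Hypothesis pressure0 : (2 <= M)%N -> - (rho_ W * theta_ W) < Pi_ W.

Let z := (theta_ W)^-1.
Let z0 : 0 < z.
Proof. by rewrite invr_gt0. Qed.

Let L := momfun (wmom z 0).
Let S : {poly R} := 'X^2 - 1.
Implicit Types (p q A : {poly R}).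

Let even_index k : (k <= M)%N ->
  exists i : 'I_(M.+1 + M), moment_label i = (0, k)%N.
Proof.
move=> kM; have iN : (k.*2.-1 < M.+1 + M)%N by rewrite -addnn; lia.
exists (Ordinal iN); rewrite /moment_label /=.
case: k {kM iN} => [//|k]; rewrite doubleS /= uphalf_double.
by rewrite odd_double doubleK.
Qed.

Let odd_index k : (k < M)%N ->
  exists i : 'I_(M.+1 + M), moment_label i = (1, k)%N.
Proof.
move=> kM; have iN : (k.+1.*2 < M.+1 + M)%N by rewrite -addnn; lia.
exists (Ordinal iN); rewrite /moment_label /= odd_double.
by rewrite doubleK.
Qed.

Section Tangent.
Variables dA dB : {poly R}.
Hypotheses (hA : pdiff z (even_profile W) dA) (hB : pdiff z (odd_profile W) dB).
Let ET := even_tangent W dA.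
Let OT := odd_tangent W dB.

(** A column of [D_M] pairs one tangent with basis functions of both parities,
    and each parity sees only one of its components. *)
Lemma Dmx_entry (k j : 'I_(M.+1 + M)) : Dmx W k j =
  if (moment_label k).1 == 0%N
  then L (ET j * opoly 0 z (moment_label k).2)
  else L (OT j * (opoly 1 z (moment_label k).2 * S)).
Proof.
rewrite mxE.
have -> : (fun p : R => 'D_(delta_mx j 0) ((@F R M)^~ p) W) = fun p : R =>
  gJ (u_ W) (theta_ W) p * ((ET j).[energy (u_ W) p] +
     sig (u_ W) p * (OT j).[energy (u_ W) p]).
  by apply/funext => p; exact: derive_F.
pose pe : {poly R} := if (moment_label k).1 == 0%N
  then opoly 0 z (moment_label k).2 else 0.
pose qe : {poly R} := if (moment_label k).1 == 0%N
  then 0 else opoly 1 z (moment_label k).2.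
have -> : Pbasis (u_ W) (theta_ W) k = fun p : R =>
  gJ (u_ W) (theta_ W) p * (pe.[energy (u_ W) p] +
     sig (u_ W) p * qe.[energy (u_ W) p]).
  apply/funext => p; rewrite /Pbasis /Ptilde /pe /qe -mulrA; congr (_ * _).
  case: (moment_label k) (moment_label_lt2 k) => [[|[|//]] n] _ /=.
    by rewrite expr0 mulr1 horner0 mulr0 addr0.
  by rewrite expr1 horner0 add0r mulrC.
rewrite pdot_horner// -momfun_wmom0 /pe /qe; case: ifP => _.
  by rewrite mulr0 mul0r addr0.
by rewrite mulr0 add0r -mulrA.
Qed.

Variable v : 'cV[R]_(M.+1 + M).
Hypothesis Dv0 : Dmx W *m v = 0.

Let X := even_profile v z + coordW v 1 *: ET 1 + coordW v 2 *: ET 2.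
Let Y := odd_profile v z + coordW v 1 *: OT 1 + coordW v 2 *: OT 2.

Let N1 : (1 < M.+1 + M)%N. Proof. by lia. Qed.
Let N2 : (2 < M.+1 + M)%N. Proof. by lia. Qed.

Let split_sum (f g : nat -> {poly R}) : (forall j, j != 1%N -> j != 2%N -> f j = g j) ->
  g 1%N = 0 -> g 2%N = 0 ->
  \sum_j v j 0 *: f j =
  \sum_j v j 0 *: g j + coordW v 1 *: f 1%N + coordW v 2 *: f 2%N.
Proof.
move=> fg g1 g2; pose o1 := Ordinal N1; pose o2 := Ordinal N2.
apply/eqP; rewrite -addrA addrC -subr_eq -sumrB; apply/eqP.
rewrite (eq_bigr (fun j : 'I_(M.+1 + M) => v j 0 *: (f j - g j))) => [|j _]; last by rewrite scalerBr.
rewrite (bigD1 o1)//= (bigD1 o2)//= big1 => [|j /andP[j1 j2]].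
  by rewrite g1 g2 !subr0 !coordWE addr0.
by rewrite fg ?subrr ?scaler0.
Qed.

Let row0 (i : 'I_(M.+1 + M)) : \sum_j v j 0 * Dmx W i j = 0.
Proof.
have /matrixP/(_ i 0) := Dv0; rewrite !mxE => h; rewrite -[RHS]h.
by apply: eq_bigr => j _; rewrite mulrC.
Qed.

Lemma kernel_even p : (size p <= M.+1)%N -> L (X * p) = 0.
Proof.
have XE : X = \sum_j v j 0 *: ET j.
  rewrite (@split_sum ET (even_shape z))// => [[|[|[|[|[|j]]]]]] //.
have LX r : L (X * r) = \sum_j v j 0 * L (ET j * r).
  rewrite XE mulr_suml /L momfun_sum; apply: eq_bigr => j _.
  by rewrite -scalerAl momfun_scale.
move=> sp; have fP := orthonormal_familyW M.+1 (opoly_orthonormal z0 (isT : (0 < 2)%N)).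
rewrite (orthonormal_expand fP sp) mulr_sumr /L momfun_sum; apply: big1 => k _.
rewrite -scalerAr momfun_scale.
have [i ik] := even_index (ltn_ord k : (k <= M)%N).
rewrite -/L LX [X in _ * X](_ : _ = 0) ?mulr0// -[RHS](row0 i).
by apply: eq_bigr => j _; rewrite Dmx_entry ik.
Qed.

Lemma kernel_odd q : (size q <= M)%N -> L (Y * (q * S)) = 0.
Proof.
have YE : Y = \sum_j v j 0 *: OT j.
  rewrite (@split_sum OT (odd_shape z))// => [[|[|[|[|[|j]]]]]] //.
have LY r : L (Y * r) = \sum_j v j 0 * L (OT j * r).
  rewrite YE mulr_suml /L momfun_sum; apply: eq_bigr => j _.
  by rewrite -scalerAl momfun_scale.
move=> sq; have fP := orthonormal_familyW M (opoly_orthonormal z0 (isT : (1 < 2)%N)).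
rewrite (orthonormal_expand fP sq) mulr_suml mulr_sumr /L momfun_sum; apply: big1 => k _.
rewrite -scalerAl -scalerAr momfun_scale.
have [i ik] := odd_index (ltn_ord k).
rewrite -/L LY [X in _ * X](_ : _ = 0) ?mulr0// -[RHS](row0 i).
by apply: eq_bigr => j _; rewrite Dmx_entry ik.
Qed.

Let L_combine (A B C p : {poly R}) (b c : R) :
  L ((A + b *: B + c *: C) * p) = L (A * p) + b * L (B * p) + c * L (C * p).
Proof. by rewrite !mulrDl -!scalerAl /L !momfunD !momfun_scale. Qed.

Lemma test_even p : (size p <= minn M.+1 3)%N ->
  coordW v 0 * L p - bulk v * p.[0]
  + coordW v 1 * (U0 (u_ W) ^+ 2 * (diffusion W * p^`().[0]))
  - coordW v 2 * (z ^+ 2 * (rho_ W * momfun (dwmom z 0) p)) = 0.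
Proof.
move=> sp; have := sp; rewrite leq_min => /andP[/kernel_even h _].
rewrite -[RHS]h /X L_combine.
have e1 : L (even_profile v z * p) = _ := even_profile_pairing M0 v z0 sp.
have e2 : L (ET 1 * p) = _ := velocity_even_pairing M0 u1 th0 dA sp.
have e3 : L (ET 2 * p) = _ := thermal_even_pairing M0 th0 hA sp.
by rewrite e1 e2 e3 mulrN.
Qed.

Lemma test_odd q : (size q <= minn M 2)%N ->
  diffusion v * q.[0] + coordW v 1 *
    (U0 (u_ W) ^+ 2 * (rho_ W * L ('X * q + S * q^`()) + bulk W * q^`().[0])) = 0.
Proof.
move=> sq; have := sq; rewrite leq_min => /andP[/kernel_odd h _].
apply: oppr_inj; rewrite oppr0 -[RHS]h /Y L_combine.
have e1 : L (odd_profile v z * (q * S)) = - (diffusion v * q.[0]).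
  by rewrite mulrA /L -momfun_wmom1; exact: odd_profile_pairing.
have e2 : L (OT 1 * (q * S)) = _ := velocity_odd_pairing M0 u1 th0 dB sq.
have e3 : L (OT 2 * (q * S)) = _ := thermal_odd_pairing M0 th0 hB sq.
by rewrite e1 e2 e3 mulr0 addr0 mulrN opprD.
Qed.

Let LX : L 'X = 1.
Proof. by rewrite /L -[X in momfun _ X]expr1 momfunXn wmom01. Qed.

Let cancel_right (a b : R) : a * b = 0 -> b != 0 -> a = 0.
Proof. by move=> ab b0; apply/eqP; move/eqP: ab; rewrite mulf_eq0 (negPf b0) orbF. Qed.

Let extra0 (V : 'cV[R]_(M.+1 + M)) : M = 1%N -> (bulk V = 0) * (diffusion V = 0).
Proof. by move=> M1; rewrite /bulk /diffusion; case: eqP. Qed.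

Let size1P : (size (1%:P : {poly R}) = 1)%N.
Proof. by rewrite polyC1 size_poly1. Qed.

(** The tests are [s x] when [2 <= M], which isolates the velocity with the
    coefficient [rho L (x^2) + rho theta + Pi], and [s] when [M = 1]. *)
Lemma velocity_coord0 : coordW v 1 = 0.
Proof.
have U2 : 0 < U0 (u_ W) ^+ 2 by rewrite exprn_gt0// U0_gt0.
have [M1|M1] := eqVneq M 1%N.
  have s1 : (size (1%:P : {poly R}) <= minn M 2)%N by rewrite size1P leq_min M0.
  have := test_odd s1.
  rewrite !(extra0 _ M1) !mul0r add0r addr0.
  rewrite derivC mulr0 polyC1 mulr1 addr0 LX mulr1 => /cancel_right; apply.
  by rewrite gt_eqF// mulr_gt0.
have M2 : (2 <= M)%N by lia.
have s2 : (size ('X : {poly R}) <= minn M 2)%N by rewrite size_polyX leq_min M2.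
have := test_odd s2.
rewrite /diffusion /bulk (negPf M1) hornerX mulr0 add0r derivX.
have -> : 'X * 'X + S * 1 = 'X^2 + S by rewrite mulr1.
rewrite -polyC1 hornerC mulr1 /L momfunD wmom0_pressure// momfunXn => /cancel_right; apply.
have k2 : 0 < wmom z 0 2 by rewrite /wmom expr0 mulr1 momfunXn divr_gt0 ?mom_gt0.
rewrite gt_eqF// mulr_gt0// mulrDr -addrA addr_gt0 ?(mulr_gt0 rho0 k2)//.
by have := pressure0 M2; rewrite /z invrK -subr_gt0 opprK addrC.
Qed.

(* The tests are [x], then [x^2] (or [1] when [M = 1]), then [1]. *)
Let thermal_bulk_coord0 : [/\ coordW v 0 = 0, coordW v 2 = 0 & bulk v = 0].
Proof.
have c1 := velocity_coord0.
have sX : (size ('X : {poly R}) <= minn M.+1 3)%N.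
  by rewrite size_polyX leq_min ltnS M0.
have s1 : (size (1%:P : {poly R}) <= minn M.+1 3)%N by rewrite size1P leq_min.
have c0 : coordW v 0 = 0.
  have := test_even sX; rewrite hornerX mulr0 LX c1 !mul0r mulr1 subr0 addr0.
  rewrite -[X in momfun (dwmom z 0) X]expr1 momfunXn dwmom1// !mulr0.
  by rewrite subr0.
have zr : z ^+ 2 * rho_ W != 0 by rewrite mulf_neq0 ?expf_neq0// gt_eqF.
have t1 := test_even s1; move: t1.
rewrite c0 c1 !mul0r hornerC mulr1 addr0 sub0r.
rewrite -[X in momfun (dwmom z 0) X]/('X^0) momfunXn => t1.
have [M1|M1] := eqVneq M 1%N.
  have b0 : bulk v = 0 by rewrite (extra0 _ M1).
  move: t1; rewrite b0 oppr0 sub0r [z ^+ 2 * _]mulrA => /eqP; rewrite oppr_eq0 => /eqP.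
  move=> /cancel_right c2; split=> //; apply: c2.
  by rewrite mulf_neq0// dwmom0_neq0.
have M2 : (2 <= M)%N by lia.
have s2 : (size ('X^2 : {poly R}) <= minn M.+1 3)%N.
  by rewrite size_polyXn leq_min ltnS M2.
have c2 : coordW v 2 = 0.
  have := test_even s2; rewrite c0 c1 !mul0r hornerXn expr0n /= mulr0 subr0 addr0.
  rewrite sub0r momfunXn [z ^+ 2 * _]mulrA => /eqP; rewrite oppr_eq0 => /eqP.
  by move=> /cancel_right; apply; rewrite mulf_neq0// dwmom2_neq0.
by split=> //; move: t1; rewrite c2 mul0r subr0 => /eqP; rewrite oppr_eq0 => /eqP.
Qed.

Let flux_coord0 : diffusion v = 0.
Proof.
have s1 : (size (1%:P : {poly R}) <= minn M 2)%N by rewrite size1P leq_min M0.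
by have := test_odd s1; rewrite velocity_coord0 mul0r addr0 hornerC mulr1.
Qed.

Let small_coord0 (i : 'I_(M.+1 + M)) : (i < 5)%N -> v i 0 = 0.
Proof.
have [c0 c2 c3] := thermal_bulk_coord0; have c4 := flux_coord0.
have c1 := velocity_coord0; have iN := ltn_ord i; rewrite coordWE.
move: c3 c4 iN; rewrite /bulk /diffusion; have [M1|_] := eqVneq M 1%N.
  by case: (nat_of_ord i) => [|[|[|k]]] //; lia.
by move=> c3 c4 _; case: (nat_of_ord i) => [|[|[|[|[|k]]]]].
Qed.

Let profile_coord (f : nat -> {poly R}) l (i : 'I_(M.+1 + M)) :
  (forall j, (5 <= j)%N -> f j =
    if (moment_label j).1 == l then gs (wmom z l) (moment_label j).2 else 0) ->
  (moment_label i).1 = l -> (5 <= i)%N ->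
  momfun (wmom z l) ((\sum_j v j 0 *: f j) * gs (wmom z l) (moment_label i).2) =
  v i 0.
Proof.
move=> fE il i5; have [_ orth] := gs_orthonormal (wmom_positive z0 l).
rewrite mulr_suml momfun_sum (bigD1 i)//= big1 => [|j ji].
  by rewrite -scalerAl momfun_scale fE// il eqxx orth eqxx mulr1 addr0.
rewrite -scalerAl momfun_scale.
have [j5|j5] := ltnP j 5; first by rewrite small_coord0// mul0r.
rewrite fE//; case: eqP => jl; last by rewrite mul0r momfun0 mulr0.
rewrite orth; case: eqP => [e|_]; last by rewrite mulr0.
have jiE : moment_label j = moment_label i.
  by rewrite [LHS]surjective_pairing [RHS]surjective_pairing jl il e.
have ij : j = i by apply: val_inj; exact: moment_label_inj.
by rewrite ij eqxx in ji.
Qed.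

Let label_bound (i : 'I_(M.+1 + M)) :
  if (moment_label i).1 == 0%N then ((moment_label i).2 < M.+1)%N
  else ((moment_label i).2 < M)%N.
Proof.
have iN := ltn_ord i; have iE := odd_double_half i; move: iN iE.
rewrite /moment_label; move: (nat_of_ord i) => {}i.
have [//|i0] := eqVneq i 0%N.
by case io: (odd i); rewrite /= ?uphalf_half ?io -muln2; lia.
Qed.

(** Once the first five coordinates vanish, only orthonormal basis functions
    remain in the combination. *)
Lemma kernel_trivial : v = 0.
Proof.
apply/matrixP => i j; rewrite ord1 mxE.
have [i5|i5] := ltnP i 5; first exact: small_coord0.
have [_ c2 _] := thermal_bulk_coord0; have c1 := velocity_coord0.
have XE : X = even_profile v z by rewrite /X c1 c2 !scale0r !addr0.
have YE : Y = odd_profile v z by rewrite /Y c1 c2 !scale0r !addr0.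
have := label_bound i; have := moment_label_lt2 i.
have sg l n : (size (gs (wmom z l) n) <= n.+1)%N := size_gs _ _.
case: (eqVneq (moment_label i).1 0%N) => [l0 _ kM|l0 l2 kM].
  have := kernel_even (leq_trans (sg 0%N _) kM); rewrite XE => <-.
  rewrite -(@profile_coord (even_shape z) 0 i)// => k.
  by case: k => [|[|[|[|[|k]]]]].
have l1 : (moment_label i).1 = 1%N by lia.
have := kernel_odd (leq_trans (sg 1%N _) kM); rewrite YE mulrA /L -momfun_wmom1.
move=> <-; rewrite -(@profile_coord (odd_shape z) 1 i)// => k.
case: k => [|[|[|[|[|k]]]]]// _; have := moment_label_lt2 k.+1.+4.
by rewrite /odd_shape; case: (moment_label _).1 => [|[|]].
Qed.

End Tangent.

Lemma Dmx_unit : Dmx W \in unitmx.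
Proof.
have [dA hA] := pdiff_even_profile th0; have [dB hB] := pdiff_odd_profile th0.
rewrite -unitmx_tr -row_free_unit -kermx_eq0; apply/rowV0P => v /sub_kermxP vD.
apply: trmx_inj; rewrite trmx0; apply: (kernel_trivial hA hB).
by rewrite -[Dmx W]trmxK -trmx_mul vD trmx0.
Qed.

End Injectivity.

Theorem theorem5p2 (R : realType) (M : nat) (hM : (1 <= M)%N)
    (W : 'cV[R]_(M.+1 + M)) (hW : admissible W) :
  B0 W \in unitmx /\
  real_distinct_spectrum (Bmx W) /\
  diagonalizable (Bmx W) /\
  spectral_radius (Bmx W) < 1.
Proof.
have [rho0 u1 th0 pressure] := hW.
exact: (hyperbolic_of_unit hM u1 th0 (Dmx_unit hM u1 th0 rho0 pressure)).
Qed.
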